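(* Let $A\subset\mathbb R^n$ be arbitrary. The following are equivalent: (i$_1$) $c_\alpha(A)<\infty$; (ii$_1$) for some (equivalently, every) $y\in\mathbb R^n$, with $q\in(1,\infty)$ fixed and $A_k:=A\cap\{x:\ q^k\le|x-y|<q^{k+1}\}$, one has $\sum_{k\in\mathbb N}c_\alpha(A_k)<\infty$; (iii$_1$) for some (equivalently, every) $y\in\mathbb R^n$, the measure $\varepsilon_y^{A_y^*}$ has finite energy; (iv$_1$) for some (equivalently, every) $y\in\mathbb R^n$, with $q\in(0,1)$ fixed and $R_k:=\{x:\ q^{k+1}<|x-y|\le q^k\}$, $$\sum_{k\in\mathbb N}\frac{c_\alpha(A_y^*\cap R_k)}{q^{2k(n-\alpha)}}<\infty.$$
   Context: Standing assumptions: $n\ge3$, $\alpha\in(0,2]$, and $\kappa_\alpha(x,y)=|x-y|^{\alpha-n}$ is the Riesz kernel on $\mathbb R^n$. $\mathfrak M^+$ denotes the cone of positive Radon measures $\mu$ on $\mathbb R^n$ whose potential $\kappa_\alpha\mu(x)=\int|x-z|^{\alpha-n}d\mu(z)$ is not identically $+\infty$. The energy of $\mu$ is $\|\mu\|_\alpha^2=\iint\kappa_\alpha\,d\mu\,d\mu$; $\mathcal E^+_\alpha(A)$ is the set of positive measures of finite energy concentrated on $A$. The inner capacity of $A\subset\mathbb R^n$ is defined by $1/c_\alpha(A)=\inf\{\|\mu\|_\alpha^2:\ \mu\in\mathcal E^+_\alpha(A),\ \mu(\mathbb R^n)=1\}$. ''n.e. on $A$'' means: for all points of $A$ except a subset of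 inner capacity zero. Inner balayage: for $\mu\in\mathfrak M^+$ and arbitrary $A$, $\mu^A$ is the unique measure in $\mathfrak M^+$ with $\kappa_\alpha\mu^A=\inf\{\kappa_\alpha\nu:\ \nu\in\mathfrak M^+,\ \kappa_\alpha\nu\ge\kappa_\alpha\mu \text{ n.e. on }A\}$ pointwise. $\varepsilon_y$ is the Dirac measure at $y$ and $\varepsilon_y^A:=(\varepsilon_y)^A$. Inversion: $J_y$ maps $x\neq y$ to the point $x^*$ on the ray from $y$ through $x$ with $|x-y|\,|x^*-y|=1$; $A_y^*:=J_y(A\setminus\{y\})$. *)

(* Defs.v *)
From HB Require Import structures.
From mathcomp Require Import all_boot all_order all_algebra.
From mathcomp Require Import all_classical all_reals all_analysis.
Set Implicit Arguments. Unset Strict Implicit. Unset Printing Implicit Defensive.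
Import Order.TTheory GRing.Theory Num.Theory.
Import numFieldNormedType.Exports.
Local Open Scope classical_set_scope.
Local Open Scope ring_scope.

Section Riesz.
Variables (R : realType) (n : nat) (alpha : R).

(* R^n as row vectors; Borel sigma-algebra = generated by the open sets
   of the (product = Euclidean) topology. *)
Definition Rn : measurableType _ := g_sigma_algebraType (@open 'rV[R]_n).

Definition eucl_dist (x y : Rn) : R :=
  Num.sqrt (\sum_(i < n) ((x : 'rV[R]_n) 0 i - (y : 'rV[R]_n) 0 i) ^+ 2).

Definition riesz_kernel (x y : Rn) : \bar R :=
  if x == y then +oo%E else (powR (eucl_dist x y) (alpha - n%:R))%:E.

Definition riesz_potential (mu : {measure set Rn -> \bar R}) (x : Rn) : \bar R :=
  (\int[mu]_z riesz_kernel x z)%E.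

Definition riesz_energy (mu : {measure set Rn -> \bar R}) : \bar R :=
  (\int[mu]_x \int[mu]_z riesz_kernel x z)%E.

Definition radon_measure (mu : {measure set Rn -> \bar R}) : Prop :=
  forall r : R, (mu [set x | (eucl_dist ((0%R : 'rV[R]_n) : Rn) x <= r)%R] < +oo)%E.

Definition Mplus (mu : {measure set Rn -> \bar R}) : Prop :=
  radon_measure mu /\ exists x, (riesz_potential mu x < +oo)%E.

Definition concentrated (mu : {measure set Rn -> \bar R}) (A : set Rn) : Prop :=
  mu.-negligible (~` A).

Definition inv_capacity (A : set Rn) : \bar R :=
  ereal_inf [set riesz_energy mu | mu in
    [set mu : {measure set Rn -> \bar R} |
       concentrated mu A /\ (riesz_energy mu < +oo)%E /\ mu setT = 1%E]].

Definition inner_capacity (A : set Rn) : \bar R :=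
  let e := inv_capacity A in
  if e == 0%E then +oo%E else if e == +oo%E then 0%E else ((fine e)^-1)%:E.

Definition nearly_everywhere (A : set Rn) (P : Rn -> Prop) : Prop :=
  exists E, E `<=` A /\ inner_capacity E = 0%E /\ forall x, A x -> ~ E x -> P x.

Definition is_balayage (mu : {measure set Rn -> \bar R}) (A : set Rn)
    (nu : {measure set Rn -> \bar R}) : Prop :=
  Mplus nu /\
  forall x, riesz_potential nu x =
    ereal_inf [set riesz_potential eta x | eta in
      [set eta : {measure set Rn -> \bar R} | Mplus eta /\
         nearly_everywhere A (fun z => (riesz_potential mu z <= riesz_potential eta z)%E)]].

Definition inversion_at (y x : Rn) : Rn :=
  ((y : 'rV[R]_n) + (eucl_dist x y ^- 2) *: ((x : 'rV[R]_n) - y)) : 'rV[R]_n.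

Definition inv_set (A : set Rn) (y : Rn) : set Rn :=
  inversion_at y @` (A `\ y).

End Riesz.

(* Main.v *)
(** (i) and (ii) are compared by cutting measures along annuli: neighbouring annuli
    aside, the mutual energies decay geometrically.  The inversion multiplies the
    capacity of a set lying in an annulus by a controlled factor, whence (iv).

    For (iii), write the Riesz kernel as a mixture of Gaussian densities with weight
    [t ^ (a - 1)], [a = alpha / 2], and convolve it with the law of [sqrt s * Z], where
    [Z] is Gaussian and [s] has density [a e ^ a s ^ (- a - 1)] on [s > e].  The kernel
    decreases, by [O(e)] away from the diagonal, but the potential of the Gaussian law
    decreases by at least [c * e * ln (1 / e)]; adding a small multiple of it to a
    superharmonic [p] makes the maximum of [pot nu - p] impossible off the support of
    [nu].  This gives the domination principle, without any positive definiteness of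
    the kernel.  An equilibrium measure of a set of finite capacity is a vague limit
    of nearly minimizing measures, each of potential at most 1 on a set carrying it; by
    domination its potential is the smallest superharmonic function that is at least 1
    nearly everywhere on the set.  The Kelvin transform maps it to the balayage of the
    Dirac measure and preserves the energy. *)
Require Import Defs.
From HB Require Import structures.
From mathcomp Require Import all_boot all_order all_algebra.
From mathcomp Require Import all_classical all_reals all_analysis.
From mathcomp Require Import measurable_realfun.
From mathcomp Require Import ring lra.
Import Order.TTheory GRing.Theory Num.Theory.
Import numFieldNormedType.Exports.
Local Open Scope classical_set_scope.
Local Open Scope ring_scope.
Set SsrOldRewriteGoalsOrder.
Set Implicit Arguments. Unset Strict Implicit. Unset Printing Implicit Defensive.

(** * Euclidean space and the Riesz kernel *)

(** Since [A] is arbitrary, measures are cut only along measurable sets, and capacity is handled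
    through the inequality [mass ^ 2 <= b * energy] of [cap_leP]. Without positive definiteness
    there is no strong convergence of minimizing sequences: nearly minimizing measures have the part
    of high potential cut away, and vague limits are tested only against continuous functions
    vanishing at infinity. The two rates for the Gaussian mixture have one source. Convolution
    lowers the weight of variance [t] by at most [e * t ^ (a - 2)], and by at least [a * e / t] for
    [e <= t <= 1]. Away from the diagonal the factor [exp (- r^2 / (2t))] suppresses small [t] and
    leaves [O(e)]; in the potential of a Gaussian law no such factor remains, and the integral of
    [1 / t] from [e] to 1 gives the logarithm. A balayage of finite energy does not by itself
    provide an equilibrium measure of [A]. For that direction [A] is truncated to balls, and the
    near minimizers there are compared with the balayage uniformly in the radius. *)

Section Euclidean.
Variables (R : realType) (n : nat).
Implicit Types x y z : 'rV[R]_n.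
Local Notation d := (@eucl_dist R n).

Definition dotp x y : R := \sum_(i < n) x 0 i * y 0 i.

Lemma dotpC x y : dotp x y = dotp y x.
Proof. by apply: eq_bigr => i _; rewrite mulrC. Qed.

Lemma dotpDl x y z : dotp (x + y) z = dotp x z + dotp y z.
Proof. by rewrite /dotp -big_split; apply: eq_bigr => i _; rewrite mxE mulrDl. Qed.

Lemma dotpNl x z : dotp (- x) z = - dotp x z.
Proof. by rewrite /dotp -sumrN; apply: eq_bigr => i _; rewrite mxE mulNr. Qed.

Lemma dotpZl (a : R) x z : dotp (a *: x) z = a * dotp x z.
Proof. by rewrite /dotp mulr_sumr; apply: eq_bigr => i _; rewrite mxE mulrA. Qed.

Lemma dotpDr x y z : dotp z (x + y) = dotp z x + dotp z y.
Proof. by rewrite dotpC dotpDl !(dotpC z). Qed.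

Lemma dotpNr x z : dotp z (- x) = - dotp z x.
Proof. by rewrite dotpC dotpNl dotpC. Qed.

Lemma dotpZr (a : R) x z : dotp z (a *: x) = a * dotp z x.
Proof. by rewrite dotpC dotpZl dotpC. Qed.

Lemma dotp_ge0 x : 0 <= dotp x x.
Proof. by apply: sumr_ge0 => i _; rewrite -expr2 sqr_ge0. Qed.

Lemma dotp_eq0 x : (dotp x x == 0) = (x == 0).
Proof.
apply/eqP/eqP => [h|->]; last by rewrite /dotp big1// => i _; rewrite mxE mul0r.
apply/rowP => i; rewrite mxE.
have /eqP := psumr_eq0P (fun j _ => sqr_ge0 (x 0 j)) h (i := i) isT.
by rewrite sqrf_eq0 => /eqP.
Qed.

Lemma distE x y : d x y = Num.sqrt (dotp (x - y) (x - y)).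
Proof.
by rewrite /eucl_dist /dotp; congr Num.sqrt; apply: eq_bigr => i _; rewrite !mxE expr2.
Qed.

Lemma dist_ge0 x y : 0 <= d x y. Proof. exact: sqrtr_ge0. Qed.

Lemma dist_sqr x y : d x y ^+ 2 = dotp (x - y) (x - y).
Proof. by rewrite distE sqr_sqrtr// dotp_ge0. Qed.

Lemma dist_eq0 x y : (d x y == 0) = (x == y).
Proof.
by rewrite distE sqrtr_eq0 le_eqVlt ltNge dotp_ge0 orbF dotp_eq0 subr_eq0.
Qed.

Lemma distxx x : d x x = 0. Proof. by apply/eqP; rewrite dist_eq0. Qed.

Lemma dist_gt0 x y : (0 < d x y) = (x != y).
Proof. by rewrite lt0r dist_ge0 andbT dist_eq0. Qed.

Lemma dist_sym x y : d x y = d y x.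
Proof. by rewrite !distE -(opprB y x) dotpNl dotpNr opprK. Qed.

Lemma dotp_CS x y : dotp x y ^+ 2 <= dotp x x * dotp y y.
Proof.
have [/eqP|y0] := eqVneq (dotp y y) 0.
  rewrite dotp_eq0 => /eqP ->.
  have -> : dotp x 0 = 0 by rewrite /dotp big1// => i _; rewrite mxE mulr0.
  by rewrite expr0n /= mulr_ge0// dotp_ge0.
have yp : 0 < dotp y y by rewrite lt0r y0 dotp_ge0.
have := dotp_ge0 (dotp y y *: x - dotp x y *: y).
rewrite !(dotpDl, dotpDr, dotpNl, dotpNr, dotpZl, dotpZr) (dotpC y x).
set a := dotp x x; set b := dotp x y; set c := dotp y y => h.
rewrite -subr_ge0 -(pmulr_rge0 _ yp) -/c.
by move: h; congr (0 <= _); ring.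
Qed.

Lemma dist_triangle x y z : d x z <= d x y + d y z.
Proof.
rewrite -(@ler_pXn2r _ 2)// ?nnegrE ?addr_ge0 ?dist_ge0//.
rewrite sqrrD !dist_sqr.
have -> : x - z = (x - y) + (y - z) by rewrite addrA subrK.
have h : dotp (x - y) (y - z) <= d x y * d y z.
  rewrite (le_trans (ler_norm _))// -(@ler_pXn2r _ 2)// ?nnegrE ?mulr_ge0 ?dist_ge0//.
  by rewrite real_normK ?num_real// exprMn !dist_sqr dotp_CS.
move: h; move: (x - y) (y - z) => u v h.
rewrite dotpDl !dotpDr (dotpC v u).
rewrite mulr2n; lra.
Qed.

Lemma dist_lip x x' y : `|d x y - d x' y| <= d x x'.
Proof.
rewrite ler_norml; have := dist_triangle x x' y; have := dist_triangle x' x y.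
by rewrite (dist_sym x' x); lra.
Qed.

Lemma dist_coord x y i : `|x 0 i - y 0 i| <= d x y.
Proof.
rewrite -(@ler_pXn2r _ 2)// ?nnegrE ?dist_ge0// real_normK ?num_real//.
rewrite dist_sqr /dotp (bigD1 i)//= !mxE -expr2 lerDl.
by apply: sumr_ge0 => j _; rewrite -expr2 sqr_ge0.
Qed.

Lemma dist_le_coord x y (e : R) : 0 <= e -> (forall i, `|x 0 i - y 0 i| <= e) ->
  d x y <= n%:R * e.
Proof.
move=> e0 h.
have [n0|n0] := posnP n.
  rewrite distE /dotp; have -> : \sum_(i < n) (x - y) 0 i * (x - y) 0 i = 0.
    by apply: big1 => i _; have := ltn_ord i; rewrite {2}n0.
  by rewrite sqrtr0 mulr_ge0.
rewrite -(@ler_pXn2r _ 2)// ?nnegrE ?dist_ge0 ?mulr_ge0// dist_sqr.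
apply: (@le_trans _ _ (\sum_(i < n) e ^+ 2)).
  apply: ler_sum => i _; rewrite !mxE -expr2 -real_normK ?num_real//.
  by rewrite ler_pXn2r// ?nnegrE.
rewrite sumr_const card_ord -[leLHS]mulr_natl exprMn ler_wpM2r ?sqr_ge0//.
by rewrite -natrX ler_nat -{1}(expn1 n) leq_pexp2l.
Qed.

Lemma ball_dist x (e : R) : 0 < e -> exists2 r : R, 0 < r &
  forall y, d x y < r -> ball x e y.
Proof.
move=> e0; exists e => // y xy; split => // i j.
by rewrite (ord1 i) /ball/= (le_lt_trans (dist_coord _ _ _)).
Qed.

Lemma dist_ball x (e : R) : 0 < e -> exists2 r : R, 0 < r &
  forall y, ball x r y -> d x y < e.
Proof.
move=> e0; exists (e / n.+1%:R); first by rewrite divr_gt0// ltr0n.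
move=> y [_ xy]; apply: (@le_lt_trans _ _ (n%:R * (e / n.+1%:R))).
  apply: dist_le_coord; first by rewrite divr_ge0// ltW.
  by move=> i; have := xy 0 i; rewrite /ball/= => /ltW.
rewrite mulrCA gtr_pMr// ltr_pdivrMr ?ltr0n// mul1r ltr_nat//.
Qed.

Lemma nbhs_distP x (A : set 'rV[R]_n) :
  nbhs x A <-> exists2 r : R, 0 < r & forall y, d x y < r -> A y.
Proof.
split.
  move=> /nbhs_ballP[e /= e0 eA]; have [r r0 h] := ball_dist x e0.
  by exists r => // y /h /eA.
move=> [r r0 h]; apply/nbhs_ballP; have [e e0 he] := dist_ball x r0.
by exists e => //= y /he /h.
Qed.

Lemma open_distP (A : set 'rV[R]_n) : open A <->
  forall x, A x -> exists2 r : R, 0 < r & forall y, d x y < r -> A y.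
Proof.
rewrite openE; split => [h x /h /nbhs_distP //|h x /h /nbhs_distP //].
Qed.

End Euclidean.

(** * Borel measurability of maps into Euclidean space *)

Section BorelRn.
Variables (R : realType) (n : nat).
Local Notation E := (Rn R n).
Local Notation d := (@eucl_dist R n).

Lemma open_measurable_Rn (A : set 'rV[R]_n) : open A -> measurable (A : set E).
Proof. by move=> oA; apply: sub_sigma_algebra. Qed.

Lemma measurable_coord i : measurable_fun setT (fun x : E => (x : 'rV[R]_n) 0 i).
Proof.
apply: (measurability _ (RGenOpens.measurableE R)).
move=> _ [_ [a [b ->]] <-]; rewrite setTI; apply: open_measurable_Rn.
have /continuousP : continuous (fun x : 'rV[R]_n => x 0 i) by exact: coord_continuous.
by apply; exact: interval_open.
Qed.

(** Countably many rational boxes form a base of the topology; this reduces measurability of a map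
    into the space to its coordinates in [measurable_to_Rn]. *)
Lemma open_rat_box (U : set 'rV[R]_n) x : open U -> U x ->
  exists c : 'rV[rat]_n, exists r : rat,
    (forall i, `|x 0 i - ratr (c 0 i)| < ratr r) /\
    forall z : 'rV[R]_n, (forall i, `|z 0 i - ratr (c 0 i)| < ratr r) -> U z.
Proof.
move=> /open_distP oU /oU[e e0 he].
have e'0 : 0 < e / (n.+1%:R) / 2 by rewrite !divr_gt0// ltr0n.
have [r rI] := @rat_in_itvoo R 0 (e / (n.+1%:R) / 2) e'0.
move: rI; rewrite in_itv/= => /andP[].
have [rr rrE] : exists rr : R, ratr r = rr by exists (ratr r).
rewrite rrE => r0 re.
have hc i : exists q : rat, `|x 0 i - ratr q| < rr.
  have [|q] := @rat_in_itvoo R (x 0 i - rr) (x 0 i + rr); first lra.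
  rewrite in_itv/= => /andP[]; move=> q1 q2; exists q; move: (ratr q : R) q1 q2 => qq q1 q2.
  by rewrite ltr_norml; apply/andP; split; lra.
pose c : 'rV[rat]_n := \row_i xchoose (hc i).
have cP i : `|x 0 i - ratr (c 0 i)| < rr by rewrite mxE; exact: (xchooseP (hc i)).
exists c, r; rewrite rrE; split=> // z hz; apply: he.
apply: (@le_lt_trans _ _ (n%:R * (e / n.+1%:R))).
  apply: dist_le_coord => [|i]; first by rewrite divr_ge0// ltW.
  have := hz i; have := cP i; move: (ratr (c 0 i) : R) re; move: (e / _) => k q re; rewrite !ltr_norml => /andP[? ?] /andP[? ?].
  by rewrite ler_norml; apply/andP; split; lra.
by rewrite mulrCA gtr_pMr// ltr_pdivrMr ?ltr0n// mul1r ltr_nat.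
Qed.

Lemma measurable_to_Rn d1 (T : measurableType d1) (f : T -> E) :
  (forall i, measurable_fun setT (fun t => (f t : 'rV[R]_n) 0 i)) ->
  measurable_fun setT f.
Proof.
move=> mf; apply: (@measurability _ _ T E setT f (@open 'rV[R]_n)) => //.
move=> _ [U oU <-]; rewrite setTI.
pose box (p : 'rV[rat]_n * rat) : set 'rV[R]_n :=
  [set z | forall i, `|z 0 i - ratr (p.1 0 i)| < ratr p.2].
have -> : f @^-1` U = \bigcup_(p in [set p | box p `<=` U]) (f @^-1` box p).
  apply/seteqP; split => [t /= /(open_rat_box oU)[c [r [h1 h2]]]|t [p pU]]; last exact: pU.
  by exists (c, r).
rewrite bigcup_mkcond; apply: countable_bigcupT_measurable; first exact: countableP.
move=> p; case: ifP => // _.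
have -> : f @^-1` box p = \bigcap_(i in [set: 'I_n])
    [set t | `|(f t : 'rV[R]_n) 0 i - ratr (p.1 0 i)| < ratr p.2].
  by apply/seteqP; split => [t /= h i _|t h i]; exact: h.
apply: fin_bigcap_measurable => // i _.
rewrite -[X in measurable X]setTI.
have mi : measurable_fun setT (fun t => `|(f t : 'rV[R]_n) 0 i - ratr (p.1 0 i)|).
  by apply: measurableT_comp => //; apply: measurable_funB.
have := mi measurableT `]-oo, ratr p.2[%classic (measurable_itv _).
by congr measurable; congr (_ `&` _); apply/seteqP; split => t /=; rewrite in_itv.
Qed.

Lemma measurable_dist d1 (T : measurableType d1) (f g : T -> E) :
  measurable_fun setT f -> measurable_fun setT g ->
  measurable_fun setT (fun t => d (f t) (g t)).
Proof.
move=> mf mg; apply: (measurableT_comp (continuous_measurable_fun (@sqrt_continuous R))) => //=.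
apply: measurable_sum => i; apply: measurable_funX; apply: measurable_funB.
- exact: (measurableT_comp (measurable_coord i) mf).
- exact: (measurableT_comp (measurable_coord i) mg).
Qed.

End BorelRn.

(** * Induction on measurable functions, weighted images of measures, Tonelli's theorem *)

Section MeasureTools.
Local Open Scope ereal_scope.
Variable R : realType.

Import HBNNSimple.

(** Every nonnegative measurable function is an increasing limit of simple functions, and a simple
    function is the finite sum of its values times the indicators of its level sets; the closure
    properties follow this construction. *)
Lemma ge0_measurable_ind d (T : measurableType d) (P : (T -> \bar R) -> Prop) :
  (forall A, measurable A -> P (fun x => (\1_A x)%:E)) ->
  (forall (k : R) f, (0 <= k)%R -> measurable_fun setT f -> (forall x, 0 <= f x) ->
    P f -> P (fun x => k%:E * f x)) ->
  (forall f g, measurable_fun setT f -> (forall x, 0 <= f x) ->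
    measurable_fun setT g -> (forall x, 0 <= g x) ->
    P f -> P g -> P (fun x => f x + g x)) ->
  (forall f_ : (T -> \bar R)^nat, (forall n, measurable_fun setT (f_ n)) ->
    (forall n x, 0 <= f_ n x) -> (forall x, nondecreasing_seq (f_ ^~ x)) ->
    (forall n, P (f_ n)) -> P (fun x => limn (f_ ^~ x))) ->
  forall f, measurable_fun setT f -> (forall x, 0 <= f x) -> P f.
Proof.
move=> Pind PZ PD Plim f mf f0.
have Ps (h : {nnsfun T >-> R}) : P (EFin \o h).
  have mterm (r : R) : measurable_fun setT
      (fun x => r%:E * (\1_(h @^-1` [set r]) x)%:E).
    by apply: measurable_funeM; apply/measurable_EFinP; exact: measurable_indic.
  have tge0 (r : R) x : (0 <= r)%R -> 0 <= r%:E * (\1_(h @^-1` [set r]) x)%:E.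
    by move=> r0; rewrite mule_ge0// lee_fin.
  have aux (s : seq R) : {in s, forall r : R, (0 <= r)%R} ->
      P (fun x => \sum_(r <- s) r%:E * (\1_(h @^-1` [set r]) x)%:E).
    elim: s => [|r s ih] hs.
      have := Pind set0 measurable0; congr P.
      by apply/funext => x; rewrite big_nil indic0.
    have r0 : (0 <= r)%R by apply: hs; rewrite mem_head.
    have hs' : {in s, forall r : R, (0 <= r)%R}.
      by move=> y ys; apply: hs; rewrite in_cons ys orbT.
    have -> : (fun x => \sum_(r <- r :: s) r%:E * (\1_(h @^-1` [set r]) x)%:E) =
        (fun x => r%:E * (\1_(h @^-1` [set r]) x)%:E +
                  \sum_(r <- s) r%:E * (\1_(h @^-1` [set r]) x)%:E).
      by apply/funext => x; rewrite big_cons.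
    apply: PD => //.
    - by move=> x; exact: tge0.
    - by apply: emeasurable_sum => y.
    - move=> x; rewrite big_seq; apply: sume_ge0 => y ys.
      by apply: tge0; exact: hs'.
    - apply: PZ => //.
      + by apply/measurable_EFinP; exact: measurable_indic.
      + exact: Pind.
    - exact: ih.
  have := aux (finmap.enum_fset (fset_set (range h))) _; rewrite (_ : (fun x => _) = EFin \o h).
    apply=> r; rewrite in_fset_set; last exact: (@fimfunP _ _ h).
    by rewrite inE => -[x _ <-].
  apply/funext => x /=; rewrite (fimfunE h x) fsbig_finite/=; last exact: (@fimfunP _ _ h).
  by rewrite -sumEFin.
have -> : f = (fun x => limn (fun k => (nnsfun_approx measurableT mf k x)%:E)).
  apply/funext => x; apply/esym/cvg_lim => //.
  by apply: (@cvg_nnsfun_approx _ _ _ _ measurableT f mf) => // *; exact: f0.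
apply: Plim.
- by move=> k; exact/measurable_EFinP/measurable_funP.
- by move=> k x; rewrite lee_fin.
- by move=> x a b ab; rewrite lee_fin; exact/lefP/nd_nnsfun_approx.
- by move=> k; exact: Ps.
Qed.

(** The image under [phi] of the measure with density [rho]. Describing it by its integrals lets one
    lemma serve restriction, scaling, affine substitution, inversion and Kelvin transformation. *)
Lemma wpush_ex d1 d2 (T1 : measurableType d1) (T2 : measurableType d2)
    (mu : {measure set T1 -> \bar R}) (rho : T1 -> \bar R) (phi : T1 -> T2) :
  measurable_fun setT rho -> (forall x, 0 <= rho x) -> measurable_fun setT phi ->
  exists nu : {measure set T2 -> \bar R},
    forall f, measurable_fun setT f -> (forall y, 0 <= f y) ->
      \int[nu]_y f y = \int[mu]_x (rho x * f (phi x)).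
Proof.
move=> mr r0 mphi.
pose nu (B : set T2) := \int[mu]_(x in phi @^-1` B) rho x.
have mpre B : measurable B -> measurable (phi @^-1` B).
  by move=> mB; rewrite -[X in measurable X]setTI; exact: mphi.
have nu0 : nu set0 = 0 by rewrite /nu preimage_set0 integral_set0.
have nuge0 B : 0 <= nu B by apply: integral_ge0 => x _; exact: r0.
have nus : semi_sigma_additive nu.
  move=> F mF tF mUF.
  have mF' k : measurable (phi @^-1` F k) by exact: mpre.
  have h := @ge0_integral_bigcup _ T1 R mu (fun k => phi @^-1` F k) rho mF'
    (measurable_funS measurableT (@subsetT _ _) mr) (fun x _ => r0 x)
    (fun i j (_ : setT i) (_ : setT j) (h : (phi @^-1` F i) `&` (phi @^-1` F j) !=set0) =>
       let: ex_intro x hx := h in tF i j I I (ex_intro _ (phi x) hx)).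
  rewrite /nu preimage_bigcup h.
  by apply: is_cvg_nneseries => k _ _; exact: nuge0.
pose mm := isMeasure.Build _ T2 R nu nu0 nuge0 nus.
pose nuM : {measure set T2 -> \bar R} := HB.pack nu mm.
exists nuM.
apply: ge0_measurable_ind.
- move=> A mA; rewrite integral_indic// setIT.
  rewrite /= /nu integral_mkcond; apply: eq_integral => x _.
  rewrite patchE indicE.
  have -> : (x \in phi @^-1` A) = (phi x \in A) by apply/idP/idP; rewrite !inE.
  by case: ifP => _; rewrite ?mule1 ?mule0.
- move=> k f k0 mf f0 ih.
  rewrite ge0_integralZl_EFin//.
  rewrite ih -ge0_integralZl_EFin//.
  + by apply: eq_integral => x _; rewrite muleCA.
  + by move=> x _; rewrite mule_ge0.
  + by apply: emeasurable_funM => //; exact: (measurableT_comp mf).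
- move=> f g mf f0 mg g0 ihf ihg; rewrite ge0_integralD// ihf ihg -ge0_integralD//.
  + by apply: eq_integral => x _; rewrite ge0_muleDr.
  + by move=> x _; rewrite mule_ge0.
  + by apply: emeasurable_funM => //; exact: (measurableT_comp mf).
  + by move=> x _; rewrite mule_ge0.
  + by apply: emeasurable_funM => //; exact: (measurableT_comp mg).
- move=> f_ mf f0 nf ih.
  have mrf k : measurable_fun setT (fun x => rho x * f_ k (phi x)).
    by apply: emeasurable_funM => //; exact: (measurableT_comp (mf k)).
  rewrite monotone_convergence//.
  have -> : (fun k => \int[nuM]_x f_ k x) = (fun k => \int[mu]_x (rho x * f_ k (phi x))).
    by apply/funext => k; exact: ih.
  rewrite -monotone_convergence//; last 2 first.
  + by move=> k x _; rewrite mule_ge0.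
  + by move=> x _ a b ab; rewrite lee_wpmul2l//; exact: nf.
  apply: eq_integral => x _; apply/cvg_lim => //.
  have hc : f_ ^~ (phi x) @ \oo --> limn (f_ ^~ (phi x)).
    exact: ereal_nondecreasing_is_cvgn.
  (* Multiplication by [+oo] does not commute with limits in general; here the sequence increases,
     so either all its terms vanish or the product is eventually constant. *)
  have [->|rf] := eqVneq (rho x) +oo.
    have [/eqP|l0] := eqVneq (limn (f_ ^~ (phi x))) 0.
      move=> /eqP l0; rewrite l0 mule0.
      have fz k : f_ k (phi x) = 0.
        apply/eqP; rewrite eq_le f0 andbT -l0.
        rewrite (cvg_lim _ (ereal_nondecreasing_cvgn (nf (phi x))))//.
        by apply: ereal_sup_ubound; exists k.
      by under eq_fun do rewrite fz mule0; exact: cvg_cst.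
    have lp : 0 < limn (f_ ^~ (phi x)).
      by rewrite lt0e l0 /=; apply: lime_ge => //; exact: nearW.
    have [k0 k0P] : exists k, 0 < f_ k (phi x).
      apply/not_existsP => hn; move: lp; rewrite ltNge => /negP; apply.
      apply: lime_le => //; apply: nearW => k; rewrite leNgt; apply/negP; exact: hn.
    rewrite gt0_mulye//; apply: cvg_near_cst.
    exists k0 => // k /= kk0; apply/eqP; rewrite gt0_mulye// (lt_le_trans k0P)//.
    exact: nf.
  have rfin : rho x \is a fin_num by rewrite ge0_fin_numE// ltey.
  by apply: cvgeZl.
Qed.

End MeasureTools.

Section Tonelli.
Local Open Scope ereal_scope.
Variable R : realType.

Lemma fin_sigma_finite d (T : measurableType d) (mu : {measure set T -> \bar R}) :
  mu setT < +oo -> sigma_finite setT mu.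
Proof.
move=> h; exists (fun=> setT); first by rewrite bigcup_const.
by move=> _; split.
Qed.

Section two.
Context d1 d2 (T1 : measurableType d1) (T2 : measurableType d2).
Variables (m1 : {measure set T1 -> \bar R}) (m2 : {measure set T2 -> \bar R}).
Variable f : T1 * T2 -> \bar R.
Hypotheses (mf : measurable_fun setT f) (f0 : forall z, 0 <= f z).

(** The measures of this development come out of existence statements and carry no sigma-finite
    structure; it is packed from the hypothesis, here and in [tonelli_swap]. *)
Lemma tonelli_measurable : sigma_finite setT m2 ->
  measurable_fun setT (fun x => \int[m2]_y f (x, y)).
Proof.
move=> s2.
pose m2' : {sigma_finite_measure set T2 -> \bar R} :=
  HB.pack_for (SigmaFiniteMeasure.type T2 R) (Measure.sort m2)
    (isSFinite.Build _ _ _ _ (sfinite_measure_sigma_finite s2)) (isSigmaFinite.Build _ _ _ _ s2).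
exact: (@measurable_fun_fubini_tonelli_F _ _ T1 T2 R m2' f mf f0).
Qed.

Lemma tonelli_swap : sigma_finite setT m1 -> sigma_finite setT m2 ->
  \int[m1]_x \int[m2]_y f (x, y) = \int[m2]_y \int[m1]_x f (x, y).
Proof.
move=> s1 s2.
pose m1' : {sigma_finite_measure set T1 -> \bar R} :=
  HB.pack_for (SigmaFiniteMeasure.type T1 R) (Measure.sort m1)
    (isSFinite.Build _ _ _ _ (sfinite_measure_sigma_finite s1)) (isSigmaFinite.Build _ _ _ _ s1).
pose m2' : {sigma_finite_measure set T2 -> \bar R} :=
  HB.pack_for (SigmaFiniteMeasure.type T2 R) (Measure.sort m2)
    (isSFinite.Build _ _ _ _ (sfinite_measure_sigma_finite s2)) (isSigmaFinite.Build _ _ _ _ s2).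
exact: (@fubini_tonelli _ _ T1 T2 R m1' m2' f mf f0).
Qed.
End two.
End Tonelli.

(** * The kernel as a function of the distance, and its truncations *)

Section Kernel.
Local Open Scope ereal_scope.
Variables (R : realType) (n : nat) (alpha : R).
Hypotheses (hn : (3 <= n)%N) (halpha : (0 < alpha <= 2)%R).
Local Notation E := (Rn R n).
Local Notation d := (@eucl_dist R n).
Local Notation K := (@riesz_kernel R n alpha).

Lemma exponent_gt0 : (0 < n%:R - alpha)%R.
Proof.
have : (3 <= n%:R :> R)%R by rewrite ler_nat.
by case/andP: halpha; lra.
Qed.
Let b0 := exponent_gt0.

(** [kr] is the profile of the kernel in the distance. The [kt k] are bounded and continuous and
    increase to it, which gives access to vague limits and to monotone convergence. *)
Definition kr (r : R) : \bar R :=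
  if r == 0%R then +oo else (r `^ (alpha - n%:R))%R%:E.
Definition kt (k : nat) (r : R) : R := ((Num.max r k.+1%:R^-1) `^ (alpha - n%:R))%R.

Lemma powRN_le (r s : R) : (0 < r)%R -> (r <= s)%R ->
  (s `^ (alpha - n%:R) <= r `^ (alpha - n%:R))%R.
Proof.
move=> r0 rs; have s0 : (0 < s)%R := lt_le_trans r0 rs.
rewrite -(opprB _ alpha) !powRN lef_pV2 ?posrE ?powR_gt0//.
by apply: ge0_ler_powR => //; rewrite ?nnegrE ltW.
Qed.

Lemma kerE x z : K x z = kr (d x z).
Proof. by rewrite /riesz_kernel /kr dist_eq0. Qed.

Lemma kr_ge0 r : 0 <= kr r.
Proof. by rewrite /kr; case: ifP => // _; rewrite lee_fin powR_ge0. Qed.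

Lemma ker_ge0 x z : 0 <= K x z. Proof. by rewrite kerE kr_ge0. Qed.

Lemma ker_sym x z : K x z = K z x. Proof. by rewrite !kerE dist_sym. Qed.

Lemma kr_le r s : (0 <= r)%R -> (r <= s)%R -> kr s <= kr r.
Proof.
rewrite /kr; have [->|r0 r1 rs] := eqVneq r 0%R; first by rewrite leey.
have r2 : (0 < r)%R by rewrite lt0r r0.
have s2 : (0 < s)%R := lt_le_trans r2 rs.
by rewrite gt_eqF// lee_fin powRN_le.
Qed.

Lemma measurable_kr : measurable_fun setT kr.
Proof.
apply: measurable_fun_ifT => //.
- exact: measurable_fun_eqr.
- by apply/measurable_EFinP; exact: measurable_powR.
Qed.

Lemma measurable_ker d1 (T : measurableType d1) (f g : T -> E) :
  measurable_fun setT f -> measurable_fun setT g ->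
  measurable_fun setT (fun t => K (f t) (g t)).
Proof.
move=> mf mg; under eq_fun do rewrite kerE.
by apply: (measurableT_comp measurable_kr); exact: measurable_dist.
Qed.

Lemma measurable_kerl x : measurable_fun setT (fun z => K x z).
Proof. exact: measurable_ker. Qed.

Lemma measurable_ker2 : measurable_fun setT (fun p : E * E => K p.1 p.2).
Proof. exact: measurable_ker. Qed.

Lemma natinv_gt0 k : (0 < k.+1%:R^-1 :> R)%R.
Proof. by rewrite invr_gt0 ltr0n. Qed.

Lemma kt_ge0 k r : (0 <= kt k r)%R. Proof. exact: powR_ge0. Qed.

Lemma kt_bound k r : (kt k r <= (k.+1%:R^-1) `^ (alpha - n%:R))%R.
Proof. by apply: powRN_le; rewrite ?natinv_gt0// le_max lexx orbT. Qed.

Lemma kt_nd k l r : (k <= l)%N -> (kt k r <= kt l r)%R.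
Proof.
move=> kl; apply: powRN_le; first by rewrite lt_max natinv_gt0 orbT.
rewrite ge_max le_max lexx /= le_max lef_pV2 ?posrE ?ltr0n// ler_nat ltnS kl.
by rewrite orbT.
Qed.

Lemma kt_le_kr k r : (0 <= r)%R -> (kt k r)%:E <= kr r.
Proof.
move=> r0; rewrite /kr; have [|r1] := eqVneq r 0%R; first by rewrite leey.
by rewrite lee_fin powRN_le// ?lt0r ?r1// le_max lexx.
Qed.

Lemma kt_eq k r : (k.+1%:R^-1 <= r)%R -> (kt k r)%:E = kr r.
Proof.
move=> h; have r0 : (0 < r)%R := lt_le_trans (natinv_gt0 k) h.
by rewrite /kr gt_eqF// /kt max_l.
Qed.

Lemma kt_cvg r : (0 <= r)%R -> (kt k r)%:E @[k --> \oo] --> kr r.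
Proof.
(* At [r = 0] the truncation equals [k.+1] to the power [n - alpha], which passes [M] once [k]
   exceeds the corresponding root of its absolute value; at [r > 0] it is eventually constant. *)
move=> r0; have [req|rneq] := eqVneq r 0%R.
  rewrite /kr req eqxx; apply/cvgeyPge => M.
  have [k hk] : exists k : nat, (`|M| `^ (n%:R - alpha)^-1 <= k%:R)%R.
    by exists (Num.truncn (`|M| `^ (n%:R - alpha)^-1)).+1; exact/ltW/truncnS_gt.
  exists k => // l /= kl; rewrite lee_fin /kt max_r ?invr_ge0//.
  rewrite -powR_inv1 ?ler0n// -powRrM mulN1r opprB.
  rewrite (le_trans (ler_norm M))//.
  have -> : (`|M| = (`|M| `^ (n%:R - alpha)^-1) `^ (n%:R - alpha))%R.
    by rewrite -powRrM mulVf ?gt_eqF// powRr1.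
  apply: ge0_ler_powR; rewrite ?nnegrE ?powR_ge0 ?ler0n// ltW//.
  by rewrite (le_lt_trans hk)// ltr_nat ltnS.
have r1 : (0 < r)%R by rewrite lt0r rneq.
apply: cvg_near_cst; exists (Num.truncn r^-1).+1 => // k /= hk.
apply: kt_eq.
rewrite invf_ple ?posrE ?ltr0n// (le_trans (ltW (truncnS_gt _)))// ler_nat.
by rewrite (leq_trans hk).
Qed.

Lemma kt_limn r : (0 <= r)%R -> kr r = limn (fun k => (kt k r)%:E).
Proof. by move=> r0; apply/esym/cvg_lim => //; exact: kt_cvg. Qed.

Lemma measurable_kt k : measurable_fun setT (kt k).
Proof.
apply: (measurableT_comp (@measurable_powR R _)).
by apply: measurable_maxr.
Qed.

Lemma kt_continuous k : continuous (kt k).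
Proof.
move=> r.
have m0 : (0 < Num.max r k.+1%:R^-1)%R by rewrite lt_max natinv_gt0 orbT.
have c1 : {for r, continuous ((fun s : R => s) \max (fun=> k.+1%:R^-1 : R))%R}.
  by apply: continuous_max; [exact: cvg_id|exact: cvg_cst].
apply: (@continuous_comp R R R _ (fun s : R => s `^ (alpha - n%:R))%R _ c1).
apply: differentiable_continuous; apply/derivable1_diffP.
by have := is_derive1_powR (alpha - n%:R) m0; case.
Qed.

End Kernel.

(** * Energy and capacity *)

Section Potential.
Local Open Scope ereal_scope.
Variables (R : realType) (n : nat) (alpha : R).
Hypotheses (hn : (3 <= n)%N) (halpha : (0 < alpha <= 2)%R).
Local Notation E := (Rn R n).
Local Notation d := (@eucl_dist R n).
Local Notation K := (@riesz_kernel R n alpha).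
Local Notation pot := (@riesz_potential R n alpha).
Local Notation energy := (@riesz_energy R n alpha).
Local Notation cap := (@inner_capacity R n alpha).
Implicit Types mu nu : {measure set E -> \bar R}.

Definition mutual_energy mu nu := \int[mu]_x pot nu x.

Lemma energyE mu : energy mu = mutual_energy mu mu. Proof. by []. Qed.

Lemma pot_ge0 mu x : 0 <= pot mu x.
Proof. by apply: integral_ge0 => z _; exact: ker_ge0. Qed.

Lemma mutual_ge0 mu nu : 0 <= mutual_energy mu nu.
Proof. by apply: integral_ge0 => z _; exact: pot_ge0. Qed.

Lemma energy_ge0 mu : 0 <= energy mu.
Proof. exact: mutual_ge0. Qed.

Lemma measurable_pot nu : sigma_finite setT nu -> measurable_fun setT (pot nu).
Proof.
move=> s.
by apply: (@tonelli_measurable R _ _ E E nu (fun p => K p.1 p.2)) => //;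
  [exact: measurable_ker2|move=> p; exact: ker_ge0].
Qed.

Lemma mutual_sym mu nu : sigma_finite setT mu -> sigma_finite setT nu ->
  mutual_energy mu nu = mutual_energy nu mu.
Proof.
move=> s1 s2.
have h := @tonelli_swap R _ _ E E mu nu (fun p => K p.1 p.2) (@measurable_ker2 R n alpha)
  (fun p => ker_ge0 alpha p.1 p.2) s1 s2.
transitivity (\int[nu]_y \int[mu]_x K x y); first exact: h.
by apply: eq_integral => x _; apply: eq_integral => z _; rewrite ker_sym.
Qed.

(** Cuts and rescales at once: [c = 1] gives restrictions, [D = setT] gives normalisation. As [A]
    need not be measurable, concentration is transported through null sets. *)
Lemma restr_ex mu (D : set E) (c : R) : measurable D -> (0 <= c)%R ->
  exists nu, (forall f, measurable_fun setT f -> (forall y, 0 <= f y) ->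
     \int[nu]_y f y = c%:E * \int[mu]_(x in D) f x) /\
    (forall B, measurable B -> nu B = c%:E * mu (B `&` D)) /\
    (forall A, concentrated mu A -> concentrated nu (A `&` D)) /\
    (forall x, pot nu x = c%:E * \int[mu]_(z in D) K x z).
Proof.
move=> mD c0.
have [|||nu hnu] := @wpush_ex R _ _ E E mu (fun x => (c * \1_D x)%:E) id.
- by apply/measurable_EFinP; apply: measurable_funM => //; exact: measurable_indic.
- by move=> x; rewrite lee_fin mulr_ge0.
- exact: measurable_id.
have hf f : measurable_fun setT f -> (forall y, 0 <= f y) ->
     \int[nu]_y f y = c%:E * \int[mu]_(x in D) f x.
  move=> mf f0; rewrite hnu// -ge0_integralZl_EFin//; last exact: measurable_funS mf.
  rewrite [RHS]integral_mkcond; apply: eq_integral => x _; rewrite patchE indicE.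
  by case: ifP => _; rewrite ?mulr1 ?mulr0 ?mul0e.
have hB B : measurable B -> nu B = c%:E * mu (B `&` D).
  move=> mB; rewrite -(setIT B) -integral_indic// hf//.
  + by rewrite integral_indic// setIT.
  + by apply/measurable_EFinP; exact: measurable_indic.
exists nu; split => //; split => //; split.
- move=> A [N [mN N0 AN]]; exists (N `|` ~` D); split.
  + by apply: measurableU => //; exact: measurableC.
  + rewrite hB; last by apply: measurableU => //; exact: measurableC.
    have -> : mu ((N `|` ~` D) `&` D) = 0; last by rewrite mule0.
    apply/eqP; rewrite eq_le measure_ge0 andbT -N0 le_measure ?inE//.
      by apply: measurableI => //; apply: measurableU => //; exact: measurableC.
    by move=> x [[|]].
  + by move=> x /= /not_andP[/AN|]; [left|right].
- move=> x; apply: hf; first exact: measurable_kerl.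
  by move=> y; exact: ker_ge0.
Qed.

Lemma concentrated_sub mu A B : A `<=` B -> concentrated mu A -> concentrated mu B.
Proof. by move=> AB; apply: negligibleS; exact: subsetC. Qed.

Lemma cap_ge0 A : 0 <= cap A.
Proof.
rewrite /inner_capacity; case: ifP => // _; case: ifP => // _.
rewrite lee_fin invr_ge0 fine_ge0//; apply: le_ereal_inf_tmp => _ [mu _ <-].
exact: energy_ge0.
Qed.

(** The square of the mass and the energy scale alike, so the infimum over probability measures
    becomes an inequality for all finite measures. This form absorbs the conventions for [1 / 0] and
    [1 / +oo] and asks for no minimizer. *)
Lemma cap_leP A (b : R) : (0 <= b)%R ->
  cap A <= b%:E <->
  (forall mu, concentrated mu A -> mu setT < +oo -> energy mu < +oo ->
     (fine (mu setT) ^+ 2 <= b * fine (energy mu))%R).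
Proof.
move=> b0.
set S := [set mu : {measure set E -> \bar R} |
       concentrated mu A /\ energy mu < +oo /\ mu setT = 1].
have S0 : 0 <= inv_capacity alpha A.
  by apply: le_ereal_inf_tmp => _ [mu _ <-]; exact: energy_ge0.
split=> [cb mu muA mfin efin|h].
  have mm : mu setT \is a fin_num by rewrite ge0_fin_numE.
  have em : energy mu \is a fin_num by rewrite ge0_fin_numE ?energy_ge0.
  set m := fine (mu setT); set e := fine (energy mu).
  have e0 : (0 <= e)%R by rewrite fine_ge0 ?energy_ge0.
  have m0 : (0 <= m)%R by rewrite fine_ge0.
  have [->|mn0] := eqVneq m 0%R; first by rewrite expr0n/= mulr_ge0.
  have mp : (0 < m)%R by rewrite lt0r mn0.
  have mi0 : (0 <= m^-1)%R by rewrite invr_ge0.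
  have [nu [h1 [h2 [h3 h4]]]] := restr_ex mu measurableT mi0.
  have smu : sigma_finite setT mu by exact: fin_sigma_finite.
  have mpmu := measurable_pot smu.
  have enu : energy nu = (e / m ^+ 2)%:E.
    rewrite /riesz_energy -/(riesz_potential alpha nu).
    under eq_integral do rewrite -/(riesz_potential alpha nu _) h4.
    rewrite h1.
    - rewrite ge0_integralZl_EFin//; last by move=> x _; exact: pot_ge0.
      rewrite -/(energy mu) -(fineK em) -/e -!EFinM; congr EFin.
      by rewrite mulrA -expr2 exprVn mulrC.
    - exact: measurable_funeM.
    - by move=> y; rewrite mule_ge0// ?lee_fin//; exact: pot_ge0.
  have nuS : S nu.
    split; first by have := h3 _ muA; rewrite setIT.
    split; first by rewrite enu ltry.
    by rewrite h2// setIT -(fineK mm) -EFinM mulVf.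
  have le1 : inv_capacity alpha A <= (e / m ^+ 2)%:E.
    by apply: ereal_inf_lbound; exists nu => //; rewrite enu.
  move: cb; rewrite /inner_capacity.
  have [_|v0] := eqVneq (inv_capacity alpha A) 0; first by rewrite leye_eq.
  have [vy|vy] := eqVneq (inv_capacity alpha A) +oo.
    by move: le1; rewrite vy leye_eq.
  have vf : inv_capacity alpha A \is a fin_num by rewrite ge0_fin_numE// ltey.
  move: le1; rewrite -(fineK vf); set v := fine _; rewrite /= !lee_fin => le1.
  have vp : (0 < v)%R by rewrite fine_gt0// lt0e v0 S0 ltey vy.
  move=> vb0; have b1 : (0 < b)%R by rewrite (lt_le_trans _ vb0)// invr_gt0.
  have vb : (b^-1 <= v)%R by rewrite invf_ple ?posrE.
  rewrite -ler_pdivrMl// -[leRHS](@mulfK _ (m ^+ 2)) ?expf_neq0//.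
  rewrite mulrAC ler_pM2r ?exprn_gt0//.
  exact: le_trans vb le1.
have bS e : (exists2 mu, S mu & energy mu = e) -> (0 < b)%R /\ b^-1%:E <= e.
  move=> [mu [muA [efin m1]] <-].
  have := h mu muA; rewrite m1 => /(_ (ltry _) efin); rewrite /= expr1n => h1.
  have em : energy mu \is a fin_num by rewrite ge0_fin_numE ?energy_ge0.
  have b1 : (0 < b)%R.
    by rewrite lt0r b0 andbT; apply/eqP => bz; move: h1; rewrite bz mul0r; lra.
  split=> //; rewrite -(fineK em) lee_fin -(ler_pM2l b1) mulfV// ?gt_eqF//.
have [S1|/set0P[mu0 Smu0]] := eqVneq S set0.
  rewrite /inner_capacity.
  have -> : inv_capacity alpha A = +oo.
    by rewrite /inv_capacity -/S S1 image_set0 ereal_inf0.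
  by rewrite /= lee_fin.
have [b1 _] := bS _ (ex_intro2 _ _ mu0 Smu0 erefl).
have vb : b^-1%:E <= inv_capacity alpha A.
  apply: le_ereal_inf_tmp => _ [mu Smu <-].
  by have [] := bS _ (ex_intro2 _ _ mu Smu erefl).
have bi : (0 < b^-1)%R by rewrite invr_gt0.
rewrite /inner_capacity; have [v0|v0] := eqVneq (inv_capacity alpha A) 0.
  by move: vb; rewrite v0 lee_fin leNgt bi.
case: ifP => [_|/negP vy]; first by rewrite lee_fin.
have vf : inv_capacity alpha A \is a fin_num.
  by rewrite ge0_fin_numE// ltey; apply/eqP => h'; apply: vy; rewrite h'.
rewrite lee_fin; move: vb; rewrite -(fineK vf) lee_fin => vb.
by rewrite invf_ple ?posrE// (lt_le_trans bi).
Qed.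

Lemma cap_cases A : cap A = +oo \/ exists2 b : R, (0 <= b)%R & cap A = b%:E.
Proof.
have := cap_ge0 A; case: (cap A) => [b||] //; last by left.
by rewrite lee_fin => b0; right; exists b.
Qed.

Lemma cap_mono A B : A `<=` B -> cap A <= cap B.
Proof.
move=> AB; have [->|[b b0 cB]] := cap_cases B; first by rewrite leey.
rewrite cB; apply/cap_leP => // mu muA.
have [h _] := cap_leP B b0.
by apply: h; [rewrite cB|exact: concentrated_sub muA].
Qed.

(** If [b] is below the capacity, some measure violates the inequality of [cap_leP]; rescaled to
    mass [b], it has energy at most [b]. *)
Lemma cap_gt_ex A (b : R) : (0 <= b)%R -> b%:E < cap A -> exists mu,
  [/\ concentrated mu A, mu setT = b%:E & energy mu <= b%:E].
Proof.
move=> b0; rewrite ltNge => /negP cA.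
have [mu [muA [mfin [efin]]]] : exists mu, concentrated mu A /\ mu setT < +oo /\
    energy mu < +oo /\ (b * fine (energy mu) < fine (mu setT) ^+ 2)%R.
  apply: contrapT => /forallNP hN; apply: cA; apply/cap_leP => // mu h1 h2 h3.
  rewrite leNgt; apply/negP => h4; exact: (hN mu).
have mm : mu setT \is a fin_num by rewrite ge0_fin_numE.
have em : energy mu \is a fin_num by rewrite ge0_fin_numE ?energy_ge0.
set m := fine (mu setT); set e := fine (energy mu) => bm.
have e0 : (0 <= e)%R by rewrite fine_ge0 ?energy_ge0.
have m0 : (0 <= m)%R by rewrite fine_ge0.
have mp : (0 < m)%R.
  rewrite lt0r m0 andbT; apply/eqP => mz; move: bm; rewrite mz expr0n/= ltNge.
  by rewrite mulr_ge0.
have mi0 : (0 <= b / m)%R by rewrite divr_ge0.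
have [nu [h1 [h2 [h3 h4]]]] := restr_ex mu measurableT mi0.
have smu : sigma_finite setT mu by exact: fin_sigma_finite.
have mpmu := measurable_pot smu.
exists nu; split.
- by have := h3 _ muA; rewrite setIT.
- by rewrite h2// setIT -(fineK mm) -EFinM divfK ?gt_eqF.
- rewrite /riesz_energy.
  under eq_integral do rewrite -/(riesz_potential alpha nu _) h4.
  rewrite h1.
  + rewrite ge0_integralZl_EFin//; last by move=> x _; exact: pot_ge0.
    rewrite -/(energy mu) -(fineK em) -/e -!EFinM lee_fin.
    have -> : (b / m * (b / m * e) = b * ((b * e) / m ^+ 2))%R.
      by field; rewrite gt_eqF.
    rewrite ler_piMr// ler_pdivrMr ?exprn_gt0// mul1r ltW//.
  + exact: measurable_funeM.
  + by move=> y; rewrite mule_ge0// ?lee_fin//; exact: pot_ge0.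
Qed.

End Potential.

(** * Cutting measures and comparing capacities *)

Section Capacity.
Local Open Scope ereal_scope.
Variables (R : realType) (n : nat) (alpha : R).
Hypotheses (hn : (3 <= n)%N) (halpha : (0 < alpha <= 2)%R).
Local Notation E := (Rn R n).
Local Notation d := (@eucl_dist R n).
Local Notation K := (@riesz_kernel R n alpha).
Local Notation pot := (@riesz_potential R n alpha).
Local Notation energy := (@riesz_energy R n alpha).
Local Notation cap := (@inner_capacity R n alpha).
Local Notation mutual := (@mutual_energy R n alpha).
Implicit Types mu nu : {measure set E -> \bar R}.

(** The complement of [A] may fail to be measurable, but it lies in a measurable null set, which
    then covers the complement of [B] as well. *)
Lemma conc_int mu A B (f : E -> \bar R) : concentrated mu A -> A `<=` B -> measurable B ->
  measurable_fun setT f -> (forall x, 0 <= f x) -> \int[mu]_x f x = \int[mu]_(x in B) f x.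
Proof.
move=> [N [mN N0 AN]] AB mB mf f0.
have BC0 : mu (~` B) = 0.
  apply/eqP; rewrite eq_le measure_ge0 andbT -N0 le_measure ?inE//.
    exact: measurableC.
  by move=> x nBx; apply: AN => /AB.
have mBC := measurableC mB.
by rewrite (ge0_negligible_integral mBC)// setTD setCK.
Qed.

Lemma conc_mass mu A B : concentrated mu A -> A `<=` B -> measurable B -> mu setT = mu B.
Proof.
move=> muA AB mB; have := @conc_int mu A B (cst 1) muA AB mB.
by rewrite !integral_cst// !mul1e; apply.
Qed.

Lemma measurable_ball_le (y : E) (r : R) : measurable [set x : E | (d x y <= r)%R].
Proof.
have := @measurable_dist R n _ E id (fun=> y) (@measurable_id _ _ _) (@measurable_cst _ _ _ _ _ _).
move=> /(_ measurableT `]-oo, r]%classic (measurable_itv _)).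
by rewrite setTI; congr measurable; apply/seteqP; split => x /=; rewrite in_itv.
Qed.

Lemma measurable_ball_lt (y : E) (r : R) : measurable [set x : E | (d x y < r)%R].
Proof.
have := @measurable_dist R n _ E id (fun=> y) (@measurable_id _ _ _) (@measurable_cst _ _ _ _ _ _).
move=> /(_ measurableT `]-oo, r[%classic (measurable_itv _)).
by rewrite setTI; congr measurable; apply/seteqP; split => x /=; rewrite in_itv.
Qed.

Lemma measurable_ge (y : E) (r : R) : measurable [set x : E | (r <= d x y)%R].
Proof.
have -> : [set x : E | (r <= d x y)%R] = ~` [set x : E | (d x y < r)%R].
  by apply/seteqP; split => x /=; rewrite leNgt => /negP.
by apply: measurableC; exact: measurable_ball_lt.
Qed.

Lemma energy_split mu D : sigma_finite setT mu -> measurable D ->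
  energy mu = \int[mu]_(x in D) pot mu x + \int[mu]_(x in ~` D) pot mu x.
Proof.
move=> s mD; have mp := measurable_pot alpha s.
rewrite /riesz_energy -/(riesz_potential alpha mu) -ge0_integral_setU ?setUv//.
- exact: measurableC.
- by move=> x _; exact: pot_ge0.
- by apply/disj_setPS; rewrite setICr.
Qed.

(** The properties of a restriction that are used later, recorded as a relation so that [nu] is
    again an ordinary measure. *)
Definition restr mu (D : set E) nu :=
  [/\ forall f, measurable_fun setT f -> (forall y, 0 <= f y) ->
        \int[nu]_y f y = \int[mu]_(x in D) f x,
      forall B, measurable B -> nu B = mu (B `&` D),
      forall A, concentrated mu A -> concentrated nu (A `&` D) &
      forall x, pot nu x = \int[mu]_(z in D) K x z].

Lemma restr_exists mu D : measurable D -> exists nu, restr mu D nu.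
Proof.
move=> mD; have [nu [h1 [h2 [h3 h4]]]] := restr_ex alpha mu mD ler01.
exists nu; split => //.
- by move=> f mf f0; rewrite h1// mul1e.
- by move=> B mB; rewrite h2// mul1e.
- by move=> x; rewrite h4// mul1e.
Qed.

Lemma restr_mass mu D nu : measurable D -> restr mu D nu -> nu setT = mu D.
Proof. by move=> mD [_ h _ _]; rewrite h// setTI. Qed.

Lemma restr_pot_le mu D nu x : measurable D -> restr mu D nu -> pot nu x <= pot mu x.
Proof.
move=> mD [_ _ _ ->]; apply: ge0_subset_integral => //.
- exact: measurable_kerl.
- by move=> z _; exact: ker_ge0.
Qed.

Lemma restr_energy_le mu D nu : measurable D -> restr mu D nu ->
  sigma_finite setT mu -> sigma_finite setT nu ->
  energy nu <= \int[mu]_(x in D) pot mu x.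
Proof.
move=> mD rn s s'; have mp := measurable_pot alpha s; have mp' := measurable_pot alpha s'.
case: (rn) => h1 _ _ _; rewrite /riesz_energy h1 => //; last by move=> x; exact: pot_ge0.
apply: ge0_le_integral => //.
- by move=> x _; exact: pot_ge0.
- exact: measurable_funS mp'.
- exact: measurable_funS mp.
- by move=> x _; exact: restr_pot_le rn.
Qed.

Lemma restr_energy_le_energy mu D nu : measurable D -> restr mu D nu ->
  sigma_finite setT mu -> sigma_finite setT nu -> energy nu <= energy mu.
Proof.
move=> mD rn s s'; apply: (le_trans (restr_energy_le mD rn s s')).
rewrite (energy_split s mD) leeDl//; apply: integral_ge0 => x _; exact: pot_ge0.
Qed.

(** The kernel is nonnegative, so dropping the mutual energy of the two pieces of a measure only
    lowers the total. The bounds for the pieces combine by the Cauchy-Schwarz inequality.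
    Measurability of [D] is what permits the cut. *)
Lemma cap_add A1 A2 D (b1 b2 : R) : measurable D -> A1 `<=` D -> A2 `<=` ~` D ->
  (0 <= b1)%R -> (0 <= b2)%R ->
  cap A1 <= b1%:E -> cap A2 <= b2%:E -> cap (A1 `|` A2) <= (b1 + b2)%:E.
Proof.
move=> mD A1D A2D b10 b20 c1 c2; apply/cap_leP => //; first exact: addr_ge0.
move=> mu muA mfin efin.
have mDC := measurableC mD.
have [m1 r1] := restr_exists mu mD; have [m2 r2] := restr_exists mu mDC.
have smu := fin_sigma_finite mfin.
have mm1 : m1 setT = mu D by exact: restr_mass r1.
have mm2 : m2 setT = mu (~` D) by exact: restr_mass r2.
have f1 : m1 setT < +oo by rewrite mm1 (le_lt_trans _ mfin)// le_measure// ?inE.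
have f2 : m2 setT < +oo by rewrite mm2 (le_lt_trans _ mfin)// le_measure// ?inE.
have s1 := fin_sigma_finite f1; have s2 := fin_sigma_finite f2.
have e12 : energy m1 + energy m2 <= energy mu.
  by rewrite (energy_split smu mD) leeD//; exact: restr_energy_le.
have e1 : energy m1 < +oo.
  by rewrite (le_lt_trans _ efin)// (le_trans _ e12)// leeDl// energy_ge0.
have e2 : energy m2 < +oo.
  by rewrite (le_lt_trans _ efin)// (le_trans _ e12)// leeDr// energy_ge0.
have conc1 : concentrated m1 A1.
  case: r1 => _ _ h _; apply: concentrated_sub (h _ muA).
  by move=> x [[//|/A2D]].
have conc2 : concentrated m2 A2.
  case: r2 => _ _ h _; apply: concentrated_sub (h _ muA).
  by move=> x [[/A1D|//]].
have [h1 _] := cap_leP alpha A1 b10; have {}h1 := h1 c1 _ conc1 f1 e1.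
have [h2 _] := cap_leP alpha A2 b20; have {}h2 := h2 c2 _ conc2 f2 e2.
have msum : fine (mu setT) = (fine (m1 setT) + fine (m2 setT))%R.
  rewrite mm1 mm2 -fineD//.
  - by rewrite -measureU// ?setUv// setICr.
  - by rewrite ge0_fin_numE// -mm1.
  - by rewrite ge0_fin_numE// -mm2.
have esum : (fine (energy m1) + fine (energy m2) <= fine (energy mu))%R.
  have fin1 : energy m1 \is a fin_num by rewrite ge0_fin_numE ?energy_ge0.
  have fin2 : energy m2 \is a fin_num by rewrite ge0_fin_numE ?energy_ge0.
  have fin3 : energy mu \is a fin_num by rewrite ge0_fin_numE ?energy_ge0.
  by rewrite -lee_fin EFinD !fineK.
have p1 : (0 <= fine (m1 setT))%R by rewrite fine_ge0.
have p2 : (0 <= fine (m2 setT))%R by rewrite fine_ge0.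
have q1 : (0 <= fine (energy m1))%R by rewrite fine_ge0 ?energy_ge0.
have q2 : (0 <= fine (energy m2))%R by rewrite fine_ge0 ?energy_ge0.
rewrite msum; move: h1 h2 esum p1 p2 q1 q2.
move: (fine (m1 setT)) (fine (m2 setT)) => u v.
move: (fine (energy m1)) (fine (energy m2)) (fine (energy mu)) => e f g.
move=> h1 h2 h3 u0 v0 e0 f0.
apply: (@le_trans _ _ ((b1 + b2) * (e + f)))%R; last by rewrite ler_wpM2l ?addr_ge0.
(* The square of [u * v] is at most [(b1 * e) * (b2 * f)]; the inequality between arithmetic and
   geometric means does the rest. *)
have uv : (2 * (u * v) <= b1 * f + b2 * e)%R.
  rewrite -(@ler_pXn2r _ 2)// ?nnegrE ?addr_ge0 ?mulr_ge0//.
  apply: (@le_trans _ _ (4 * ((b1 * e) * (b2 * f))))%R.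
    rewrite (_ : (2 * (u * v)) ^+ 2 = 4 * (u ^+ 2 * v ^+ 2))%R; last by ring.
    by rewrite ler_pM2l ?ltr0n// ler_pM ?sqr_ge0.
  rewrite -subr_ge0.
  rewrite (_ : _ - _ = (b1 * f - b2 * e) ^+ 2)%R ?sqr_ge0//; ring.
rewrite sqrrD !mulrDl !mulrDr mulr2n; lra.
Qed.

(** Restriction to [F k] does not raise the energy, while the masses of the [F k] tend to the total
    mass, so the bound passes to the limit for each measure separately. *)
Lemma cap_exhaust A (F : nat -> set E) (b : R) : (0 <= b)%R ->
  (forall k, measurable (F k)) -> nondecreasing_seq F -> \bigcup_k F k = setT ->
  (forall k, cap (A `&` F k) <= b%:E) -> cap A <= b%:E.
Proof.
move=> b0 mF ndF UF h; apply/cap_leP => // mu muA mfin efin.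
have smu := fin_sigma_finite mfin.
have hk k : (fine (mu (F k)) ^+ 2 <= b * fine (energy mu))%R.
  have [m1 r1] := restr_exists mu (mF k).
  have mm1 := restr_mass (mF k) r1.
  have f1 : m1 setT < +oo by rewrite mm1 (le_lt_trans _ mfin)// le_measure// ?inE.
  have s1 := fin_sigma_finite f1.
  have le1 := restr_energy_le_energy (mF k) r1 smu s1.
  have e1 : energy m1 < +oo := le_lt_trans le1 efin.
  have [h' _] := cap_leP alpha (A `&` F k) b0.
  have := h' (h k) m1 _ f1 e1; rewrite mm1 => /(_ _)/le_trans; apply.
    by case: r1 => _ _ + _; exact.
  by rewrite ler_wpM2l// fine_le// ge0_fin_numE ?energy_ge0.
have cv : (fun k => fine (mu (F k)) ^+ 2)%R @ \oo --> (fine (mu setT) ^+ 2)%R.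
  apply: (@cvg_comp _ _ _ (fun k => fine (mu (F k))) (fun x : R => x ^+ 2)%R _
    (nbhs (fine (mu setT)))); last exact: exprn_continuous.
  apply: fine_cvg; rewrite fineK ?ge0_fin_numE// -UF.
  apply: nondecreasing_cvg_mu => //; rewrite UF; exact: measurableT.
rewrite -(cvg_lim _ cv)//; apply: limr_le; first by apply/cvg_ex; eexists; exact: cv.
by apply: nearW.
Qed.

Lemma mutual_ge mu A B (c : R) : (0 <= c)%R -> mu setT < +oo ->
  concentrated mu A -> A `<=` B -> measurable B ->
  (forall x z, B x -> B z -> c%:E <= K x z) ->
  c%:E * (mu setT * mu setT) <= energy mu.
Proof.
move=> c0 mfin muA AB mB h; have s := fin_sigma_finite mfin.
have mp := measurable_pot alpha s.
have -> : energy mu = \int[mu]_(x in B) pot mu x.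
  by apply: conc_int muA AB mB mp _ => x; exact: pot_ge0.
have mTB := conc_mass muA AB mB.
rewrite muleA {2}mTB -integral_cst//.
apply: ge0_le_integral => //.
- by move=> x _; rewrite mule_ge0.
- exact: measurable_funS mp.
- move=> x Bx; rewrite mTB -integral_cst//.
  rewrite /riesz_potential (conc_int muA AB mB (measurable_kerl alpha x)); last first.
    by move=> z; exact: ker_ge0.
  apply: ge0_le_integral => //.
  - exact: measurable_funS (measurable_kerl alpha x).
  - by move=> z Bz; exact: h.
Qed.

Lemma mutual_le mu nu A B A' B' (c : R) : (0 <= c)%R ->
  mu setT < +oo -> nu setT < +oo ->
  concentrated mu A -> A `<=` B -> measurable B ->
  concentrated nu A' -> A' `<=` B' -> measurable B' ->
  (forall x z, B x -> B' z -> K x z <= c%:E) ->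
  mutual mu nu <= c%:E * (mu setT * nu setT).
Proof.
move=> c0 mfin nfin muA AB mB nuA AB' mB' h; have s := fin_sigma_finite nfin.
have mp := measurable_pot alpha s.
have -> : mutual mu nu = \int[mu]_(x in B) pot nu x.
  by apply: conc_int muA AB mB mp _ => x; exact: pot_ge0.
rewrite [mu setT * _]muleC muleA (conc_mass muA AB mB) -integral_cst//.
apply: ge0_le_integral => //.
- by move=> x _; exact: pot_ge0.
- exact: measurable_funS mp.
- move=> x Bx; rewrite (conc_mass nuA AB' mB') -integral_cst//.
  rewrite /riesz_potential (conc_int nuA AB' mB' (measurable_kerl alpha x)); last first.
    by move=> z; exact: ker_ge0.
  apply: ge0_le_integral => //.
  - by move=> z _; exact: ker_ge0.
  - exact: measurable_funS (measurable_kerl alpha x).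
  - by move=> z Bz; exact: h.
Qed.

Lemma kr_ler r s : (0 < r)%R -> (r <= s)%R -> kr n alpha s <= ((r `^ (alpha - n%:R))%R)%:E.
Proof.
move=> r0 rs; rewrite (le_trans (kr_le hn halpha (ltW r0) rs))//.
by rewrite /kr gt_eqF.
Qed.

(** Two points of the ball are at distance at most [2 * r], which bounds the kernel and hence the
    energy from below. *)
Lemma cap_bounded A y (r : R) : (0 < r)%R -> A `<=` [set x | (d x y <= r)%R] ->
  cap A <= ((2 * r) `^ (n%:R - alpha))%R%:E.
Proof.
move=> r0 Ar; apply/cap_leP; rewrite ?powR_ge0// => mu muA mfin efin.
have r2 : (0 < 2 * r)%R by rewrite mulr_gt0.
have := @mutual_ge mu A _ ((2 * r) `^ (alpha - n%:R))%R (powR_ge0 _ _) mfin muA Ar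
  (measurable_ball_le y r).
have hk (x z : E) : (d x y <= r)%R -> (d z y <= r)%R ->
    ((2 * r) `^ (alpha - n%:R))%R%:E <= K x z.
  move=> xr zr; rewrite kerE.
  have h : (d x z <= 2 * r)%R.
    by rewrite (le_trans (dist_triangle x y z))// (dist_sym y z); lra.
  by rewrite (le_trans _ (kr_le hn halpha (dist_ge0 x z) h))// /kr gt_eqF.
move=> /(_ hk).
have mm : mu setT \is a fin_num by rewrite ge0_fin_numE.
have em : energy mu \is a fin_num by rewrite ge0_fin_numE ?energy_ge0.
rewrite -(fineK mm) -(fineK em) -!EFinM lee_fin -expr2 -[(alpha - n%:R)%R]opprB powRN.
move=> hle.
by rewrite -ler_pdivrMl// ?powR_gt0.
Qed.

Lemma cap_fin_bounded A y (r : R) : A `<=` [set x | (d x y <= r)%R] -> cap A < +oo.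
Proof.
move=> h; apply: (@le_lt_trans _ _ ((2 * (`|r| + 1)) `^ (n%:R - alpha))%R%:E); last exact: ltry.
apply: (@cap_bounded A y); first by rewrite ltr_pwDr.
by move=> x /h /= /le_trans; apply; rewrite (le_trans (ler_norm r))// lerDl.
Qed.

End Capacity.

(** * Annuli and inversion *)

Section Annuli.
Local Open Scope ereal_scope.
Variables (R : realType) (n : nat) (alpha : R).
Hypotheses (hn : (3 <= n)%N) (halpha : (0 < alpha <= 2)%R).
Local Notation E := (Rn R n).
Local Notation d := (@eucl_dist R n).
Local Notation K := (@riesz_kernel R n alpha).
Local Notation pot := (@riesz_potential R n alpha).
Local Notation energy := (@riesz_energy R n alpha).
Local Notation cap := (@inner_capacity R n alpha).
Local Notation mutual := (@mutual_energy R n alpha).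
Implicit Types mu nu : {measure set E -> \bar R}.

Lemma pow_unbounded (q r : R) : (1 < q)%R -> exists N : nat, (r < q ^+ N)%R.
Proof.
move=> q1.
have [N hN] : exists N : nat, (r / (q - 1) < N%:R)%R.
  by exists (Num.truncn (r / (q - 1))).+1; exact: truncnS_gt.
exists N; have q0 : (0 < q - 1)%R by rewrite subr_gt0.
have bern k : (k%:R * (q - 1) <= q ^+ k)%R.
  elim: k => [|k ih]; first by rewrite mul0r expr0.
  rewrite exprS -natr1 mulrDl mul1r.
  have : (1 <= q ^+ k)%R by rewrite exprn_ege1// ltW.
  by move: ih; move: (q ^+ k)%R (k%:R * (q - 1))%R => a b ab a1; nra.
by rewrite (lt_le_trans _ (bern N))// -ltr_pdivrMr.
Qed.

Definition annulus (q : R) (y : E) k : set E :=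
  [set x | (q ^+ k <= d x y < q ^+ k.+1)%R].

Lemma cap_annulus_fin A q y k : cap (A `&` annulus q y k) < +oo.
Proof.
apply: (@cap_fin_bounded R n alpha hn halpha _ y (q ^+ k.+1)).
by move=> x [_ /andP[_ /ltW]].
Qed.

Lemma nneseries_partial (c : nat -> \bar R) N : (forall k, 0 <= c k) ->
  \sum_(0 <= k < N) c k <= \sum_(k <oo) c k.
Proof.
by move=> c0; apply: (@nneseries_lim_ge R c xpredT) => k _.
Qed.

(** Consecutive annuli are separated by measurable balls, so [cap_add] applies repeatedly, starting
    from the ball of radius 1 that the annuli leave out; the partial bounds pass to [A] by
    exhaustion. *)
Lemma cap_fin_annuli A (q : R) (y : E) : (1 < q)%R ->
  \sum_(k <oo) cap (A `&` annulus q y k) < +oo -> cap A < +oo.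
Proof.
move=> q1 hS.
pose F N : set E := [set x | (d x y < q ^+ N)%R].
have q0 : (0 < q)%R by rewrite (lt_trans ltr01).
have c0 : cap (A `&` F 0%N) < +oo.
  apply: (@cap_fin_bounded R n alpha hn halpha _ y 1%R).
  by move=> x [_]; rewrite /F/= expr0 => /ltW.
have mF N : measurable (F N) by exact: measurable_ball_lt.
set S := \sum_(k <oo) _ in hS.
have S0 : 0 <= S by apply: nneseries_ge0 => k _ _; exact: cap_ge0.
have Sf : S \is a fin_num by rewrite ge0_fin_numE.
have c0f : cap (A `&` F 0%N) \is a fin_num by rewrite ge0_fin_numE// cap_ge0.
have hN N : cap (A `&` F N) <= (fine (cap (A `&` F 0%N)) +
    \sum_(0 <= k < N) fine (cap (A `&` annulus q y k)))%R%:E.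
  elim: N => [|N ih]; first by rewrite big_nil addr0 fineK.
  have -> : A `&` F N.+1 = (A `&` F N) `|` (A `&` annulus q y N).
    apply/seteqP; split => x /=.
      move=> [Ax h]; have [h1|h1] := ltP (d x y) (q ^+ N)%R; first by left.
      by right; split => //; rewrite /annulus/= h1.
    move=> [[Ax h]|[Ax /andP[_ h]]]; split => //.
    by rewrite /F/= (lt_le_trans h)// ler_eXn2l.
  rewrite big_nat_recr//= addrA.
  apply: (cap_add (mF N)) => //.
  - by move=> x [_ /andP[h _]]; rewrite /F/=; apply/negP; rewrite -leNgt.
  - apply: addr_ge0; first by rewrite fine_ge0// cap_ge0.
    by apply: sumr_ge0 => k _; rewrite fine_ge0// cap_ge0.
  - by rewrite fine_ge0// cap_ge0.
  - by rewrite fineK// ge0_fin_numE ?cap_ge0// cap_annulus_fin.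
apply: (@le_lt_trans _ _ (fine (cap (A `&` F 0%N)) + fine S)%R%:E); last exact: ltry.
apply: (@cap_exhaust R n alpha A F).
- by apply: addr_ge0; rewrite fine_ge0// cap_ge0.
- exact: mF.
- move=> k l kl; apply/subsetPset => x; rewrite /F/= => /lt_le_trans; apply.
  by rewrite ler_weXn2l// ltW.
- apply/seteqP; split => // x _; have [N hx] := pow_unbounded (d x y) q1.
  by exists N.
- move=> N; apply: (le_trans (hN N)); rewrite lee_fin lerD2l -lee_fin fineK//.
  rewrite -sumEFin (eq_bigr (fun k => cap (A `&` annulus q y k))); last first.
    by move=> k _; rewrite fineK// ge0_fin_numE ?cap_ge0// cap_annulus_fin.
  by apply: nneseries_partial => k; exact: cap_ge0.
Qed.

Lemma concentrated_null A nu : nu setT = 0 -> concentrated nu A.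
Proof. by move=> h; exists setT; split. Qed.

(** The capacity need not be attained on [A], but half of a positive capacity lies strictly below
    it, so [cap_gt_ex] applies; capacity zero is served by the zero measure. *)
Lemma half_optimal A y (r : R) : A `<=` [set x | (d x y <= r)%R] ->
  exists mu, [/\ concentrated mu A, mu setT = (fine (cap A) / 2)%R%:E &
    energy mu <= (fine (cap A) / 2)%R%:E].
Proof.
move=> Ar; have cf := cap_fin_bounded hn halpha Ar.
have c0 := cap_ge0 alpha A.
have cfin : cap A \is a fin_num by rewrite ge0_fin_numE.
have [c1|c1] := eqVneq (fine (cap A)) 0%R.
  exists (mzero : {measure set E -> \bar R}); rewrite c1 mul0r; split => //.
  - exact: concentrated_null.
  - by rewrite /riesz_energy integral_measure_zero.
have c2 : (0 < fine (cap A))%R by rewrite lt0r c1 fine_ge0.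
apply: (@cap_gt_ex R n alpha); first by rewrite divr_ge0// ltW.
by rewrite -[X in _ < X]fineK// lte_fin ltr_pdivrMr// ltr_pMr// ltr1n.
Qed.

Lemma energy_add mu nu : mu setT < +oo -> nu setT < +oo ->
  exists la : {measure set E -> \bar R},
  [/\ forall B, la B = mu B + nu B,
      forall A, concentrated mu A -> concentrated nu A -> concentrated la A &
      energy la = energy mu + 2%:E * mutual mu nu + energy nu].
Proof.
move=> sm sn; have smu := fin_sigma_finite sm; have snu := fin_sigma_finite sn.
pose la : {measure set E -> \bar R} := measure_add mu nu.
have laT (B : set E) : la B = mu B + nu B by exact: (@measure_addE _ _ _ mu nu B).
have hla f : measurable_fun setT f -> (forall x, 0 <= f x) ->
    \int[la]_x f x = \int[mu]_x f x + \int[nu]_x f x.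
  by move=> mf f0; rewrite ge0_integral_measure_add.
have sla : sigma_finite setT la.
  by apply: fin_sigma_finite; rewrite laT lte_add_pinfty.
have pla x : pot la x = pot mu x + pot nu x.
  by rewrite /riesz_potential hla//; [exact: measurable_kerl|move=> z; exact: ker_ge0].
have mpm := measurable_pot alpha smu; have mpn := measurable_pot alpha snu.
have mpl := measurable_pot alpha sla.
exists la; split => //.
- move=> A [N1 [mN1 N10 sN1]] [N2 [mN2 N20 sN2]].
  exists (N1 `&` N2); split; first exact: measurableI.
    rewrite laT; apply/eqP; rewrite eq_le adde_ge0// andbT -[leRHS](adde0 0) leeD//.
      by rewrite -N10 le_measure ?inE//; exact: measurableI.
    by rewrite -N20 le_measure ?inE//; exact: measurableI.
  by move=> x /= nx; split; [exact: sN1|exact: sN2].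
- have hh (m : {measure set E -> \bar R}) : \int[m]_x pot la x =
      \int[m]_x pot mu x + \int[m]_x pot nu x.
    rewrite -ge0_integralD//; first by apply: eq_integral => x _; exact: pla.
    - by move=> x _; exact: pot_ge0.
    - by move=> x _; exact: pot_ge0.
  have -> : energy la = \int[mu]_x pot la x + \int[nu]_x pot la x.
    by rewrite -hla//; move=> x; exact: pot_ge0.
  rewrite !hh -!/(mutual_energy alpha _ _).
  rewrite (mutual_sym alpha snu smu) mule_natl mule2n.
  by rewrite -!addeA.
Qed.

(** Annuli of one parity lie at distances comparable to the larger radius. Half-optimal measures on
    them are summed one by one: the mass present at stage [N] is at most a multiple of [rr N ^ be],
    the kernel between it and the new piece at most a multiple of [rr N ^ (- be)], so each new piece
    adds energy proportional to its own mass. A measure on [A] whose energy is at most [K0] times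
    its mass has mass at most [b * K0]. *)
Lemma sep_annuli A (q b : R) (y : E) (j : nat) : (1 < q)%R -> (0 <= b)%R ->
  cap A <= b%:E -> exists C : R, forall N,
  (\sum_(0 <= i < N) fine (cap (A `&` annulus q y (2 * i + j)%N)) <= C)%R.
Proof.
move=> q1 b0 cA; have q0 : (0 < q)%R by rewrite (lt_trans ltr01).
set be := (n%:R - alpha)%R; have be0 : (0 < be)%R by exact: exponent_gt0.
pose c i := fine (cap (A `&` annulus q y (2 * i + j)%N)).
have c0 i : (0 <= c i)%R by rewrite fine_ge0// cap_ge0.
pose rr (N : nat) : R := (q ^+ (2 * N + j)%N)%R.
have rr0 N : (0 < rr N)%R by rewrite exprn_gt0.
have rrS N : (rr N.+1 = q ^+ 2 * rr N)%R.
  by rewrite /rr -exprD; congr (_ ^+ _)%R; rewrite mulnS addnA.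
have sub i : A `&` annulus q y (2 * i + j)%N `<=` [set x | (d x y <= q * rr i)%R].
  by move=> x [_ /andP[_ /ltW]]; rewrite /= /rr -exprS.
have ck i : (c i <= (2 * q) `^ be * rr i `^ be)%R.
  have h1 : (0 <= 2 * q)%R by rewrite mulr_ge0 ?ltW.
  have h2 := ltW (rr0 i).
  rewrite -powRM// -mulrA -lee_fin fineK.
    by apply: (cap_bounded hn halpha _ (sub i)); rewrite mulr_gt0.
  by rewrite ge0_fin_numE ?cap_ge0// cap_annulus_fin.
have Q1 : (1 < (q ^+ 2) `^ be)%R.
  have := @gt0_ltr_powR R be be0 1%R (q ^+ 2)%R; rewrite powR1; apply.
  - by rewrite nnegrE.
  - by rewrite nnegrE exprn_ge0// ltW.
  - by rewrite exprn_egt1.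
(* [C3] solves [C3 * (Q - 1) = (2 * q) ^ be] with [Q = q ^ (2 * be)], the relation that closes the
   induction for [MC]. *)
pose C3 := ((2 * q) `^ be / ((q ^+ 2) `^ be - 1))%R.
have C30 : (0 <= C3)%R by rewrite divr_ge0 ?powR_ge0// subr_ge0 ltW.
(* The older annuli lie within [rr N / q] of [y] and the new one at distance at least [rr N], so
   they are at least [th * rr N] apart. *)
pose th := (1 - q^-1)%R.
have th0 : (0 < th)%R by rewrite subr_gt0 invf_lt1.
pose C4 := (C3 * th `^ (- be))%R.
have C40 : (0 <= C4)%R by rewrite mulr_ge0 ?powR_ge0.
(* The 1 stands for the energy of the new piece itself, [2 * C4] for twice its mutual energy with
   the older pieces. *)
pose K0 := (1 + 2 * C4)%R.
pose M N := (\sum_(0 <= i < N) c i / 2)%R.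
have MS N : (M N.+1 = M N + c N / 2)%R by rewrite /M big_nat_recr.
have M0 N : (0 <= M N)%R by apply: sumr_ge0 => i _; rewrite divr_ge0.
have MC N : (M N <= C3 * rr N `^ be)%R.
  elim: N => [|N ih]; first by rewrite /M big_nil mulr_ge0 ?powR_ge0.
  rewrite MS rrS powRM ?exprn_ge0 ?(ltW q0) ?(ltW (rr0 N))//.
  have hC : (C3 * ((q ^+ 2) `^ be - 1) = (2 * q) `^ be)%R.
    by rewrite /C3 divfK// gt_eqF// subr_gt0.
  have := ck N; rewrite -hC; move: ih; move: (powR_ge0 (rr N) be) (c0 N) (M N) Q1.
  move: (rr N `^ be)%R (c N) ((q ^+ 2) `^ be)%R => u v w u0 v0 m w1 h1 h2.
  nra.
pose G N : set E := [set x | (q * d x y <= rr N)%R].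
have mG N : measurable (G N).
  have -> : G N = [set x | (d x y <= rr N / q)%R].
    by apply/seteqP; split => x /=; rewrite ler_pdivlMr// mulrC.
  exact: measurable_ball_le.
have main N : exists mu, [/\ concentrated mu (A `&` G N), mu setT = (M N)%:E &
    energy mu <= (K0 * M N)%:E].
  elim: N => [|N [mu [muA muM mue]]].
    exists (mzero : {measure set E -> \bar R}); rewrite /M big_nil mulr0; split => //.
    - exact: concentrated_null.
    - by rewrite /riesz_energy integral_measure_zero.
  have [nu [nuA nuM nue]] := half_optimal (sub N).
  have sm : mu setT < +oo by rewrite muM ltry.
  have sn : nu setT < +oo by rewrite nuM ltry.
  have smu := fin_sigma_finite sm; have snu := fin_sigma_finite sn.
  have [la [laT laA ela]] := energy_add sm sn.
  have cr : mutual mu nu <= (C4 * (c N / 2))%:E.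
    have hle : mutual mu nu <= ((th * rr N) `^ (- be))%R%:E * (mu setT * nu setT).
      apply: (mutual_le (powR_ge0 _ _) sm sn muA _ (mG N) nuA _ (measurable_ge y (rr N))).
      - by move=> x [].
      - by move=> x [_ /andP[+ _]].
      - move=> x z /= xG zG.
        rewrite kerE.
        have dd : (th * rr N <= d x z)%R.
          have := dist_triangle z x y; rewrite (dist_sym z x).
          have : (d x y <= rr N / q)%R by rewrite ler_pdivlMr// mulrC.
          by rewrite /th mulrBl mul1r [(q^-1 * _)%R]mulrC; move: zG => /=; lra.
        have := kr_ler hn halpha (mulr_gt0 th0 (rr0 N)) dd.
        by rewrite /be opprB.
    apply: (le_trans hle); rewrite muM nuM -!EFinM lee_fin.
    rewrite powRM ?(ltW th0) ?(ltW (rr0 N))//.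
    have e1 : (rr N `^ (- be) * rr N `^ be = 1)%R.
      by rewrite -powRD ?addNr ?powRr0//; apply/implyP => _; rewrite gt_eqF.
    have := MC N; rewrite -/(c N) /C4 => h.
    apply: (@le_trans _ _ (th `^ (- be) * rr N `^ (- be) * (C3 * rr N `^ be * (c N / 2))))%R.
      by rewrite ler_wpM2l ?mulr_ge0 ?powR_ge0// ler_wpM2r// divr_ge0.
    rewrite le_eqVlt; apply/orP; left; apply/eqP.
    transitivity (th `^ (- be) * (rr N `^ (- be) * rr N `^ be) * C3 * (c N / 2))%R; first by ring.
    by rewrite e1; ring.
  exists la; split.
  - apply: laA.
      apply: concentrated_sub muA => x [Ax xG]; split => //; rewrite /G/= in xG *.
      by rewrite (le_trans xG)// rrS ler_peMl ?(ltW (rr0 N))// exprn_ege1// ltW.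
    apply: concentrated_sub nuA => x [Ax /andP[_ xG]]; split => //; rewrite /G/=.
    by rewrite rrS expr2 -mulrA ler_pM2l// (ltW (lt_le_trans xG _))// exprS.
  - by rewrite laT muM nuM MS -EFinD.
  - rewrite ela MS; apply: (@le_trans _ _ ((K0 * M N)%:E +
      2%:E * (C4 * (c N / 2))%:E + (c N / 2)%:E)).
      by rewrite leeD// leeD// lee_pmul2l.
    by rewrite -EFinM -!EFinD lee_fin /K0; lra.
have MK N : (M N <= b * K0)%R.
  have [mu [muA muM mue]] := main N.
  have K00 : (0 <= K0)%R by rewrite addr_ge0// mulr_ge0.
  have [h _] := cap_leP alpha A b0.
  have := h cA mu _ _ _; rewrite muM ltry (le_lt_trans mue (ltry _)).
  have muA' : concentrated mu A by apply: concentrated_sub muA => x [].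
  move=> /(_ muA' isT isT) /= h2.
  have : (M N ^+ 2 <= b * (K0 * M N))%R.
    rewrite (le_trans h2)// ler_wpM2l// -lee_fin fineK//.
    by rewrite ge0_fin_numE ?energy_ge0// (le_lt_trans mue (ltry _)).
  have [->|mn] := eqVneq (M N) 0%R; first by rewrite mulr_ge0.
  by rewrite expr2 mulrA ler_pM2r// lt0r mn M0.
exists (2 * (b * K0))%R => N.
have := MK N; rewrite /M -mulr_suml -/(c _).
by rewrite ler_pdivrMr// mulrC.
Qed.

(** Adds the bounds for the even and the odd annuli; the first [N] terms are among the first
    [2 * N], which split evenly between the parities. *)
Lemma annuli_cap_fin A (q : R) (y : E) : (1 < q)%R ->
  cap A < +oo -> \sum_(k <oo) cap (A `&` annulus q y k) < +oo.
Proof.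
move=> q1 cA; have [cy|[b b0 cb]] := cap_cases alpha A; first by rewrite cy in cA.
have cb' : cap A <= b%:E by rewrite cb.
have [C0 h0] := sep_annuli y 0 q1 b0 cb'.
have [C1 h1] := sep_annuli y 1 q1 b0 cb'.
pose c k := fine (cap (A `&` annulus q y k)).
have c0 k : (0 <= c k)%R by rewrite fine_ge0// cap_ge0.
have cE k : cap (A `&` annulus q y k) = (c k)%:E.
  by rewrite fineK// ge0_fin_numE ?cap_ge0// cap_annulus_fin.
have split2 N : (\sum_(0 <= k < 2 * N) c k =
    \sum_(0 <= i < N) c (2 * i + 0)%N + \sum_(0 <= i < N) c (2 * i + 1)%N)%R.
  elim: N => [|N ih]; first by rewrite muln0 !big_nil addr0.
  rewrite mulnS addSn add1n !big_nat_recr//= ih addn0 addn1.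
  by rewrite addrACA addrA.
apply: (@le_lt_trans _ _ (C0 + C1)%R%:E); last exact: ltry.
apply: lime_le; first by apply: is_cvg_nneseries => k _ _; exact: cap_ge0.
apply: nearW => N.
rewrite (eq_bigr (fun k => (c k)%:E)); last by move=> k _; exact: cE.
rewrite sumEFin lee_fin.
apply: (@le_trans _ _ (\sum_(0 <= k < 2 * N) c k))%R; last first.
  by rewrite split2 lerD// ?h0// h1.
rewrite (@big_cat_nat _ _ _ N 0 (2 * N))//= ?leq_pmull// lerDl.
by apply: sumr_ge0 => k _; exact: c0.
Qed.

End Annuli.

(** * Inversion and its effect on the kernel and on capacity *)

Section Inversion.
Local Open Scope ereal_scope.
Variables (R : realType) (n : nat) (alpha : R).
Hypotheses (hn : (3 <= n)%N) (halpha : (0 < alpha <= 2)%R).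
Local Notation E := (Rn R n).
Local Notation d := (@eucl_dist R n).
Local Notation K := (@riesz_kernel R n alpha).
Local Notation pot := (@riesz_potential R n alpha).
Local Notation energy := (@riesz_energy R n alpha).
Local Notation cap := (@inner_capacity R n alpha).
Implicit Types mu nu : {measure set E -> \bar R}.
Variable y : E.
Local Notation J := (@inversion_at R n y).
Local Notation be := (n%:R - alpha)%R.

Lemma inv_center : J y = y.
Proof. by rewrite /inversion_at subrr scaler0 addr0. Qed.

Lemma inv_sub (x : E) : ((J x : 'rV[R]_n) - y = ((d x y) ^- 2) *: ((x : 'rV[R]_n) - y))%R.
Proof. by rewrite /inversion_at addrAC subrr add0r. Qed.

Lemma dist_inv (x : E) : x != y -> d (J x) y = (d x y)^-1%R.
Proof.
move=> xy; have dp : (0 < d x y)%R by rewrite dist_gt0.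
rewrite distE inv_sub dotpZl dotpZr -dist_sqr mulrA.
have -> : ((d x y) ^- 2 * (d x y) ^- 2 * d x y ^+ 2 = ((d x y)^-1) ^+ 2)%R.
  by rewrite exprVn -mulrA mulVf ?mulr1// expf_neq0// gt_eqF.
by rewrite sqrtr_sqr ger0_norm// invr_ge0 ltW.
Qed.

Lemma inv_neq (x : E) : x != y -> J x != y.
Proof. by move=> xy; rewrite -dist_gt0 dist_inv// invr_gt0 dist_gt0. Qed.

Lemma inversionK (x : E) : J (J x) = x.
Proof.
have [->|xy] := eqVneq x y; first by rewrite !inv_center.
have dp : (0 < d x y)%R by rewrite dist_gt0.
rewrite {1}/inversion_at dist_inv// inv_sub scalerA exprVn invrK mulfV ?scale1r.
  by rewrite addrC subrK.
by rewrite expf_neq0// gt_eqF.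
Qed.

(** Comes from expanding the squared distances about [y]. It is the identity behind [ker_inv], where
    both sides are infinite on the diagonal. *)
Lemma dist_inv2 (x z : E) : x != y -> z != y ->
  d (J x) (J z) = (d x z / (d x y * d z y))%R.
Proof.
move=> xy zy; have xp : (0 < d x y)%R by rewrite dist_gt0.
have zp : (0 < d z y)%R by rewrite dist_gt0.
have e0 : (0 <= d x z / (d x y * d z y))%R.
  by rewrite divr_ge0 ?mulr_ge0 ?dist_ge0.
apply/eqP; rewrite -(@eqrXn2 _ 2)// ?dist_ge0//; apply/eqP.
rewrite expr_div_n exprMn !dist_sqr.
have -> : ((J x : 'rV[R]_n) - J z = (J x - y) - (J z - y))%R.
  by rewrite opprB addrA subrK.
have -> : ((x : 'rV[R]_n) - z = (x - y) - (z - y))%R by rewrite opprB addrA subrK.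
rewrite !inv_sub !dist_sqr.
have := dist_sqr x y; have := dist_sqr z y.
move: ((x : 'rV[R]_n) - y)%R ((z : 'rV[R]_n) - y)%R => u v vE uE.
have u0 : dotp u u != 0%R by rewrite -uE expf_neq0// gt_eqF.
have v0 : dotp v v != 0%R by rewrite -vE expf_neq0// gt_eqF.
rewrite !(dotpDl, dotpDr, dotpNl, dotpNr, dotpZl, dotpZr) (dotpC v u).
by field; rewrite u0 v0.
Qed.

Lemma ker_inv (x z : E) : x != y -> z != y ->
  K (J x) (J z) = ((d x y) `^ be * (d z y) `^ be)%R%:E * K x z.
Proof.
move=> xy zy; have xp : (0 < d x y)%R by rewrite dist_gt0.
have zp : (0 < d z y)%R by rewrite dist_gt0.
rewrite !kerE /kr.
have [/eqP|xz] := eqVneq (d x z) 0%R.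
  rewrite dist_eq0 => /eqP ->; rewrite distxx eqxx gt0_muley//.
  by rewrite lte_fin mulr_gt0 ?powR_gt0.
have xzp : (0 < d x z)%R by rewrite lt0r xz dist_ge0.
rewrite dist_inv2// mulf_eq0 (negbTE xz) invr_eq0 mulf_eq0 !gt_eqF//=.
rewrite -EFinM; congr EFin.
have e0 : (0 <= (d x y * d z y)^-1)%R by rewrite invr_ge0 mulr_ge0 ?ltW.
rewrite powRM ?dist_ge0// mulrC; congr (_ * _)%R.
rewrite -(powR_inv1 (ltW (mulr_gt0 xp zp))) -powRrM mulN1r opprB.
by rewrite powRM ?dist_ge0.
Qed.

Lemma measurable_inversion : measurable_fun setT J.
Proof.
apply: measurable_to_Rn => i.
have -> : (fun t : E => (J t : 'rV[R]_n) 0%R i) =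
   (fun t : E => (y : 'rV[R]_n) 0 i + ((d t y)^-1 ^+ 2) * ((t : 'rV[R]_n) 0 i - (y : 'rV[R]_n) 0 i))%R.
  by apply/funext => t; rewrite /inversion_at !mxE exprVn.
have md : measurable_fun setT (fun t : E => d t y).
  by apply: measurable_dist; [exact: measurable_id|exact: measurable_cst].
have mi : measurable_fun setT (fun t : E => (d t y)^-1)%R.
  have -> : (fun t : E => (d t y)^-1)%R = (fun t : E => (d t y) `^ (-1))%R.
    by apply/funext => t; rewrite powR_inv1// dist_ge0.
  exact: (measurableT_comp (@measurable_powR R _) md).
apply: measurable_funD => //; apply: measurable_funM.
  exact: measurable_funX.
by apply: measurable_funB => //; exact: measurable_coord.
Qed.

(** A measure on the image of [B] is carried back by the involution [J], without a density. The
    image lies within [1 / r] of [y], so by [ker_inv] the energy grows at most by the factor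
    [r ^ (- 2 * be)]; the mass is unchanged, and the bound for [B] transfers. *)
Lemma cap_inv (B : set E) (r b : R) : (0 < r)%R -> (0 <= b)%R ->
  B `<=` [set x | (r <= d x y)%R] -> cap B <= b%:E ->
  cap (J @` B) <= ((r^-1) `^ be * (r^-1) `^ be * b)%R%:E.
Proof.
move=> r0 b0 Br cB; have be0 := exponent_gt0 hn halpha.
have ri0 : (0 < r^-1)%R by rewrite invr_gt0.
(* The centre is removed from the ball because [ker_inv] needs points different from [y]. *)
pose D : set E := [set x | (d x y <= r^-1)%R] `&` [set x | (0 < d x y)%R].
have mD : measurable D.
  apply: measurableI; first exact: measurable_ball_le.
  have -> : [set x : E | (0 < d x y)%R] = ~` [set x : E | (d x y <= 0)%R].
    by apply/seteqP; split => x /=; rewrite ltNge => /negP.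
  by apply: measurableC; exact: measurable_ball_le.
have JBD : J @` B `<=` D.
  move=> _ [x Bx <-]; have rx := Br _ Bx; have xp : (0 < d x y)%R := lt_le_trans r0 rx.
  have xy : x != y by rewrite -dist_gt0.
  by rewrite /D/= dist_inv// invr_gt0 lef_pV2.
have c0 : (0 <= (r^-1) `^ be * (r^-1) `^ be)%R by rewrite mulr_ge0 ?powR_ge0.
apply/cap_leP; first by rewrite mulr_ge0.
move=> mu muA mfin efin.
have [|||nu hnu] := @wpush_ex R _ _ E E mu (cst 1) J.
- exact: measurable_cst.
- by move=> x.
- exact: measurable_inversion.
have {}hnu f : measurable_fun setT f -> (forall x, 0 <= f x) ->
    \int[nu]_x f x = \int[mu]_x f (J x).
  by move=> mf f0; rewrite hnu//; apply: eq_integral => x _; rewrite mul1e.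
have hB S : measurable S -> nu S = mu (J @^-1` S).
  move=> mS; rewrite -(setIT S) -integral_indic// hnu//.
  - have mJ : measurable (J @^-1` S) by rewrite -[X in measurable X]setTI; exact: measurable_inversion.
    by rewrite -(setIT (J @^-1` _)) -integral_indic//= setIT.
  - by apply/measurable_EFinP; exact: measurable_indic.
have nuT : nu setT = mu setT by rewrite hB.
have nfin : nu setT < +oo by rewrite nuT.
have sn := fin_sigma_finite nfin; have sm := fin_sigma_finite mfin.
have nuB : concentrated nu B.
  case: muA => N [mN N0 sN].
  have mJN : measurable (J @^-1` N) by rewrite -[X in measurable X]setTI; exact: measurable_inversion.
  exists (J @^-1` N); split => //.
    rewrite hB// -N0; congr (mu _); apply/seteqP; split => x /=; by rewrite inversionK.
  move=> x nBx; apply: sN => -[z Bz Jz]; apply: nBx.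
  by rewrite -(inversionK x) -Jz inversionK.
have eE : energy nu <= ((r^-1) `^ be * (r^-1) `^ be)%R%:E * energy mu.
  have pE x : pot nu x = \int[mu]_z K x (J z).
    exact: (hnu (K x) (measurable_kerl alpha x) (fun z => ker_ge0 alpha x z)).
  have mpn := measurable_pot alpha sn; have mpm := measurable_pot alpha sm.
  have mpJ : measurable_fun setT (fun x => pot nu (J x)).
    exact: (measurableT_comp mpn measurable_inversion).
  have mKJ (x : E) : measurable_fun setT (fun z : E => K x (J z)).
    exact: (measurableT_comp (measurable_kerl alpha x) measurable_inversion).
  have -> : energy nu = \int[mu]_(x in D) pot nu (J x).
    rewrite -(conc_int muA JBD mD mpJ); last by move=> x; exact: pot_ge0.
    exact: (hnu (pot nu) mpn (fun x => pot_ge0 alpha nu x)).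
  have -> : energy mu = \int[mu]_(x in D) pot mu x.
    by apply: (conc_int muA JBD mD mpm) => x; exact: pot_ge0.
  rewrite -ge0_integralZl_EFin//; last 2 first.
  - by move=> x _; exact: pot_ge0.
  - exact: measurable_funS mpm.
  apply: ge0_le_integral.
  - exact: mD.
  - by move=> x _; exact: pot_ge0.
  - exact: measurable_funS mpJ.
  - by apply: measurable_funeM; exact: measurable_funS mpm.
  move=> x [/= xr xp]; rewrite pE /riesz_potential.
  rewrite (conc_int muA JBD mD (mKJ _)); last by move=> z; exact: ker_ge0.
  rewrite (conc_int muA JBD mD (measurable_kerl alpha x)); last by move=> z; exact: ker_ge0.
  have mkD : measurable_fun D (fun z => K x z) by exact: measurable_funS (measurable_kerl alpha x).
  rewrite -ge0_integralZl_EFin//; last by move=> z _; exact: ker_ge0.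
  apply: ge0_le_integral.
  - exact: mD.
  - by move=> z _; exact: ker_ge0.
  - exact: measurable_funS (mKJ _).
  - exact: measurable_funeM.
  - move=> z [/= zr zp]; rewrite ker_inv -?dist_gt0//.
    rewrite lee_wpmul2r ?ker_ge0// lee_fin ler_pM ?powR_ge0//;
    by apply: ge0_ler_powR; rewrite ?nnegrE ?dist_ge0 ?(ltW be0) ?(ltW ri0).
have em : energy mu \is a fin_num by rewrite ge0_fin_numE ?energy_ge0.
have enfin : energy nu < +oo.
  by rewrite (le_lt_trans eE)// -(fineK em) -EFinM ltry.
have en : energy nu \is a fin_num by rewrite ge0_fin_numE ?energy_ge0.
have [h _] := cap_leP alpha B b0.
have := h cB nu nuB nfin enfin; rewrite nuT => /le_trans; apply.
move: eE; rewrite -(fineK em) -(fineK en) -EFinM lee_fin => eE.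
by rewrite [leRHS]mulrAC [leRHS]mulrC ler_wpM2l.
Qed.

End Inversion.

(** * Comparison of the two series of capacities *)

Section Wiener.
Local Open Scope ereal_scope.
Variables (R : realType) (n : nat) (alpha : R).
Hypotheses (hn : (3 <= n)%N) (halpha : (0 < alpha <= 2)%R).
Local Notation E := (Rn R n).
Local Notation d := (@eucl_dist R n).
Local Notation cap := (@inner_capacity R n alpha).
Local Notation be := (n%:R - alpha)%R.
Variables (A : set E) (y : E) (q : R).
Hypothesis hq : (0 < q < 1)%R.
Local Notation shell k := [set x | (q ^+ k.+1 < eucl_dist x y <= q ^+ k)%R].

(** Inversion reverses the order of the radii, which is why annuli closed on the inside correspond
    to shells closed on the outside. *)
Lemma inv_shell k : inv_set A y `&` shell k =
  @inversion_at R n y @` (A `&` annulus q^-1 y k).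
Proof.
have [q0 q1] := andP hq.
have key (x : E) : x != y -> (q ^+ k.+1 < d (inversion_at y x) y <= q ^+ k)%R =
    (q^-1 ^+ k <= d x y < q^-1 ^+ k.+1)%R.
  move=> xy; have dp : (0 < d x y)%R by rewrite dist_gt0.
  rewrite dist_inv// andbC !exprVn; congr (_ && _).
    by rewrite -[in LHS](invrK (q ^+ k)%R) lef_pV2 ?posrE ?invr_gt0 ?exprn_gt0.
  by rewrite -[in LHS](invrK (q ^+ k.+1)%R) ltf_pV2 ?posrE ?invr_gt0 ?exprn_gt0.
apply/seteqP; split => [_ [[x [Ax /eqP xy] <-] h]|_ [x [Ax h] <-]].
  by exists x => //; split => //; rewrite /annulus /= -key.
have xy : x != y.
  rewrite -dist_gt0; case/andP: h => h _; apply: lt_le_trans h.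
  by rewrite exprn_gt0// invr_gt0.
by split; [exists x => //; split => //; exact/eqP|rewrite /= key].
Qed.

(** [cap_inv] is used in both directions, [J] being an involution. Radii within one annulus differ
    at most by the factor [1 / q], so the weighted term of the shell and the capacity of the annulus
    agree up to the constant [C], uniformly in [k]. *)
Lemma wiener_equiv :
  \sum_(k <oo) cap (A `&` annulus q^-1 y k) < +oo <->
  \sum_(k <oo) (cap (inv_set A y `&` shell k)
        * ((powR q (2 * k%:R * be))^-1)%R%:E) < +oo.
Proof.
have [q0 q1] := andP hq.
have be0 := exponent_gt0 hn halpha.
have qi : (1 < q^-1)%R by rewrite invf_gt1.
have sq (r : R) : (0 <= r)%R -> (r `^ be * r `^ be = (r ^+ 2) `^ be)%R.
  by move=> r0; rewrite -powRM// expr2.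
have qk k : (q `^ (2 * k%:R * be) = (q ^+ k) `^ be * (q ^+ k) `^ be)%R.
  rewrite sq ?exprn_ge0 ?ltW// -exprM powRrM; congr (_ `^ _)%R.
  by rewrite mulnC -natrM powR_mulrn// ltW.
have finB k : cap (A `&` annulus q^-1 y k) < +oo by exact: cap_annulus_fin.
have le1 k : cap (inv_set A y `&` shell k) * ((powR q (2 * k%:R * be))^-1)%R%:E
    <= cap (A `&` annulus q^-1 y k).
  have fB : cap (A `&` annulus q^-1 y k) \is a fin_num by rewrite ge0_fin_numE ?cap_ge0.
  have := @cap_inv R n alpha hn halpha y (A `&` annulus q^-1 y k) (q^-1 ^+ k)
    (fine (cap (A `&` annulus q^-1 y k))).
  rewrite exprn_gt0 ?invr_gt0// fine_ge0 ?cap_ge0// => /(_ isT isT) h.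
  rewrite inv_shell -[leRHS]fineK//.
  have {}h := h (fun x => fun h0 => proj1 (andP (proj2 h0))) _.
  rewrite fineK// lexx exprVn invrK in h; have {}h := h isT.
  apply: (@le_trans _ _ (((q ^+ k) `^ be * (q ^+ k) `^ be *
       fine (cap (A `&` annulus q^-1 y k)))%:E * (q `^ (2 * k%:R * be))^-1%:E)).
    by rewrite lee_wpmul2r// lee_fin invr_ge0 powR_ge0.
  have u0 : (0 < (q ^+ k) `^ be)%R by rewrite powR_gt0// exprn_gt0.
  by rewrite -EFinM lee_fin qk mulrAC mulfV ?mul1r// gt_eqF// mulr_gt0.
pose C := ((q^-1) `^ be * (q^-1) `^ be)%R.
have C0 : (0 <= C)%R by rewrite mulr_ge0 ?powR_ge0.
have le2 k : cap (A `&` annulus q^-1 y k) <=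
    C%:E * (cap (inv_set A y `&` shell k) * ((powR q (2 * k%:R * be))^-1)%R%:E).
  have fB : cap (inv_set A y `&` shell k) \is a fin_num.
    rewrite ge0_fin_numE ?cap_ge0//; apply: (@cap_fin_bounded R n alpha hn halpha _ y (q ^+ k)).
    by move=> x [_ /andP[_]].
  have := @cap_inv R n alpha hn halpha y (inv_set A y `&` shell k) (q ^+ k.+1)
    (fine (cap (inv_set A y `&` shell k))).
  rewrite exprn_gt0// fine_ge0 ?cap_ge0// => /(_ isT isT) h.
  have {}h := h (fun x h0 => ltW (proj1 (andP (proj2 h0)))) _.
  rewrite fineK// lexx in h; have {}h := h isT.
  have JJ : @inversion_at R n y @` (inv_set A y `&` shell k) = A `&` annulus q^-1 y k.
    rewrite inv_shell; apply/seteqP; split => [_ [_ [x hx <-] <-]|x hx]; first by rewrite inversionK.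
    by exists (inversion_at y x); [exists x|rewrite inversionK].
  rewrite JJ in h; apply: (le_trans h).
  rewrite -[X in _ <= _ * (X * _)]fineK// -!EFinM lee_fin qk.
  rewrite le_eqVlt; apply/orP; left; apply/eqP.
  have e1 : ((q ^+ k.+1)^-1 `^ be = (q^-1) `^ be * ((q ^+ k) `^ be)^-1)%R.
    rewrite exprSr invfM powRM ?invr_ge0 ?exprn_ge0 ?(ltW q0)// mulrC; congr (_ * _)%R.
    rewrite -(powR_inv1 (exprn_ge0 k (ltW q0))) -powRrM mulN1r powRN//.
  by rewrite e1 invfM /C; ring.
have c0 k : 0 <= cap (A `&` annulus q^-1 y k) by exact: cap_ge0.
have c1 k : 0 <= cap (inv_set A y `&` shell k) * ((powR q (2 * k%:R * be))^-1)%R%:E.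
  by rewrite mule_ge0 ?cap_ge0// lee_fin invr_ge0 powR_ge0.
split => h.
  by apply: le_lt_trans h; apply: lee_nneseries => // k _.
apply: (@le_lt_trans _ _ (C%:E * \sum_(k <oo) (cap (inv_set A y `&` shell k)
        * ((powR q (2 * k%:R * be))^-1)%R%:E))).
  by rewrite -nneseriesZl//; apply: lee_nneseries => // k _.
by rewrite lte_mul_pinfty.
Qed.

End Wiener.

(** * Vague limits *)

Section Content.
Local Open Scope ereal_scope.
Variables (R : realType) (n : nat).
Local Notation V := ('rV[R]_n).
Variables (L : set V -> R) (C : R).
Hypotheses (L0 : L set0 = 0%R)
  (LU : forall K K', compact K -> compact K' -> (L (K `|` K') <= L K + L K')%R)
  (LD : forall K K', compact K -> compact K' -> K `&` K' = set0 ->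
     L (K `|` K') = (L K + L K')%R)
  (LC : forall K, compact K -> (L K <= C)%R).

(** The classical extension of a content: inner values for open sets, then an outer measure for all
    sets. *)
Definition cinner (G : set V) : \bar R :=
  ereal_sup [set (L K)%:E | K in [set K | compact K /\ K `<=` G]].

Definition couter (X : set V) : \bar R :=
  ereal_inf [set cinner G | G in [set G | open G /\ X `<=` G]].

Lemma cinner_ub K G : compact K -> K `<=` G -> (L K)%:E <= cinner G.
Proof. by move=> cK KG; apply: ereal_sup_ubound; exists K. Qed.

Lemma cinner_le G c : (forall K, compact K -> K `<=` G -> (L K)%:E <= c) -> cinner G <= c.
Proof. by move=> h; apply: ge_ereal_sup => _ [K [cK KG] <-]; exact: h. Qed.

Lemma cinner_ge0 G : 0 <= cinner G.
Proof. by rewrite -[leLHS]/(0%:E) -L0; apply: cinner_ub => //; exact: compact0. Qed.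

Lemma cinner_leC G : cinner G <= C%:E.
Proof. by apply: cinner_le => K cK _; rewrite lee_fin LC. Qed.

Lemma cinner_mono G H : G `<=` H -> cinner G <= cinner H.
Proof.
by move=> GH; apply: cinner_le => K cK KG; apply: cinner_ub => //; exact: subset_trans GH.
Qed.

Lemma couter_open G : open G -> couter G = cinner G.
Proof.
move=> oG; apply/eqP; rewrite eq_le; apply/andP; split.
  by apply: ereal_inf_lbound; exists G => //; split.
by apply: le_ereal_inf_tmp => _ [H [oH GH] <-]; exact: cinner_mono.
Qed.

Lemma couter_le X G : open G -> X `<=` G -> couter X <= cinner G.
Proof. by move=> oG XG; apply: ereal_inf_lbound; exists G. Qed.

Lemma couter_ge0 X : 0 <= couter X.
Proof. by apply: le_ereal_inf_tmp => _ [G _ <-]; exact: cinner_ge0. Qed.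

Lemma couter_mono X Y : X `<=` Y -> couter X <= couter Y.
Proof.
move=> XY; apply: le_ereal_inf_tmp => _ [G [oG YG] <-]; apply: couter_le => //.
exact: subset_trans YG.
Qed.

Lemma couter0 : couter set0 = 0.
Proof.
rewrite couter_open; last exact: open0.
apply/eqP; rewrite eq_le cinner_ge0 andbT; apply: cinner_le => K cK; rewrite subset0 => ->.
by rewrite L0.
Qed.

(** By normality the points of [K] outside [H] have a neighbourhood [B] whose closure stays in [G];
    cutting [K] along [B] gives the two pieces. *)
Lemma compact_split (K G H : set V) : compact K -> open G -> open H -> K `<=` G `|` H ->
  exists K1 K2, [/\ compact K1, compact K2, K1 `<=` G, K2 `<=` H & K = K1 `|` K2].
Proof.
move=> cK oG oH KGH.
have clK : closed K by apply: compact_closed => //; exact: norm_hausdorff.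
have clKH : closed (K `&` ~` H) by apply: closedI => //; exact: open_closedC.
have [B nB BG] := @pseudometric_normal R V (K `&` ~` H) clKH G
  (fun x h => open_nbhs_nbhs (conj oG
     (match KGH x (proj1 h) with or_introl g => g | or_intror g => False_ind _ (proj2 h g) end))).
exists (K `&` closure B), (K `&` ~` interior B); split.
- by apply: (subclosed_compact _ cK) => //; apply: closedI => //; exact: closed_closure.
- apply: (subclosed_compact _ cK) => //; apply: closedI => //.
  by apply: open_closedC; exact: open_interior.
- by move=> x [_ /BG].
- move=> x [Kx nBx]; apply: contrapT => nHx; apply: nBx; exact: nB.
- apply/seteqP; split => [x Kx|x [[]//|[]//]].
  have [ix|ix] := pselect (interior B x); last by right.
  by left; split => //; apply: subset_closure; exact: interior_subset.
Qed.

Lemma cinner_bigcup_fin (G : nat -> set V) N (K : set V) : (forall i, open (G i)) -> compact K ->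
  K `<=` \bigcup_(i in `I_N) G i -> (L K)%:E <= \sum_(0 <= i < N) cinner (G i).
Proof.
move=> oG; elim: N K => [|N ih] K cK.
  rewrite II0 bigcup_set0 subset0 => ->; by rewrite big_nil L0.
rewrite IIS bigcup_setU bigcup_set1 => KG.
have oU : open (\bigcup_(i in `I_N) G i) by apply: bigcup_open => i _; exact: oG.
have [K1 [K2 [c1 c2 s1 s2 ->]]] := compact_split cK oU (oG N) KG.
rewrite big_nat_recr//=; apply: (@le_trans _ _ ((L K1)%:E + (L K2)%:E)).
  by rewrite -EFinD lee_fin LU.
by rewrite leeD//; [exact: ih|exact: cinner_ub].
Qed.

Lemma cinner_bigcup (G : nat -> set V) : (forall i, open (G i)) ->
  cinner (\bigcup_i G i) <= \sum_(i <oo) cinner (G i).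
Proof.
move=> oG; apply: cinner_le => K cK KG.
move: (cK); rewrite compact_cover => /(_ nat setT G (fun i _ => oG i) KG)[D _ KD].
have [N hN] : exists N, forall i : nat, i \in finmap.enum_fset D -> (i < N)%N.
  exists (\max_(i <- finmap.enum_fset D) i).+1 => i iD; rewrite ltnS.
  by rewrite (bigD1_seq i)//= ?leq_maxl ?finmap.fset_uniq.
have KN : K `<=` \bigcup_(i in `I_N) G i.
  by move=> x /KD[i iD Gx]; exists i => //=; exact: hN.
apply: (le_trans (cinner_bigcup_fin oG cK KN)).
by apply: (@nneseries_lim_ge R (fun i => cinner (G i)) xpredT) => k *; exact: cinner_ge0.
Qed.

Lemma couter_sigma : sigma_subadditive couter.
Proof.
move=> A; apply/lee_addgt0Pr => e e0.
apply: (le_trans _ (@epsilon_trick _ _ _ xpredT (fun k => couter_ge0 (A k)) (ltW e0))).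
have cf X : couter X \is a fin_num.
  rewrite ge0_fin_numE ?couter_ge0// (le_lt_trans _ (ltry C))//.
  by rewrite (le_trans _ (cinner_leC setT))// couter_le//; exact: openT.
have /choice[G hG] : forall k, exists G, [/\ open G, A k `<=` G &
    cinner G <= couter (A k) + (e / (2 ^ k.+1)%:R)%:E].
  move=> k; have ek : (0 < e / (2 ^ k.+1)%:R)%R by rewrite divr_gt0// ltr0n expn_gt0.
  have [_ [G [oG AG] <-] h] := lb_ereal_inf_adherent ek (cf (A k)).
  by exists G; split => //; exact: ltW.
apply: (@le_trans _ _ (cinner (\bigcup_k G k))).
  apply: couter_le; first by apply: bigcup_open => k _; have [] := hG k.
  by apply: subset_bigcup => k _; have [] := hG k.
apply: (le_trans (cinner_bigcup _)); first by move=> k; have [] := hG k.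
apply: lee_nneseries => [k _ _|k _]; first exact: cinner_ge0.
by have [] := hG k.
Qed.

(** Caratheodory's construction. The measure need not extend [L]: it dominates [L] on compact sets
    and is computed from compact subsets on open sets, and these one-sided facts suffice for the
    vague limit. *)
Lemma content_measure : exists mu : {measure set (Rn R n) -> \bar R},
  [/\ mu setT <= C%:E,
      forall K : set V, compact K -> (L K)%:E <= mu K &
      forall G : set V, open G -> mu G = cinner G].
Proof.
pose om := isOuterMeasure.Build R V couter couter0 couter_ge0 couter_mono couter_sigma.
pose mo : {outer_measure set V -> \bar R} := HB.pack couter om.
have cara_open G : open G -> mo.-caratheodory G.
  move=> oG; apply: le_caratheodory_measurable => X.
  rewrite /=; apply: le_ereal_inf_tmp => _ [H [oH XH] <-].
  have oHG : open (H `&` G) by exact: openI.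
  apply: (@le_trans _ _ (cinner (H `&` G) + couter (H `&` ~` G))).
    rewrite leeD//; first by apply: couter_le => //; exact: setSI.
    by apply: couter_mono; exact: setSI.
  have cf X' : couter X' \is a fin_num.
    rewrite ge0_fin_numE ?couter_ge0// (le_lt_trans _ (ltry C))//.
    by rewrite (le_trans _ (cinner_leC setT))// couter_le//; exact: openT.
  rewrite -leeBrDr; last exact: cf.
  apply: cinner_le => K cK KHG; rewrite leeBrDr; last exact: cf.
  have clK : closed K by apply: compact_closed => //; exact: norm_hausdorff.
  have oHK : open (H `&` ~` K) by apply: openI => //; exact: closed_openC.
  (* A compact [K] inside both [H] and [G] is fixed before compact sets in the rest of [H] are
     taken; additivity of [L] on disjoint compact sets then gives the Caratheodory inequality. *)
  apply: (@le_trans _ _ ((L K)%:E + cinner (H `&` ~` K))).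
    by rewrite leeD2l// couter_le// => x [Hx nGx]; split => // /KHG[].
  rewrite addeC -leeBrDr//; apply: cinner_le => K' cK' K'H; rewrite leeBrDr//.
  rewrite -EFinD addrC -LD//.
    apply: cinner_ub; first exact: compactU.
    by move=> x [/KHG[]//|/K'H[]].
  by apply/seteqP; split => // x [Kx /K'H[_]].
have cara_meas (B : set (Rn R n)) : measurable B -> mo.-caratheodory B.
  move=> mB; apply: (mB mo.-caratheodory); split; last by move=> G; exact: cara_open.
  split.
  - exact: caratheodory_measurable_set0.
  - by move=> S hS; rewrite setTD; exact: caratheodory_measurable_setC.
  - exact: caratheodory_measurable_bigcup.
have s_add : semi_sigma_additive (couter : set (Rn R n) -> \bar R).
  move=> F mF tF mUF.
  apply: (@caratheodory_measure_sigma_additive R _ mo F _ tF).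
    by move=> i; exact: cara_meas.
  exact: cara_meas.
pose mm := isMeasure.Build _ (Rn R n) R couter couter0 couter_ge0 s_add.
pose mu : {measure set (Rn R n) -> \bar R} := HB.pack (couter : set (Rn R n) -> \bar R) mm.
exists mu; split.
- rewrite -[mu setT]/(couter setT) couter_open; last exact: openT.
  exact: cinner_leC.
- move=> K cK; rewrite -[mu K]/(couter K); apply: le_ereal_inf_tmp => _ [G [oG KG] <-].
  exact: cinner_ub.
- by move=> G oG; rewrite -[mu G]/(couter G) couter_open.
Qed.

End Content.

Section Staircase.
Variable R : realType.

(** The staircase rises by [dl] at each multiple of [dl] that [t] reaches, so it stays within [dl]
    of [t] as long as its [N] steps suffice. This version belongs to closed superlevel sets, the
    strict one to open ones. *)
Lemma staircase_le (dl t : R) N : 0 < dl -> 0 <= t ->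
  let S := \sum_(0 <= i < N) dl * (dl *+ i.+1 <= t)%R%:R in
  S <= t /\ (t <= dl * N.+1%:R -> t <= dl + S).
Proof.
move=> d0 t0 /=.
(* The induction needs a dichotomy: either the staircase is already within [dl] of [t], or every
   step so far has been taken. *)
have [h1 [h2 h3]] : \sum_(0 <= i < N) dl * (dl *+ i.+1 <= t)%R%:R <= t /\
  \sum_(0 <= i < N) dl * (dl *+ i.+1 <= t)%R%:R <= dl * N%:R /\
  (t <= dl + \sum_(0 <= i < N) dl * (dl *+ i.+1 <= t)%R%:R \/
   \sum_(0 <= i < N) dl * (dl *+ i.+1 <= t)%R%:R = dl * N%:R).
  elim: N => [|N [h1 [h2 h3]]]; first by rewrite !big_nil mulr0; do !split => //; right.
  have -> : dl * N.+1%:R = dl * N%:R + dl by rewrite -natr1 mulrDr mulr1.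
  rewrite big_nat_recr//=.
  have -> : dl *+ N.+1 = dl * N%:R + dl by rewrite mulrSr mulr_natr.
  move: h1 h2 h3; move: (\sum_(0 <= i < N) _) => S h1 h2 h3.
  have [le|gt] := leP (dl * N%:R + dl) t.
    rewrite /= mulr1n mulr1; have SN : S = dl * N%:R by case: h3 => h3; lra.
    by split; [lra|split; [lra|right; rewrite SN]].
  rewrite /= mulr0n mulr0 addr0; split => //; split; first lra.
  by left; case: h3 => h3; lra.
by split=> // tN; case: h3 => [//|->]; move: tN; rewrite -natr1 mulrDr mulr1 addrC.
Qed.

Lemma staircase_lt (dl t : R) N : 0 < dl -> 0 <= t ->
  let S := \sum_(0 <= i < N) dl * (dl *+ i.+1 < t)%R%:R in
  S <= t /\ (t <= dl * N.+1%:R -> t <= dl + S).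
Proof.
move=> d0 t0 /=.
have [h1 [h2 h3]] : \sum_(0 <= i < N) dl * (dl *+ i.+1 < t)%R%:R <= t /\
  \sum_(0 <= i < N) dl * (dl *+ i.+1 < t)%R%:R <= dl * N%:R /\
  (t <= dl + \sum_(0 <= i < N) dl * (dl *+ i.+1 < t)%R%:R \/
   \sum_(0 <= i < N) dl * (dl *+ i.+1 < t)%R%:R = dl * N%:R).
  elim: N => [|N [h1 [h2 h3]]]; first by rewrite !big_nil mulr0; do !split => //; right.
  have -> : dl * N.+1%:R = dl * N%:R + dl by rewrite -natr1 mulrDr mulr1.
  rewrite big_nat_recr//=.
  have -> : dl *+ N.+1 = dl * N%:R + dl by rewrite mulrSr mulr_natr.
  move: h1 h2 h3; move: (\sum_(0 <= i < N) _) => S h1 h2 h3.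
  have [gt|le] := ltP (dl * N%:R + dl) t.
    rewrite /= mulr1n mulr1; have SN : S = dl * N%:R by case: h3 => h3; lra.
    by split; [lra|split; [lra|right; rewrite SN]].
  rewrite /= mulr0n mulr0 addr0; split => //; split; first lra.
  by left; case: h3 => h3; lra.
by split=> // tN; case: h3 => [//|->]; move: tN; rewrite -natr1 mulrDr mulr1 addrC.
Qed.

End Staircase.

Lemma fmap_ultra (T T' : Type) (f : T -> T') (U : set_system T) :
  UltraFilter U -> UltraFilter (f @ U).
Proof.
move=> UU; have PU : ProperFilter U := @ultra_proper _ _ UU.
split; first exact: fmap_proper_filter.
move=> G PG UG; apply/seteqP; split => [A GA|]; last exact: UG.
have [//|h] := in_ultra_setVsetC (f @^-1` A) UU.
have GC : G (~` A) by exact: UG.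
by have [x []] := filter_ex (filterI GA GC).
Qed.

(** * Vague compactness of bounded sequences of measures *)

Section VagueLimit.
Local Open Scope ereal_scope.
Variables (R : realType) (n : nat).
Local Notation V := ('rV[R]_n).
Local Notation E := (Rn R n).

Lemma compact_measurable (K : set V) : compact K -> measurable (K : set E).
Proof.
move=> cK; rewrite -[K]setCK; apply: measurableC; apply: open_measurable_Rn.
apply: closed_openC; apply: compact_closed => //; exact: norm_hausdorff.
Qed.

(** Nonnegative continuous functions vanishing at infinity. The last clause speaks of compact
    superlevel sets because these are the sets on which content and measure are compared. *)
Definition vanishing (phi : V -> R) :=
  [/\ forall x, (0 <= phi x)%R, continuous phi &
      forall s : R, (0 < s)%R -> compact [set x | (s <= phi x)%R]].

Lemma vanishing_bounded phi : vanishing phi -> exists M : R, forall x, (phi x <= M)%R.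
Proof.
move=> [p0 pc pK].
have cI : compact (phi @` [set x | (1 <= phi x)%R]).
  apply: continuous_compact; last exact: pK.
  exact: continuous_subspaceT.
have [M [Mr hM]] := compact_bounded cI.
exists (`|M| + 1)%R => x; have [h|h] := leP 1%R (phi x).
  have := hM (`|M| + 1)%R; rewrite (le_lt_trans (ler_norm M)) ?ltrDl// => /(_ isT).
  by move=> /(_ (phi x)) /= => hh; rewrite (le_trans (ler_norm _))// hh//; exists x.
by rewrite (le_trans (ltW h))// lerDr.
Qed.

Lemma vanishing_open phi (s : R) : vanishing phi -> open [set x | (s < phi x)%R].
Proof.
move=> [_ /continuousP pc _]; have := pc _ (@open_gt R s).
by congr open; apply/seteqP; split => x.
Qed.

Lemma vanishing_measurable phi : vanishing phi -> measurable_fun setT (phi : E -> R).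
Proof.
move=> [_ /continuousP pc _]; apply: (measurability _ (RGenOpens.measurableE R)).
move=> _ [_ [a [b ->]] <-]; rewrite setTI; apply: open_measurable_Rn.
by apply: pc; exact: interval_open.
Qed.

Lemma staircase_int (mu : {measure set E -> \bar R}) (dl : R) (P : nat -> E -> bool) N :
  (0 < dl)%R -> mu setT < +oo -> (forall i, measurable [set x | P i x]) ->
  \int[mu]_x (\sum_(0 <= i < N) dl * (P i x)%:R)%R%:E =
  (\sum_(0 <= i < N) dl * fine (mu [set x | P i x]))%R%:E.
Proof.
move=> d0 mf mP.
have eqI i : (fun x => (dl * (P i x)%:R)%R%:E) =
    (fun x => dl%:E * (\1_[set x | P i x] x)%:E).
  apply/funext => x; rewrite -EFinM indicE; congr (_ * _%:R)%R%:E.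
  by congr nat_of_bool; apply/idP/idP; rewrite inE.
under eq_integral do rewrite -sumEFin.
rewrite ge0_integral_sum//.
- rewrite -sumEFin; apply: eq_bigr => i _.
  rewrite eqI ge0_integralZl_EFin//; last 2 first.
  + by apply/measurable_EFinP; exact: measurable_indic.
  + exact: ltW.
  rewrite integral_indic// setIT EFinM fineK// ge0_fin_numE//.
  by rewrite (le_lt_trans _ mf)// le_measure// inE.
- move=> i; rewrite eqI; apply: measurable_funeM.
  by apply/measurable_EFinP; exact: measurable_indic.
- by move=> i x _; rewrite lee_fin mulr_ge0// ltW.
Qed.

(** An ultrafilter makes the masses of all measurable sets converge at once. The limit [L] is only
    finitely additive, but its values on compact sets generate [mu], with [mu <= L] on open sets and
    [L <= mu] on compact ones; the two staircases turn this into the two inequalities. They hold for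
    every eventual bound [b], so no subsequence appears later. *)
Lemma vague_limit (g : nat -> {measure set E -> \bar R}) (C : R) :
  (forall j, g j setT <= C%:E) ->
  exists mu : {measure set E -> \bar R}, mu setT <= C%:E /\
    forall phi, vanishing phi -> forall b : \bar R,
      ((\forall j \near \oo, \int[g j]_x (phi x)%:E <= b) ->
        \int[mu]_x (phi x)%:E <= b) /\
      ((\forall j \near \oo, b <= \int[g j]_x (phi x)%:E) ->
        b <= \int[mu]_x (phi x)%:E).
Proof.
move=> gC.
have [U [UU oU]] : exists U, UltraFilter U /\ \oo `<=` U.
  exact: (@ultraFilterLemma nat \oo _).
have PU : ProperFilter U := @ultra_proper _ _ UU.
have C0 : (0 <= C)%R by rewrite -lee_fin (le_trans _ (gC 0%N)).
have gfin j : g j setT < +oo by rewrite (le_lt_trans (gC j))// ltry.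
have gE j (S : set E) : measurable S -> g j S \is a fin_num.
  by move=> mS; rewrite ge0_fin_numE// (le_lt_trans _ (gfin j))// le_measure// inE.
have gle j (S : set E) : measurable S -> (0 <= fine (g j S) <= C)%R.
  move=> mS; rewrite fine_ge0//= -lee_fin fineK; last exact: gE.
  by rewrite (le_trans _ (gC j))// le_measure// inE.
have cvS (S : set E) : measurable S -> exists l : R,
    (fun j => fine (g j S)) @ U --> l.
  move=> mS; have := @segment_compact R 0%R C; rewrite compact_ultra.
  move=> hc; have hU : U ((fun j => fine (g j S)) @^-1` `[0%R, C]%classic).
    by apply: filterE => j; rewrite /= in_itv/=; exact: (gle j S mS).
  by have [l [_ hl]] := hc _ (fmap_ultra (fun j => fine (g j S)) UU) hU; exists l.
pose L (S : set E) : R := lim ((fun j => fine (g j S)) @ U).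
have Lc S : measurable S -> (fun j => fine (g j S)) @ U --> L S.
  by move=> mS; have [l hl] := cvS S mS; rewrite /L (cvg_lim _ hl).
have hR : hausdorff_space R by exact: Rhausdorff.
have Lle S (b : R) : measurable S -> (\forall j \near U, (fine (g j S) <= b)%R) -> (L S <= b)%R.
  by move=> mS hb; exact: (cvgr_to_le (Lc S mS) hb).
have L0 : L set0 = 0%R.
  rewrite /L; under eq_fun do rewrite measure0; exact: lim_cst.
have Lmono S S' : measurable S -> measurable S' -> S `<=` S' -> (L S <= L S')%R.
  move=> mS mS' SS'; apply: (ler_cvg_to (Lc S mS) (Lc S' mS')).
  by apply: filterE => j; rewrite fine_le ?gE// le_measure// inE.
have LC S : measurable S -> (L S <= C)%R.
  by move=> mS; apply: Lle => //; apply: filterE => j; have /andP[] := gle j S mS.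
have LUeq S S' : measurable S -> measurable S' -> S `&` S' = set0 ->
    L (S `|` S') = (L S + L S')%R.
  move=> mS mS' SS'; have mU : measurable (S `|` S') by exact: measurableU.
  have h := cvgD (Lc S mS) (Lc S' mS').
  apply: (cvg_unique hR (Lc _ mU)).
  have -> : (fun j => fine (g j (S `|` S'))) =
     ((fun j => fine (g j S)) \+ (fun j => fine (g j S')))%R; last exact: h.
  by apply/funext => j /=; rewrite -fineD ?gE// measureU.
have LU S S' : measurable S -> measurable S' -> (L (S `|` S') <= L S + L S')%R.
  move=> mS mS'; have mD : measurable (S' `\` S) by exact: measurableD.
  have -> : S `|` S' = S `|` (S' `\` S) by rewrite setDE setUIr setUv setIT.
  rewrite LUeq//; last by rewrite setDE setICA setICr setI0.
  by rewrite lerD2l Lmono// => x [].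
have [mu [mu1 mu2 mu3]] := @content_measure R n L C L0
  (fun K K' c c' => LU K K' (compact_measurable c) (compact_measurable c'))
  (fun K K' c c' => LUeq K K' (compact_measurable c) (compact_measurable c'))
  (fun K c => LC K (compact_measurable c)).
have mufin : mu setT < +oo by rewrite (le_lt_trans mu1)// ltry.
have muE (S : set E) : measurable S -> mu S \is a fin_num.
  by move=> mS; rewrite ge0_fin_numE// (le_lt_trans _ mufin)// le_measure// inE.
have muopen (G : set V) : open G -> mu G <= (L G)%:E.
  move=> oG; rewrite mu3//; apply: cinner_le => K cK KG.
  by rewrite lee_fin Lmono//; [exact: compact_measurable|exact: open_measurable_Rn].
exists mu; split => // phi vphi b; have [p0 pc pK] := vphi.
have [M hM] := vanishing_bounded vphi.
have mphi := vanishing_measurable vphi.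
have mEphi : measurable_fun setT (fun x : E => (phi x)%:E) by exact/measurable_EFinP.
have steps (dl : R) : (0 < dl)%R -> exists N : nat, forall x, (phi x <= dl * N.+1%:R)%R.
  move=> d0; exists (Num.truncn (M / dl)) => x; rewrite (le_trans (hM x))//.
  by rewrite mulrC -ler_pdivrMr// ltW// truncnS_gt.
have mlt (s : R) : measurable ([set x | (s < phi x)%R] : set E).
  by apply: open_measurable_Rn; exact: vanishing_open.
have cle (s : R) : (0 < s)%R -> compact [set x | (s <= phi x)%R] by exact: pK.
have mle (s : R) : (0 < s)%R -> measurable ([set x | (s <= phi x)%R] : set E).
  by move=> s0; apply: compact_measurable; exact: cle.
have mS (P : nat -> E -> bool) N (dl : R) : (forall i, measurable [set x | P i x]) ->
    measurable_fun setT (fun x : E => (\sum_(0 <= i < N) dl * (P i x)%:R)%R%:E).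
  move=> mP; apply/measurable_EFinP; apply: measurable_sum => i; apply: measurable_funM => //.
  have -> : (fun x => (P i x)%:R) = \1_[set x | P i x] :> (E -> R).
    apply/funext => x; rewrite indicE; congr (_%:R).
    by congr nat_of_bool; apply/idP/idP; rewrite inE.
  exact: measurable_indic.
have upper (m : {measure set E -> \bar R}) N (dl : R) (P : nat -> E -> bool) :
    (0 < dl)%R -> m setT <= C%:E ->
    (forall i, measurable [set x | P i x]) ->
    (forall x, phi x <= dl + \sum_(0 <= i < N) dl * (P i x)%:R)%R ->
    \int[m]_x (phi x)%:E <=
      (dl * C)%:E + (\sum_(0 <= i < N) dl * fine (m [set x | P i x]))%R%:E.
  move=> d0 mC mP hP; have mf : m setT < +oo by rewrite (le_lt_trans mC)// ltry.
  rewrite -staircase_int//.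
  apply: (@le_trans _ _ (\int[m]_x (dl%:E + (\sum_(0 <= i < N) dl * (P i x)%:R)%R%:E))).
    apply: ge0_le_integral => //.
    - by move=> x _; rewrite lee_fin.
    - by apply: emeasurable_funD => //; exact: mS.
    - by move=> x _; rewrite -EFinD lee_fin.
  rewrite ge0_integralD//.
  - rewrite leeD2r// integral_cst// EFinM lee_pmul2l//.
  - by move=> x _; rewrite lee_fin ltW.
  - by move=> x _; rewrite lee_fin; apply: sumr_ge0 => i _; rewrite mulr_ge0// ltW.
  - exact: mS.
have lower (m : {measure set E -> \bar R}) N (dl : R) (P : nat -> E -> bool) :
    (0 < dl)%R -> m setT <= C%:E ->
    (forall i, measurable [set x | P i x]) ->
    (forall x, \sum_(0 <= i < N) dl * (P i x)%:R <= phi x)%R ->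
    (\sum_(0 <= i < N) dl * fine (m [set x | P i x]))%R%:E <= \int[m]_x (phi x)%:E.
  move=> d0 mC mP hP; have mf : m setT < +oo by rewrite (le_lt_trans mC)// ltry.
  rewrite -staircase_int//; apply: ge0_le_integral => //.
  - by move=> x _; rewrite lee_fin; apply: sumr_ge0 => i _; rewrite mulr_ge0// ltW.
  - exact: mS.
  - by move=> x _; rewrite lee_fin.
have Lsum : forall (F : nat -> set E) (m : nat) (dl : R), (forall i, measurable (F i)) ->
    (fun j => \sum_(0 <= i < m) dl * fine (g j (F i)))%R @ U -->
    (\sum_(0 <= i < m) dl * L (F i))%R.
  move=> F m dl mF; elim: m => [|m ihm].
    under eq_fun do rewrite big_nil.
    by rewrite big_nil; exact: cvg_cst.
  under eq_fun do rewrite big_nat_recr//=.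
  rewrite big_nat_recr//=; apply: cvgD; first exact: ihm.
  by apply: cvgM; [exact: cvg_cst|exact: Lc].
split=> hb.
- have b0 : 0 <= b.
    have [j _ hj] : exists2 j, setT j & \int[g j]_x (phi x)%:E <= b.
      by have [N _ hN] := hb; exists N => //; apply: hN => /=.
    by rewrite (le_trans _ hj)// integral_ge0// => x _; rewrite lee_fin.
  have [->|bf] := eqVneq b +oo; first by rewrite leey.
  have {}bf : b \is a fin_num by rewrite ge0_fin_numE// ltey.
  apply/lee_addgt0Pr => e e0.
  pose dl := (e / (C + 1))%R.
  have d0 : (0 < dl)%R by rewrite divr_gt0// ltr_pwDr.
  have dC : (dl * C <= e)%R.
    by rewrite /dl mulrAC ler_pdivrMr ?ltr_pwDr// ler_pM2l// lerDl.
  have [N hN] := steps dl d0.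
  (* Strict superlevel sets are open, and there [mu] is at most [L]. *)
  pose P i (x : E) := (dl *+ i.+1 < phi x)%R.
  have mP i : measurable [set x | P i x] by exact: mlt.
  apply: (le_trans (@upper mu N dl P d0 mu1 mP _)).
    by move=> x; have [_] := staircase_lt N d0 (p0 x); apply.
  rewrite addeC leeD//.
  apply: (@le_trans _ _ (\sum_(0 <= i < N) dl * L [set x | P i x])%R%:E).
    rewrite lee_fin; apply: ler_sum => i _; rewrite ler_wpM2l ?(ltW d0)//.
    by rewrite -lee_fin fineK ?muE// muopen//; exact: vanishing_open.
  rewrite -(fineK bf) lee_fin.
  have hc := Lsum (fun i => [set x | P i x]) N dl mP.
  apply: (cvgr_to_le hc).
  apply: oU; apply: filterS hb => j hj.
  rewrite -lee_fin (fineK bf); apply: (le_trans _ hj); apply: lower => //.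
  by move=> x; have [] := staircase_lt N d0 (p0 x).
- apply/lee_addgt0Pr => e e0.
  pose dl := (e / (C + 1))%R.
  have d0 : (0 < dl)%R by rewrite divr_gt0// ltr_pwDr.
  have dC : (dl * C <= e)%R.
    by rewrite /dl mulrAC ler_pdivrMr ?ltr_pwDr// ler_pM2l// lerDl.
  have [N hN] := steps dl d0.
  (* The heights [dl *+ i.+1] are positive, so these sets are compact, and there [mu] is at least
     [L]. *)
  pose P i (x : E) := (dl *+ i.+1 <= phi x)%R.
  have dp i : (0 < dl *+ i.+1)%R by rewrite pmulrn_rgt0.
  have mP i : measurable [set x | P i x] by exact: mle.
  have hc := Lsum (fun i => [set x | P i x]) N dl mP.
  apply: (@le_trans _ _ ((\sum_(0 <= i < N) dl * L [set x | P i x])%R%:E + e%:E)); last first.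
    rewrite leeD2r//; apply: (le_trans _ (@lower mu N dl P d0 mu1 mP _)); last first.
      by move=> x; have [] := staircase_le N d0 (p0 x).
    rewrite lee_fin; apply: ler_sum => i _; rewrite ler_wpM2l ?(ltW d0)//.
    by rewrite -lee_fin fineK ?muE// mu2//; exact: cle.
  have hj : \forall j \near U, b <= ((\sum_(0 <= i < N) dl * fine (g j [set x | P i x]))%R + e)%:E.
    apply: oU; apply: filterS hb => j hj; apply: (le_trans hj).
    apply: (le_trans (@upper (g j) N dl P d0 (gC j) mP _)).
      by move=> x; have [_] := staircase_le N d0 (p0 x); apply.
    by rewrite -EFinD lee_fin addrC lerD2l.
  rewrite -EFinD; have [->|bNy] := eqVneq b -oo; first by rewrite leNye.
  have bf : b \is a fin_num.
    rewrite fin_numE bNy /=; have [j hj'] := filter_ex hj.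
    by rewrite lt_eqF// (le_lt_trans hj')// ltry.
  rewrite -(fineK bf) lee_fin -lerBlDr.
  apply: (cvgr_to_ge hc).
  by apply: filterS hj => j; rewrite -(fineK bf) lee_fin -lerBlDr.
Qed.

End VagueLimit.

(** * The Riesz kernel as a Gaussian mixture *)

Section OneDim.
Variable R : realType.
Local Notation leb := (@lebesgue_measure R).

(** The affine image of Lebesgue measure, rescaled by [c], gives intervals their length, and this
    characterises Lebesgue measure. *)
Lemma leb_affine (c b : R) (f : R -> \bar R) : 0 < c ->
  measurable_fun setT f -> (forall x, (0 <= f x)%E) ->
  (\int[leb]_x f x = c%:E * \int[leb]_x f (c * x + b)%R)%E.
Proof.
move=> c0 mf f0.
have mphi : measurable_fun setT (fun x : R => c * x + b).
  by apply: measurable_funD => //; apply: measurable_funM.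
have [|||nu hnu] := @wpush_ex R _ _ (measurableTypeR R) (measurableTypeR R) leb (cst c%:E)
   (fun x => c * x + b).
- exact: measurable_cst.
- by move=> x; rewrite lee_fin ltW.
- exact: mphi.
have hB (B : set R) : measurable B -> nu B = (c%:E * leb ((fun x : R => c * x + b)%R @^-1` B))%E.
  move=> mB; have mpB : measurable ((fun x => c * x + b) @^-1` B).
    by rewrite -[X in measurable X]setTI; exact: mphi.
  rewrite -(setIT B) -integral_indic// hnu//; last first.
    by apply/measurable_EFinP; exact: measurable_indic.
  rewrite ge0_integralZl_EFin//; last 2 first.
  + apply/measurable_EFinP; exact: (measurableT_comp (measurable_indic mB) mphi).
  + exact: ltW.
  congr (_ * _)%E; transitivity (leb (((fun x : R => c * x + b) @^-1` B) `&` setT)).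
    exact: (integral_indic leb measurableT mpB).
  by congr (leb _); rewrite setIT.
have eqm (A : set R) : measurable A -> leb A = nu A.
  apply: lebesgue_measure_unique => _ [[u v] _ <-].
  rewrite hB; last exact: measurable_itv.
  have -> : (fun x => c * x + b) @^-1` `](u, v).1, (u, v).2]%classic =
     `]((u - b) / c), ((v - b) / c)]%classic.
    apply/seteqP; split => x /=; rewrite !in_itv/= ltr_pdivrMr// ler_pdivlMr// ltrBlDr lerBrDr;
      by rewrite (mulrC x).
  rewrite !lebesgue_measure_itv/= !lte_fin ltr_pM2r ?invr_gt0// ltrD2r.
  case: ifP => _; last by rewrite mule0.
  rewrite -!EFinB -EFinM; congr EFin; by field; rewrite gt_eqF.
rewrite (@eq_measure_integral _ _ R setT nu leb f); last by move=> A mA _; exact: eqm.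
rewrite hnu// ge0_integralZl_EFin//; last exact: ltW.
exact: (measurableT_comp mf mphi).
Qed.

Lemma FTC_cc (f F : R -> R) (a b : R) : a < b ->
  (forall x, a <= x <= b -> is_derive x 1 F (f x)) ->
  (forall x, a <= x <= b -> {for x, continuous f}) ->
  (\int[leb]_(x in `[a, b]) (f x)%:E)%E = (F b - F a)%:E.
Proof.
move=> ab dF cf.
have cF x : a <= x <= b -> {for x, continuous F}.
  by move=> xab; apply: differentiable_continuous; apply/derivable1_diffP; case: (dF x xab).
rewrite (@continuous_FTC2 R f F a b ab) ?EFinB//.
- apply: continuous_in_subspaceT => x; rewrite inE/= in_itv/= => xab; exact: cf.
- split.
  + by move=> x; rewrite in_itv/= => /andP[ax xb]; case: (dF x) => //; rewrite !ltW.
  + by apply: cvg_at_right_filter; apply: cF; rewrite lexx ltW.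
  + by apply: cvg_at_left_filter; apply: cF; rewrite lexx ltW.
- move=> x; rewrite in_itv/= => /andP[ax xb]; rewrite derive1E.
  by case: (dF x) => //; rewrite !ltW.
Qed.

Lemma continuous_powR (e x : R) : 0 < x -> {for x, continuous (fun s : R => s `^ e)}.
Proof.
move=> x0; apply: differentiable_continuous; apply/derivable1_diffP.
by have := is_derive1_powR e x0; case.
Qed.

Lemma pow_int (e c b : R) : e != 0 -> 0 < c -> c < b ->
  (\int[leb]_(s in `[c, b]) (s `^ (e - 1))%:E)%E = ((b `^ e - c `^ e) / e)%:E.
Proof.
move=> e0 c0 cb.
rewrite mulrBl; apply: (@FTC_cc (fun s => s `^ (e - 1)) (fun s => s `^ e / e) c b cb).
- move=> x /andP[cx _]; have x0 := lt_le_trans c0 cx.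
  have h := is_derive1_powR e x0.
  have -> : (fun s : R => s `^ e / e) = e^-1 \*: (fun s : R => s `^ e).
    by apply/funext => s; rewrite /= mulrC.
  have := is_deriveZ e^-1 h; rewrite /GRing.scale/= => h2.
  by rewrite (_ : x `^ (e - 1) = e^-1 * (e * x `^ (e - 1)))// mulrA mulVf// mul1r.
- by move=> x /andP[cx _]; apply: continuous_powR; exact: lt_le_trans cx.
Qed.

Lemma leb_cvg (F : nat -> set R) (f : R -> \bar R) : (forall k, measurable (F k)) ->
  (forall k l, (k <= l)%N -> F k `<=` F l) ->
  measurable_fun setT f -> (forall x, (0 <= f x)%E) ->
  (fun k => \int[leb]_(x in F k) f x)%E @ \oo --> (\int[leb]_(x in \bigcup_k F k) f x)%E.
Proof.
move=> mF ndF mf f0.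
apply: (@ge0_nondecreasing_set_cvg_integral _ (measurableTypeR R) R F f leb) => //.
- by move=> k l kl; apply/subsetPset; exact: ndF.
- by move=> k; exact: measurable_funS mf.
Qed.

Lemma pow_tail (e c : R) : 0 < e -> 0 < c ->
  (\int[leb]_(s in `[c, +oo[) (s `^ (- e - 1))%:E <= (c `^ (- e) / e)%:E)%E.
Proof.
move=> e0 c0.
have mf : measurable_fun setT (fun s : R => (s `^ (- e - 1))%:E).
  by apply/measurable_EFinP; exact: measurable_powR.
have UF : \bigcup_k `[c, c + k.+1%:R]%classic = `[c, +oo[%classic :> set R.
  apply/seteqP; split => x /=; first by move=> [k _ /=]; rewrite !in_itv/= andbT => /andP[].
  rewrite in_itv/= andbT => cx; exists (Num.truncn (x - c)) => //=.
  by rewrite in_itv/= cx/= -lerBlDl ltW// truncnS_gt.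
have hc : (fun k => \int[leb]_(x in `[c, (c + k.+1%:R)%R]) (x `^ (- e - 1))%:E)%E @ \oo -->
    (\int[leb]_(x in `[c, +oo[) (x `^ (- e - 1))%:E)%E.
  rewrite -UF; apply: leb_cvg mf _; first by move=> k; exact: measurable_itv.
    move=> k l kl x /=; rewrite !in_itv/= => /andP[-> /le_trans]; apply.
    by rewrite lerD2l ler_nat.
  by move=> x; rewrite lee_fin powR_ge0.
rewrite -(cvg_lim _ hc)//.
apply: lime_le.
  apply: ereal_nondecreasing_is_cvgn => k l kl; apply: ge0_subset_integral => //.
  - exact: measurable_funS mf.
  - by move=> x _; rewrite lee_fin powR_ge0.
  - move=> x /=; rewrite !in_itv/= => /andP[-> /le_trans]; apply.
    by rewrite lerD2l ler_nat.
apply: nearW => k; rewrite pow_int ?oppr_eq0 ?gt_eqF// ?ltrDl// lee_fin.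
rewrite invrN mulrN -mulNr opprB ler_pM2r ?invr_gt0// gerBl powR_ge0//.
Qed.

Lemma ln_int (e : R) : 0 < e < 1 ->
  (\int[leb]_(s in `[e, 1%R]) (s^-1)%:E)%E = (- ln e)%:E.
Proof.
move=> /andP[e0 e1]; rewrite -[- ln e]sub0r -(@ln1 R).
apply: (@FTC_cc (fun s => s^-1) (@ln R) e 1 e1).
- by move=> x /andP[ex _]; apply: is_derive1_ln; exact: lt_le_trans ex.
- move=> x /andP[ex _]; apply: inv_continuous; rewrite gt_eqF//; exact: lt_le_trans ex.
Qed.

End OneDim.

Lemma measurable_inv (R : realType) : measurable_fun setT (fun t : R => t^-1).
Proof.
have -> : (fun t : R => t^-1) = (fun t : R => if t < 0 then - ((- t) `^ (- 1)) else t `^ (-1)).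
  apply/funext => t; case: ltP => t0; last by rewrite powR_inv1.
  by rewrite powR_inv1 ?oppr_ge0 ?(ltW t0)// invrN opprK.
apply: measurable_fun_ifT => //; first exact: measurable_fun_ltr.
apply: measurableT_comp => //; apply: (measurableT_comp (@measurable_powR R _)).
exact: oppr_measurable.
Qed.

(** * The mixture weight and its convolution *)

Section Pareto.
Variables (R : realType) (a : R).
Hypothesis ha : 0 < a <= 1.
Local Notation leb := (@lebesgue_measure R).

(* The Riesz kernel is a multiple of [\int ut t * g_t dt], where [g_t] is the Gaussian
   density of variance [t]; convolution by [pareto e] turns [ut] into [vt e]. *)
Definition ut (t : R) : R := if 0 < t then t `^ (a - 1) else 0.
Definition pareto (e s : R) : R := if e < s then a * e `^ a * s `^ (- a - 1) else 0.
Definition vt (e t : R) : R := if e < t then (t - e) `^ a / t else 0.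
Definition wt (e t : R) : R := if 0 < t then ut t - vt e t else 0.

Lemma ut_ge0 t : 0 <= ut t. Proof. by rewrite /ut; case: ifP => // _; exact: powR_ge0. Qed.

Lemma pareto_ge0 e s : 0 <= pareto e s.
Proof.
rewrite /pareto; case: ifP => // _; case/andP: ha => a0 _.
by rewrite !mulr_ge0 ?powR_ge0// ltW.
Qed.

Lemma measurable_ut : measurable_fun setT ut.
Proof.
by apply: measurable_fun_ifT => //; exact: measurable_fun_ltr.
Qed.

Lemma measurable_pareto e : measurable_fun setT (pareto e).
Proof.
apply: measurable_fun_ifT => //; first exact: measurable_fun_ltr.
by apply: measurable_funM => //; exact: measurable_powR.
Qed.

Lemma pareto_mass e : 0 < e -> (\int[leb]_s (pareto e s)%:E <= 1)%E.
Proof.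
move=> e0; case/andP: ha => a0 a1.
have mp : measurable_fun setT (fun s : R => (s `^ (- a - 1))%:E).
  by apply/measurable_EFinP; exact: measurable_powR.
apply: (@le_trans _ _ (\int[leb]_(s in `[e, +oo[) ((a * e `^ a)%:E * (s `^ (- a - 1))%:E))%E).
  rewrite [leRHS]integral_mkcond; apply: ge0_le_integral => //.
  - by move=> s _; rewrite lee_fin pareto_ge0.
  - by apply/measurable_EFinP; exact: measurable_pareto.
  - apply/(measurable_restrictT _ (measurable_itv _)); apply: measurable_funeM.
    exact: measurable_funS mp.
  - move=> s _; rewrite patchE /pareto; case: ifPn => es.
      by rewrite ifT ?lexx// inE/= in_itv/= andbT ltW.
    by case: ifP => // _; rewrite -EFinM lee_fin !mulr_ge0 ?powR_ge0 ?(ltW a0).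
rewrite ge0_integralZl_EFin//; last 3 first.
- by move=> s _; rewrite lee_fin powR_ge0.
- exact: measurable_funS mp.
- by rewrite mulr_ge0 ?powR_ge0 ?(ltW a0).
apply: (@le_trans _ _ ((a * e `^ a)%:E * (e `^ (- a) / a)%:E)%E).
  by rewrite lee_wpmul2l ?lee_fin ?mulr_ge0 ?powR_ge0 ?(ltW a0)//; exact: pow_tail.
have u0 : 0 < e `^ a by rewrite powR_gt0.
rewrite -EFinM lee_fin powRN le_eqVlt; apply/orP; left; apply/eqP.
by field; rewrite !gt_eqF.
Qed.

(* d/ds ((t - s) / s)^a = - a t (t - s)^(a - 1) s^(- a - 1) *)
Lemma pareto_ut_cc e t b : 0 < e -> e < b -> b < t ->
  (\int[leb]_(s in `[e, b]) (pareto e s * ut (t - s))%:E)%E =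
  ((e `^ a / t) * (((t - e) / e) `^ a - ((t - b) / b) `^ a))%:E.
Proof.
move=> e0 eb bt; case/andP: ha => a0 a1; have t0 : 0 < t by lra.
pose f s := a * e `^ a * s `^ (- a - 1) * (t - s) `^ (a - 1).
pose F s := - (e `^ a / t) * ((t - s) / s) `^ a.
transitivity (\int[leb]_(s in `[e, b]) (f s)%:E)%E.
  have mf1 : measurable_fun setT (fun s => pareto e s * ut (t - s)).
    apply: measurable_funM; first exact: measurable_pareto.
    by apply: (measurableT_comp measurable_ut); apply: measurable_funB.
  have mf2 : measurable_fun setT f.
    apply: measurable_funM; first by apply: measurable_funM => //; exact: measurable_powR.
    by apply: (measurableT_comp (@measurable_powR R _)); apply: measurable_funB.
  apply: eq_integral_itv_bounded; [exact: measurable_funS mf1|exact: measurable_funS mf2|].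
  move=> s; rewrite in_itv/= => /andP[es sb].
  by rewrite /pareto es /ut subr_gt0 (lt_trans sb bt).
have -> : (e `^ a / t) * (((t - e) / e) `^ a - ((t - b) / b) `^ a) = F b - F e.
  by rewrite /F; ring.
apply: (@FTC_cc R f F e b eb).
- move=> s /andP[es sb]; have s0 : 0 < s := lt_le_trans e0 es.
  have ts0 : 0 < t - s by lra.
  have q0 : 0 < (t - s) / s by rewrite divr_gt0.
  have d1 : is_derive s 1 (fun s : R => (t - s) / s) (- t * s ^- 2).
    have hB : is_derive s 1 (fun x : R => t - x) (0 - 1).
      exact: (is_deriveB (is_derive_cst t s 1) (is_derive_id s 1)).
    have hV := is_deriveV (lt0r_neq0 s0) (is_derive_id s (1 : R)).
    have hM := is_deriveM hB hV.
    apply: (is_derive_eq hM).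
    by rewrite /GRing.scale/=; field; rewrite gt_eqF.
  have d2 := @is_derive1_comp R (fun q : R => q `^ a) (fun s : R => (t - s) / s) s _ _ (is_derive1_powR a q0) d1.
  have d3 := is_deriveZ (- (e `^ a / t)) d2.
  apply: (is_derive_eq d3); rewrite /GRing.scale/= /f.
  have -> : ((t - s) / s) `^ (a - 1) = (t - s) `^ (a - 1) * s `^ (1 - a).
    rewrite powRM ?invr_ge0 ?(ltW ts0) ?(ltW s0)//; congr (_ * _).
    by rewrite -(powR_inv1 (ltW s0)) -powRrM mulN1r opprB.
  have -> : s `^ (- a - 1) = s `^ (1 - a) * s ^- 2.
    rewrite -(powR_invn 2 (ltW s0)) -powRD; last by rewrite (gt_eqF s0) implybT.
    by congr (_ `^ _); lra.
  field; rewrite ?gt_eqF//.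
- move=> s /andP[es sb]; have s0 : 0 < s := lt_le_trans e0 es.
  have ts0 : 0 < t - s by lra.
  apply: continuousM.
    by apply: continuousM; [exact: cvg_cst|exact: continuous_powR].
  apply: (@continuous_comp R R R (fun s => t - s) (fun s => s `^ (a - 1))).
    by apply: continuousB; [exact: cvg_cst|exact: cvg_id].
  exact: continuous_powR.
Qed.

(** [pareto_ut_cc] stops short of [s = t], where the weight may be singular, so the interval is
    exhausted by closed ones ending at [b k < t]. *)
Lemma pareto_ut e t : 0 < e ->
  (\int[leb]_s (pareto e s * ut (t - s))%:E)%E = (vt e t)%:E.
Proof.
move=> e0; case/andP: ha => a0 a1; rewrite /vt; have [et|te] := ltP e t; last first.
  rewrite integral0_eq// => s _; rewrite /pareto /ut.
  case: ifP => es; last by rewrite mul0r.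
  by rewrite subr_gt0 ltNge (le_trans te (ltW es)) mulr0.
have t0 : 0 < t by lra.
have mf1 : measurable_fun setT (fun s => (pareto e s * ut (t - s))%:E).
  apply/measurable_EFinP; apply: measurable_funM; first exact: measurable_pareto.
  by apply: (measurableT_comp measurable_ut); apply: measurable_funB.
have f0 s : (0 <= (pareto e s * ut (t - s))%:E)%E.
  by rewrite lee_fin mulr_ge0 ?pareto_ge0 ?ut_ge0.
pose C := ((t - e) / e) `^ a.
have C0 : 0 < C by rewrite powR_gt0// divr_gt0// subr_gt0.
(* The end points [b k] will satisfy [(t - b k) / b k = r k], so that the boundary term of
   [pareto_ut_cc] is exactly [C / k.+2]; a denominator above 1 keeps [e < b k]. *)
pose r k := (C / k.+2%:R) `^ a^-1.
have r0 k : 0 < r k by rewrite powR_gt0// divr_gt0// ltr0n.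
have ra k : r k `^ a = C / k.+2%:R.
  by rewrite -powRrM mulVf ?gt_eqF// powRr1// divr_ge0// ltW.
have rle k l : (k <= l)%N -> r l <= r k.
  move=> kl; apply: ge0_ler_powR; rewrite ?nnegrE ?divr_ge0 ?invr_ge0 ?(ltW a0) ?(ltW C0)//.
  by rewrite ler_pM2l// lef_pV2 ?posrE ?ltr0n// ler_nat !ltnS.
have te0 : 0 < (t - e) / e by rewrite divr_gt0// subr_gt0.
have r1 k : r k < (t - e) / e.
  have -> : (t - e) / e = C `^ a^-1 by rewrite /C -powRrM mulfV ?gt_eqF// powRr1// ltW.
  apply: gt0_ltr_powR; rewrite ?invr_gt0 ?nnegrE ?divr_ge0 ?(ltW C0)//.
  by rewrite gtr_pMr// invf_lt1 ?ltr0n// ltr1n.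
pose b k := t / (1 + r k).
have b1 k : 0 < 1 + r k by rewrite addr_gt0.
have bt k : b k < t by rewrite /b ltr_pdivrMr// ltr_pMr// ltrDl.
have eb k : e < b k.
  rewrite /b ltr_pdivlMr// mulrDr mulr1.
  have := r1 k; rewrite ltr_pdivlMr// mulrC; lra.
have bq k : (t - b k) / b k = r k.
  by rewrite /b; field; rewrite !gt_eqF.
have UF : \bigcup_k `[e, b k]%classic = `[e, t[%classic :> set R.
  apply/seteqP; split => x /=.
    move=> [k _ /=]; rewrite !in_itv/= => /andP[-> xb]/=; exact: le_lt_trans xb (bt k).
  rewrite in_itv/= => /andP[ex xt]; have x0 := lt_le_trans e0 ex.
  have q0 : 0 < (t - x) / x by rewrite divr_gt0// subr_gt0.
  have [k hk] : exists k : nat, C / (((t - x) / x) `^ a) <= k.+2%:R.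
    exists (Num.truncn (C / (((t - x) / x) `^ a))).
    by rewrite (le_trans (ltW (truncnS_gt _)))// ler_nat.
  exists k => //=; rewrite in_itv/= ex/=.
  have rk : r k <= (t - x) / x.
    have -> : (t - x) / x = (((t - x) / x) `^ a) `^ a^-1.
      by rewrite -powRrM mulfV ?gt_eqF// powRr1// ltW.
    apply: ge0_ler_powR; rewrite ?nnegrE ?divr_ge0 ?invr_ge0 ?(ltW a0) ?(ltW C0) ?powR_ge0//.
    rewrite ler_pdivrMr ?ltr0n// mulrC; move: hk; rewrite ler_pdivrMr// powR_gt0//.
  rewrite /b ler_pdivlMr// mulrDr mulr1; move: rk; rewrite ler_pdivlMr// mulrC; lra.
have -> : (\int[leb]_s (pareto e s * ut (t - s))%:E =
   \int[leb]_(s in `[e, t[) (pareto e s * ut (t - s))%:E)%E.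
  rewrite [RHS]integral_mkcond; apply: eq_integral => s _; rewrite patchE.
  case: ifPn => //; rewrite notin_setE/= in_itv/= /pareto /ut.
  case: ifPn => [es|]; last by rewrite mul0r.
  by rewrite (ltW es)/= subr_gt0 => /negP/negbTE ->; rewrite mulr0.
have ndb k l : (k <= l)%N -> b k <= b l.
  move=> kl; rewrite /b ler_pM2l// lef_pV2 ?posrE// lerD2l rle//.
have hc : (fun k => \int[leb]_(s in `[e, b k]) (pareto e s * ut (t - s))%:E)%E @ \oo -->
    (\int[leb]_(s in `[e, t[) (pareto e s * ut (t - s))%:E)%E.
  rewrite -UF; apply: leb_cvg mf1 f0; first by move=> k; exact: measurable_itv.
  by move=> k l kl x /=; rewrite !in_itv/= => /andP[-> /le_trans]; apply; exact: ndb.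
rewrite -(cvg_lim _ hc)//.
have eqk : (fun k => \int[leb]_(s in `[e, b k]) (pareto e s * ut (t - s))%:E)%E =
    (fun k => ((e `^ a / t) * (C - C * k.+2%:R^-1))%:E).
  by apply/funext => k; rewrite pareto_ut_cc// bq ra.
rewrite eqk; apply/cvg_lim => //; apply: cvg_EFin; first exact: nearW.
have -> : (t - e) `^ a / t = e `^ a / t * (C - C * 0).
  rewrite mulr0 subr0 /C powRM ?invr_ge0 ?(ltW e0) ?subr_ge0 ?(ltW et)//.
  rewrite -(powR_inv1 (ltW e0)) -powRrM mulN1r powRN.
  by field; rewrite !gt_eqF ?powR_gt0.
apply: cvgM; first exact: cvg_cst.
apply: cvgB; first exact: cvg_cst.
apply: cvgM; first exact: cvg_cst.
have := @cvg_harmonic R; rewrite -(cvg_shiftS (@harmonic R)).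
by apply.
Qed.

Lemma vt_ge0 e t : 0 < e -> 0 <= vt e t.
Proof.
move=> e0; rewrite /vt; case: ifP => // et; rewrite divr_ge0 ?powR_ge0//.
by rewrite ltW// (lt_trans e0).
Qed.

Lemma wt_ge0 e t : 0 < e -> 0 <= wt e t.
Proof.
move=> e0; case/andP: ha => a0 a1; rewrite /wt; case: ifP => // t0.
rewrite /ut t0 /vt; case: ifP => et; last by rewrite subr0 powR_ge0.
rewrite subr_ge0 ler_pdivrMr// [X in _ <= X]mulrC mulr_powRB1 ?(ltW t0)//.
by rewrite ge0_ler_powR ?nnegrE ?subr_ge0 ?(ltW a0) ?(ltW et) ?(ltW t0)// gerBl ltW.
Qed.

Lemma measurable_vt e : measurable_fun setT (vt e).
Proof.
apply: measurable_fun_ifT => //; first exact: measurable_fun_ltr.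
have -> : (fun t : R => (t - e) `^ a / t) = (fun t : R => (t - e) `^ a * t^-1) by [].
apply: measurable_funM.
  by apply: (measurableT_comp (@measurable_powR R a)); apply: measurable_funB.
exact: measurable_inv.
Qed.

Lemma ut_split e t : 0 < e -> ut t = vt e t + wt e t.
Proof.
move=> e0; rewrite /wt; have [t0|t0] := ltP 0 t; first by rewrite addrC subrK.
by rewrite /ut /vt !ltNge t0/= (le_trans t0 (ltW e0)) addr0.
Qed.

Lemma measurable_wt e : measurable_fun setT (wt e).
Proof.
apply: measurable_fun_ifT => //; first exact: measurable_fun_ltr.
by apply: measurable_funB; [exact: measurable_ut|exact: measurable_vt].
Qed.

Lemma powR_split (t : R) : 0 < t ->
  t `^ (a - 1) = t `^ a / t /\ t `^ (a - 2) = t `^ a / t / t.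
Proof.
move=> t0; have tN : t != 0 by rewrite gt_eqF.
split; first by rewrite powRD ?tN ?implybT// powR_inv1// ltW.
by rewrite powRD ?tN ?implybT// powR_invn ?(ltW t0)// expr2 invfM mulrA.
Qed.

(** With [x = e / t] this amounts to [1 - (1 - x) ^ a <= x], since an exponent [a <= 1] does not
    decrease a number between 0 and 1; for [t <= e] the term [vt] vanishes and [e / t >= 1]. *)
Lemma wt_ub e t : 0 < e -> 0 < t -> wt e t <= e * t `^ (a - 2).
Proof.
move=> e0 t0; case/andP: ha => a0 a1; have [E1 E2] := powR_split t0.
have u0 : 0 < t `^ a by rewrite powR_gt0.
rewrite /wt t0 /ut t0 /vt E1 E2; case: ifPn => [et|].
  have x0 : 0 < 1 - e / t by rewrite subr_gt0 ltr_pdivrMr// mul1r.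
  have -> : (t - e) `^ a = t `^ a * (1 - e / t) `^ a.
    rewrite -powRM ?(ltW t0) ?(ltW x0)//; congr (_ `^ _); field; by rewrite gt_eqF.
  have h : 1 - e / t <= (1 - e / t) `^ a.
    by apply: ger1_powR => //; rewrite x0 gerBl divr_ge0// ltW.
  rewrite -subr_ge0.
  have -> : e * (t `^ a / t / t) - (t `^ a / t - t `^ a * (1 - e / t) `^ a / t) =
    t `^ a / t * ((1 - e / t) `^ a - (1 - e / t)) by field; rewrite gt_eqF.
  by rewrite mulr_ge0 ?divr_ge0 ?subr_ge0 ?(ltW t0) ?(ltW u0).
rewrite -leNgt subr0 => te.
have -> : e * (t `^ a / t / t) = t `^ a / t * (e / t) by field; rewrite gt_eqF.
by rewrite ler_peMr ?divr_ge0 ?(ltW t0) ?(ltW u0)// ler_pdivlMr// mul1r.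
Qed.

(** The tangent at 1 of a concave power, obtained from Young's inequality with exponents [1 / a] and
    [1 / (1 - a)]; for [a = 1] it is an equality. *)
Lemma powR_tangent (x : R) : 0 <= x -> x `^ a <= 1 + a * (x - 1).
Proof.
move=> x0; case/andP: ha => a0; rewrite le_eqVlt => /predU1P[->|a1].
  by rewrite powRr1// mul1r addrC subrK.
have h := @conjugate_powR R (x `^ a) 1 a^-1 (1 - a)^-1 (powR_ge0 _ _) ler01.
have := h _ _ _; rewrite !invrK -powRrM mulfV ?gt_eqF// powRr1// powR1 mulr1 mul1r.
rewrite !invr_gt0 a0 subr_gt0 a1 addrC subrK => /(_ isT isT erefl) /le_trans; apply.
by rewrite le_eqVlt; apply/orP; left; apply/eqP; ring.
Qed.

(** [powR_tangent] at [1 - e / t] bounds the relative loss of weight from below by [a * e / t], and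
    [t ^ (a - 1) >= 1] for [t <= 1]. This [1 / t] is the source of the logarithm. *)
Lemma wt_lb e t : 0 < e -> e <= t -> t <= 1 -> a * e * t^-1 <= wt e t.
Proof.
move=> e0 et t1; case/andP: ha => a0 a1; have t0 := lt_le_trans e0 et.
have [E1 E2] := powR_split t0.
have u0 : 0 < t `^ a by rewrite powR_gt0.
have x0 : 0 <= 1 - e / t by rewrite subr_ge0 ler_pdivrMr// mul1r.
have vE : vt e t = t `^ a * (1 - e / t) `^ a / t.
  rewrite -powRM ?(ltW t0)//.
  have -> : t * (1 - e / t) = t - e by field; rewrite gt_eqF.
  rewrite /vt; case: ifPn => //; rewrite -leNgt => te.
  have -> : t = e by apply/eqP; rewrite eq_le te.
  by rewrite subrr powR0 ?gt_eqF// mul0r.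
rewrite /wt t0 vE /ut t0 E1.
have h := powR_tangent x0.
apply: (@le_trans _ _ (t `^ a / t * (a * (e / t)))); last first.
  rewrite -subr_ge0.
  have -> : t `^ a / t - t `^ a * (1 - e / t) `^ a / t - t `^ a / t * (a * (e / t)) =
    t `^ a / t * (1 + a * (1 - e / t - 1) - (1 - e / t) `^ a) by ring.
  by rewrite mulr_ge0 ?divr_ge0 ?subr_ge0 ?(ltW t0) ?(ltW u0).
have -> : t `^ a / t * (a * (e / t)) = (t `^ a / t) * (a * e * t^-1) by ring.
rewrite ler_peMl ?mulr_ge0 ?invr_ge0 ?(ltW a0) ?(ltW e0) ?(ltW t0)//.
by rewrite ler_pdivlMr// mul1r ger1_powR// t0.
Qed.

End Pareto.

(** * Gaussian densities and the standard Gaussian law *)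

Section Gaussian.
Variable R : realType.
Local Notation leb := (@lebesgue_measure R).

Definition phi (t x : R) : R := (2 * pi * t) `^ (- 2^-1) * expR (- (x ^+ 2) * (2 * t)^-1).

Lemma phi_ge0 t x : 0 <= phi t x.
Proof. by rewrite mulr_ge0 ?powR_ge0 ?expR_ge0. Qed.

Lemma measurable_phi d (T : measurableType d) (f g : T -> R) :
  measurable_fun setT f -> measurable_fun setT g ->
  measurable_fun setT (fun x => phi (f x) (g x)).
Proof.
move=> mf mg; apply: measurable_funM.
  by apply: (measurableT_comp (@measurable_powR R _)); apply: measurable_funM.
apply: measurableT_comp => //; apply: measurable_funM.
  by apply: measurableT_comp => //; exact: measurable_funX.
by apply: (measurableT_comp (@measurable_inv R)); apply: measurable_funM.
Qed.

Lemma phi_mass1 : (\int[leb]_z (phi 1 z)%:E = 1)%E.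
Proof.
rewrite -(@integral_normal_pdf R 0 1); apply: eq_integral => z _.
congr EFin; rewrite /normal_pdf oner_eq0 /normal_peak /normal_fun subr0 expr1n /phi.
rewrite mulr1 mul1r powRN powR12_sqrt ?mulr_ge0 ?pi_ge0// mulr1.
by rewrite mulr2n mulrDl !mul1r mulr2n.
Qed.

(* Completing the square. *)
Lemma phi_conv (s t x : R) : 0 < s -> 0 < t ->
  (\int[leb]_z (phi 1 z * phi t (x + Num.sqrt s * z))%:E = (phi (t + s) x)%:E)%E.
Proof.
move=> s0 t0; have ts : 0 < t + s by rewrite addr_gt0.
pose sg := Num.sqrt (t / (t + s)); pose m := - (x * Num.sqrt s / (t + s)).
have sg2 : sg ^+ 2 = t / (t + s) by rewrite sqr_sqrtr// divr_ge0// ltW.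
have sg0 : sg != 0 by rewrite gt_eqF// sqrtr_gt0 divr_gt0.
have ss : Num.sqrt s ^+ 2 = s by rewrite sqr_sqrtr// ltW.
have pi0 := pi_gt0 R.
have E z : phi 1 z * phi t (x + Num.sqrt s * z) = phi (t + s) x * normal_pdf m sg z.
  rewrite /normal_pdf (negbTE sg0) /normal_peak /normal_fun /phi.
  have -> : (Num.sqrt (sg ^+ 2 * pi *+ 2))^-1 = (2 * pi * (t / (t + s))) `^ (- 2^-1).
    rewrite powRN powR12_sqrt ?mulr_ge0 ?invr_ge0 ?(ltW t0) ?(ltW ts) ?(ltW pi0)//.
    by rewrite sg2 -mulr_natl; congr (Num.sqrt _)^-1; ring.
  rewrite [LHS]mulrACA [RHS]mulrACA -!expRD.
  rewrite -!powRM ?mulr_ge0 ?invr_ge0 ?(ltW t0) ?(ltW ts) ?(ltW pi0)//.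
  congr (_ * _); first by congr (_ `^ _); field; rewrite gt_eqF.
  congr expR; rewrite sg2 /m -mulr_natr.
  move: ts s0 ss; move: (Num.sqrt s) => q ts s0 ss; move: ts s0; rewrite -ss => ts s0.
  by field; rewrite !gt_eqF// !mulr_gt0.
under eq_integral do rewrite E EFinM.
rewrite ge0_integralZl_EFin//.
- by rewrite integral_normal_pdf mule1.
- by move=> z _; rewrite lee_fin normal_pdf_ge0.
- by apply/measurable_EFinP; exact: measurable_normal_pdf.
- exact: phi_ge0.
Qed.

Variable n : nat.
Local Notation E := (Rn R n).

Definition gk (t : R) (x : 'rV[R]_n) : R := \prod_(i < n) phi t (x 0 i).

Lemma gk_ge0 t x : 0 <= gk t x.
Proof. by apply: prodr_ge0 => i _; exact: phi_ge0. Qed.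

Lemma gkE t x : 0 < t ->
  gk t x = (2 * pi * t) `^ (- (n%:R / 2)) * expR (- dotp x x * (2 * t)^-1).
Proof.
move=> t0; rewrite /gk /phi big_split/= prodr_const card_ord -powR_mulrn ?powR_ge0//.
rewrite -powRrM; congr (_ `^ _ * _); first by rewrite mulNr mulrC.
rewrite -expR_sum; congr expR; rewrite /dotp -sumrN mulr_suml.
by apply: eq_bigr => i _; rewrite expr2.
Qed.

Lemma measurable_gk d (T : measurableType d) (f : T -> R) (g : T -> E) :
  measurable_fun setT f -> measurable_fun setT g ->
  measurable_fun setT (fun x => gk (f x) (g x)).
Proof.
move=> mf mg; apply: measurable_prod => i _; apply: measurable_phi => //.
exact: (measurableT_comp (measurable_coord i) mg).
Qed.

(** The image of a weighted product measure, which supplies laws of functions of two independent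
    variables. *)
Lemma conv_ex d1 d2 d3 (T1 : measurableType d1) (T2 : measurableType d2)
    (T3 : measurableType d3)
    (m1 : {measure set T1 -> \bar R}) (m2 : {measure set T2 -> \bar R})
    (rho : T1 * T2 -> \bar R) (f : T1 * T2 -> T3) :
  sigma_finite setT m1 -> sigma_finite setT m2 ->
  measurable_fun setT rho -> (forall x, (0 <= rho x)%E) -> measurable_fun setT f ->
  exists nu : {measure set T3 -> \bar R},
    forall h, measurable_fun setT h -> (forall y, (0 <= h y)%E) ->
      (\int[nu]_y h y = \int[m1]_x \int[m2]_y (rho (x, y) * h (f (x, y))))%E.
Proof.
move=> s1 s2 mr r0 mf.
pose m1' : {sigma_finite_measure set T1 -> \bar R} :=
  HB.pack_for (SigmaFiniteMeasure.type T1 R) (Measure.sort m1)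
    (isSFinite.Build _ _ _ _ (sfinite_measure_sigma_finite s1)) (isSigmaFinite.Build _ _ _ _ s1).
pose m2' : {sigma_finite_measure set T2 -> \bar R} :=
  HB.pack_for (SigmaFiniteMeasure.type T2 R) (Measure.sort m2)
    (isSFinite.Build _ _ _ _ (sfinite_measure_sigma_finite s2)) (isSigmaFinite.Build _ _ _ _ s2).
have [nu hnu] := @wpush_ex R _ _ (T1 * T2)%type T3 (m1' \x m2')%E rho f mr r0 mf.
exists nu => h mh h0; rewrite hnu//.
rewrite (@fubini_tonelli1 _ _ T1 T2 R m1' m2' (fun z => rho z * h (f z))%E)//.
- by apply: emeasurable_funM => //; exact: (measurableT_comp mh).
- by move=> z; rewrite mule_ge0.
Qed.

(** One independent normal coordinate is added at a time, starting from the Dirac measure at 0.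
    Besides the mass, only the effect on the densities is recorded: smoothing by [sqrt s] times the
    Gaussian variable raises the variance by [s]. *)
Lemma gauss_measure : exists G : {measure set E -> \bar R}, G setT = 1%E /\
  forall (s t : R) (x : 'rV[R]_n), 0 < s -> 0 < t ->
    (\int[G]_y (gk t (x + Num.sqrt s *: (y : 'rV[R]_n))%R)%:E = (gk (t + s) x)%:E)%E.
Proof.
(* At stage [k] the first [k] coordinates have gained variance [s] and the others none. *)
pose P k (G : {measure set E -> \bar R}) := G setT = 1%E /\
  forall (s t : R) (x : 'rV[R]_n), 0 < s -> 0 < t ->
    (\int[G]_y (gk t (x + Num.sqrt s *: (y : 'rV[R]_n))%R)%:E =
      (\prod_(i < n) (if (i < k)%N then phi (t + s) (x 0%R i) else phi t (x 0%R i)))%R%:E)%E.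
suff [G [G1 hG]] : exists G, P n G.
  exists G; split => // s t x s0 t0; rewrite hG//; congr EFin; apply: eq_bigr => i _.
  by rewrite ltn_ord.
have maff (x : 'rV[R]_n) (c : R) : measurable_fun setT (fun y : E => (x + c *: (y : 'rV[R]_n))%R : E).
  apply: measurable_to_Rn => i.
  rewrite (_ : (fun t : E => _) = (fun t : E => x 0 i + c * (t : 'rV[R]_n) 0 i)); last first.
    by apply/funext => t; rewrite !mxE.
  by apply: measurable_funD => //; apply: measurable_funM => //; exact: measurable_coord.
suff : forall k, (k <= n)%N -> exists G, P k G by apply.
elim=> [_|k ih kn].
  exists (\d_ (0%R : E)); split; first by rewrite /= diracE in_setT.
  move=> s t x s0 t0; rewrite integral_dirac//.
    by rewrite diracE in_setT mul1e scaler0 addr0.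
  apply/measurable_EFinP; apply: measurable_gk; [exact: measurable_cst|exact: maff].
have [G [G1 hG]] := ih (ltnW kn).
pose e : 'rV[R]_n := delta_mx 0 (Ordinal kn).
pose f (p : R * E) : E := ((p.2 : 'rV[R]_n) + p.1 *: e)%R.
have mf : measurable_fun setT f.
  apply: measurable_to_Rn => i.
  rewrite (_ : (fun t => _) = (fun t : R * E => (t.2 : 'rV[R]_n) 0 i + t.1 * e 0 i)); last first.
    by apply/funext => t; rewrite !mxE.
  apply: measurable_funD.
    exact: (measurableT_comp (measurable_coord i) measurable_snd).
  by apply: measurable_funM => //; exact: measurable_fst.
have sG : sigma_finite setT G by apply: fin_sigma_finite; rewrite G1 ltry.
have [|||nu hnu] := @conv_ex _ _ _ (measurableTypeR R) E E leb G
  (fun p => (phi 1 p.1)%:E) f (@sigma_finiteT _ _ _ leb) sG.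
- apply/measurable_EFinP; apply: measurable_phi; [exact: measurable_cst|exact: measurable_fst].
- by move=> p; rewrite lee_fin phi_ge0.
- exact: mf.
have mph1 : measurable_fun setT (fun z : R => (phi 1 z)%:E).
  by apply/measurable_EFinP; apply: measurable_phi.
exists nu; split.
  have := hnu (cst 1%E) (measurable_cst _) (fun=> lee01).
  rewrite integral_cst// mul1e => ->.
  transitivity (\int[leb]_z (phi 1 z)%:E)%E; last exact: phi_mass1.
  apply: eq_integral => z _.
  transitivity (\int[G]_y (cst (phi 1 z)%:E y))%E.
    by apply: eq_integral => y _ /=; rewrite mule1.
  by rewrite (integral_cst G measurableT (phi 1 z)%:E) G1 mule1.
move=> s t x s0 t0; rewrite hnu; last 2 first.
- by apply/measurable_EFinP; apply: measurable_gk; [exact: measurable_cst|exact: maff].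
- by move=> y; rewrite lee_fin gk_ge0.
pose rest := \prod_(i < n | i != Ordinal kn)
  (if (i < k)%N then phi (t + s) (x 0 i) else phi t (x 0 i)).
have rest0 : 0 <= rest.
  by apply: prodr_ge0 => i _; case: ifP => _; exact: phi_ge0.
transitivity (\int[leb]_z (rest%:E * (phi 1 z * phi t (x 0 (Ordinal kn) + Num.sqrt s * z))%R%:E))%E.
  apply: eq_integral => z _.
  have mg : measurable_fun setT (fun y : E => (gk t (x + Num.sqrt s *: (f (z, y) : 'rV[R]_n)))%:E).
    apply/measurable_EFinP; apply: measurable_gk; first exact: measurable_cst.
    apply: (measurableT_comp (maff x (Num.sqrt s))).
    exact: (measurableT_comp mf (measurable_pair1 z)).
  transitivity (\int[G]_y ((phi 1 z)%:E * (gk t (x + Num.sqrt s *: (f (z, y) : 'rV[R]_n)))%:E))%E.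
    by [].
  rewrite ge0_integralZl_EFin ?phi_ge0//; last by move=> y _; rewrite lee_fin gk_ge0.
  have -> : (fun y : E => (gk t (x + Num.sqrt s *: (f (z, y) : 'rV[R]_n)))%:E) =
     (fun y : E => (gk t ((x + (Num.sqrt s * z) *: e) + Num.sqrt s *: (y : 'rV[R]_n)))%:E).
    apply/funext => y; congr (gk t _)%:E.
    by rewrite /f scalerDr scalerA addrA addrAC.
  rewrite hG// -!EFinM; congr EFin.
  rewrite (bigD1 (Ordinal kn))//= ltnn.
  have -> : (x + (Num.sqrt s * z) *: e) 0 (Ordinal kn) = x 0 (Ordinal kn) + Num.sqrt s * z.
    by rewrite !mxE !eqxx mulr1.
  rewrite mulrA [RHS]mulrC; congr (_ * _); rewrite /rest; apply: eq_bigr => i ik.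
  have -> : (x + (Num.sqrt s * z) *: e) 0 i = x 0 i.
    by rewrite !mxE eqxx (negbTE ik) mulr0 addr0.
  by [].
rewrite ge0_integralZl_EFin//; last 2 first.
- by move=> z _; rewrite lee_fin mulr_ge0 ?phi_ge0.
- apply/measurable_EFinP; apply: measurable_funM; first exact: measurable_phi.
  apply: measurable_phi => //; apply: measurable_funD => //; exact: measurable_funM.
rewrite phi_conv// -EFinM; congr EFin.
rewrite [RHS](bigD1 (Ordinal kn))//= ltnSn mulrC; congr (_ * _).
apply: eq_bigr => i ik; congr (if _ then _ else _).
rewrite [RHS]ltnS [RHS]leq_eqVlt; case: eqP => // ik'.
by case/eqP: ik; apply: val_inj.
Qed.

End Gaussian.

(** * Splitting the kernel into an averaged part and a defect *)

Section StableOperators.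
Variables (R : realType) (n : nat) (alpha : R).
Hypotheses (hn : (3 <= n)%N) (halpha : 0 < alpha <= 2).
Local Notation E := (Rn R n).
Local Notation d := (@eucl_dist R n).
Local Notation K := (@riesz_kernel R n alpha).
Local Notation leb := (@lebesgue_measure R).
Local Notation a := (alpha / 2).

Let ha : 0 < a <= 1.
Proof. by case/andP: halpha => h1 h2; apply/andP; split; lra. Qed.

Lemma half_alpha : 0 < a <= 1. Proof. exact: ha. Qed.

Definition gr (t r : R) : R := (2 * pi * t) `^ (- (n%:R / 2)) * expR (- r ^+ 2 * (2 * t)^-1).

Lemma gr_ge0 t r : 0 <= gr t r. Proof. by rewrite mulr_ge0 ?powR_ge0 ?expR_ge0. Qed.

Lemma gk_dist t (x z : 'rV[R]_n) : 0 < t -> gk t (x - z) = gr t (d x z).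
Proof. by move=> t0; rewrite gkE// /gr dist_sqr. Qed.

Lemma measurable_gr d1 (T : measurableType d1) (f g : T -> R) :
  measurable_fun setT f -> measurable_fun setT g ->
  measurable_fun setT (fun x => gr (f x) (g x)).
Proof.
move=> mf mg; apply: measurable_funM.
  by apply: (measurableT_comp (@measurable_powR R _)); apply: measurable_funM.
apply: measurableT_comp => //; apply: measurable_funM.
  by apply: measurableT_comp => //; exact: measurable_funX.
by apply: (measurableT_comp (@measurable_inv R)); apply: measurable_funM.
Qed.

Lemma gr_le t r s : 0 <= r -> r <= s -> 0 < t -> gr t s <= gr t r.
Proof.
move=> r0 rs t0; rewrite /gr ler_wpM2l ?powR_ge0// ler_expR.
rewrite ler_wpM2r ?invr_ge0 ?mulr_ge0 ?(ltW t0)// lerN2.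
by rewrite ler_pXn2r// nnegrE (le_trans r0).
Qed.

(** The integrand of a Gamma integral in the variable [1 / t]: [rho > 0] controls it near 0, [b > 1]
    at infinity. *)
Definition hb (b rho t : R) : R := if 0 < t then t `^ (- b) * expR (- rho * t^-1) else 0.

Lemma hb_ge0 b rho t : 0 <= hb b rho t.
Proof. by rewrite /hb; case: ifP => // _; rewrite mulr_ge0 ?powR_ge0 ?expR_ge0. Qed.

Lemma measurable_hb b rho : measurable_fun setT (hb b rho).
Proof.
apply: measurable_fun_ifT => //; first exact: measurable_fun_ltr.
apply: measurable_funM; first exact: measurable_powR.
apply: measurableT_comp => //; apply: measurable_funM => //; exact: measurable_inv.
Qed.

Lemma hb_small b rho : 0 < rho -> exists C : R, forall t, 0 < t <= 1 -> hb b rho t <= C.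
Proof.
(* An integer [k >= b]: the bound [exp x >= (x / k) ^ k] at [x = rho / t] cancels the power of
   [t]. *)
move=> rho0; pose k := (Num.truncn `|b|).+1.
have bk : b <= k%:R by rewrite (le_trans (ler_norm b))// ltW// truncnS_gt.
have k0 : 0 < k%:R :> R by rewrite ltr0n.
exists ((k%:R / rho) ^+ k) => t /andP[t0 t1]; rewrite /hb t0.
have e1 : t `^ (- b) <= (t^-1) ^+ k.
  rewrite exprVn -powR_invn ?(ltW t0)// ger_powR ?t0// lerN2//.
have e2 : (rho / t / k%:R) ^+ k <= expR (rho * t^-1).
  have -> : expR (rho * t^-1) = expR ((rho / t / k%:R) * k%:R).
    by rewrite divfK// gt_eqF.
  rewrite expRM_natr ler_pXn2r ?nnegrE ?expR_ge0 ?divr_ge0 ?(ltW t0) ?(ltW rho0)//.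
  by rewrite (le_trans _ (expR_ge1Dx _))// lerDr ler01.
have q0 : 0 < (rho / t / k%:R) ^+ k by rewrite exprn_gt0// !divr_gt0.
rewrite mulNr expRN.
apply: (@le_trans _ _ ((t^-1) ^+ k * ((rho / t / k%:R) ^+ k)^-1)).
  by rewrite ler_pM ?powR_ge0 ?invr_ge0 ?expR_ge0// lef_pV2 ?posrE ?expR_gt0.
rewrite -exprVn -exprMn le_eqVlt; apply/orP; left; apply/eqP; congr (_ ^+ _).
by field; rewrite !gt_eqF.
Qed.

Lemma hb_int b rho : 1 < b -> 0 < rho -> (\int[leb]_t (hb b rho t)%:E < +oo)%E.
Proof.
move=> b1 rho0; have [C hC] := hb_small b rho0.
have C0 : 0 <= C by rewrite (le_trans (hb_ge0 b rho 1))// hC// ltr01 lexx.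
have mh : measurable_fun setT (fun t => (hb b rho t)%:E).
  by apply/measurable_EFinP; exact: measurable_hb.
have mp : measurable_fun setT (fun s : R => (s `^ (- (b - 1) - 1))%:E).
  by apply/measurable_EFinP; exact: measurable_powR.
apply: (@le_lt_trans _ _ (\int[leb]_(t in `[0%R, 1%R]) C%:E +
    \int[leb]_(s in `[1%R, +oo[) (s `^ (- (b - 1) - 1))%:E)%E).
  rewrite [X in (_ <= X + _)%E]integral_mkcond [X in (_ <= _ + X)%E]integral_mkcond.
  rewrite -ge0_integralD//; last 4 first.
  - by move=> t _; rewrite patchE; case: ifP => // _; rewrite lee_fin.
  - apply/(measurable_restrictT _ (measurable_itv _)); exact: measurable_cst.
  - by move=> t _; rewrite patchE; case: ifP => // _; rewrite lee_fin powR_ge0.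
  - apply/(measurable_restrictT _ (measurable_itv _)); exact: measurable_funS mp.
  apply: ge0_le_integral => //.
  - by move=> t _; rewrite lee_fin hb_ge0.
  - apply: emeasurable_funD.
      apply/(measurable_restrictT _ (measurable_itv _)); exact: measurable_cst.
    apply/(measurable_restrictT _ (measurable_itv _)); exact: measurable_funS mp.
  move=> t _; rewrite !patchE.
  have [t0|t0] := ltP 0 t; last first.
    rewrite /hb ltNge t0/=; apply: adde_ge0; case: ifP => // _; rewrite lee_fin// powR_ge0//.
  have [t1|t1] := leP t 1.
    rewrite ifT; last by rewrite inE/= in_itv/= (ltW t0).
    rewrite -[leLHS]adde0 leeD ?lee_fin ?hC ?t0//.
    by case: ifP => // _; rewrite lee_fin powR_ge0.
  rewrite -[leLHS]add0e leeD//; first by case: ifP => // _; rewrite lee_fin.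
  rewrite ifT; last by rewrite inE/= in_itv/= andbT ltW.
  rewrite lee_fin /hb t0 opprB addrAC subrr sub0r ler_piMr ?powR_ge0//.
  by rewrite -expR0 ler_expR mulNr oppr_le0 mulr_ge0 ?invr_ge0 ?(ltW t0) ?(ltW rho0).
rewrite integral_cst//= lebesgue_measure_itv/= lte_fin ltr01 -EFinB subr0 mule1.
rewrite lte_add_pinfty ?ltry//.
by rewrite (le_lt_trans (pow_tail _ _)) ?ltry// subr_gt0.
Qed.

Lemma ut_gr t r : ut a t * gr t r =
  (2 * pi) `^ (- (n%:R / 2)) * hb (n%:R / 2 + 1 - a) (r ^+ 2 / 2) t.
Proof.
rewrite /ut /hb; case: ifP => t0; last by rewrite mul0r mulr0.
rewrite /gr powRM ?mulr_ge0 ?pi_ge0 ?(ltW t0)//.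
have -> : t `^ (- (n%:R / 2 + 1 - a)) = t `^ (a - 1) * t `^ (- (n%:R / 2)).
  rewrite -powRD; last by rewrite (gt_eqF t0) implybT.
  by congr (_ `^ _); ring.
have -> : - r ^+ 2 * (2 * t)^-1 = - (r ^+ 2 / 2) * t^-1.
  by field; rewrite gt_eqF.
by ring.
Qed.

Lemma exponent_gt1 : 1 < n%:R / 2 + 1 - a.
Proof.
have : 3 <= n%:R :> R by rewrite ler_nat.
by case/andP: ha; lra.
Qed.

Definition k0 r : \bar R := (\int[leb]_t (ut a t * gr t r)%:E)%E.

Definition cst0 : R := fine (k0 1).

Lemma measurable_utgr r : measurable_fun setT (fun t => (ut a t * gr t r)%:E).
Proof.
apply/measurable_EFinP; apply: measurable_funM; first exact: measurable_ut.
by apply: measurable_gr.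
Qed.

Lemma k0_ge0 r : (0 <= k0 r)%E.
Proof. by apply: integral_ge0 => t _; rewrite lee_fin mulr_ge0 ?ut_ge0 ?gr_ge0. Qed.

Lemma k0_fin r : 0 < r -> (k0 r < +oo)%E.
Proof.
move=> r0; rewrite /k0; under eq_integral do rewrite ut_gr EFinM.
rewrite ge0_integralZl_EFin ?powR_ge0//; last 2 first.
- by move=> t _; rewrite lee_fin hb_ge0.
- by apply/measurable_EFinP; exact: measurable_hb.
rewrite lte_mul_pinfty ?lee_fin ?powR_ge0// hb_int ?exponent_gt1//.
by rewrite divr_gt0// exprn_gt0.
Qed.

Lemma cst0_gt0 : 0 < cst0.
Proof.
apply: fine_gt0; rewrite k0_fin// andbT.
pose f t : R := ut a t * gr t 1.
have fpos t : 0 < t -> 0 < f t.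
  move=> t0; rewrite /f /ut t0 mulr_gt0 ?powR_gt0// /gr mulr_gt0 ?expR_gt0 ?powR_gt0//.
  by rewrite !mulr_gt0 ?pi_gt0.
rewrite lt0e k0_ge0 andbT; apply/eqP => k00.
have mf := measurable_utgr 1.
have := @ae_eq_integral_abs _ (measurableTypeR R) R leb setT measurableT
   (fun t => (f t)%:E) mf.
have -> : (\int[leb]_x `|(f x)%:E| = 0)%E.
  rewrite -k00; apply: eq_integral => t _; rewrite gee0_abs// lee_fin.
  by rewrite mulr_ge0 ?ut_ge0 ?gr_ge0.
case=> /(_ erefl) [N [mN N0 sN]] _.
have : (leb `]0%R, 1%R[%classic <= leb N)%E.
  rewrite le_measure ?inE//.
  move=> t /=; rewrite in_itv/= => /andP[t0 t1]; apply: sN => /(_ I) [ft].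
  by have := fpos t t0; rewrite ft ltxx.
by rewrite N0 lebesgue_measure_itv/= lte_fin ltr01 -EFinB subr0 lee_fin ler10.
Qed.

Lemma k0_fin1 : k0 1 = cst0%:E.
Proof. by rewrite fineK// ge0_fin_numE ?k0_ge0// k0_fin. Qed.

(** The substitution replacing [t] by [r ^ 2 * t] reduces to [r = 1]; the exponents add up to
    [2 + 2 * (a - 1) - n = alpha - n]. *)
Lemma k0E r : 0 < r -> k0 r = (cst0 * r `^ (alpha - n%:R))%:E.
Proof.
move=> r0; have r20 : 0 < r ^+ 2 by rewrite exprn_gt0.
rewrite /k0 (@leb_affine R (r ^+ 2) 0 _ r20 (measurable_utgr r)); last first.
  by move=> t; rewrite lee_fin mulr_ge0 ?ut_ge0 ?gr_ge0.
have E t : ut a (r ^+ 2 * t + 0) * gr (r ^+ 2 * t + 0) r =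
    ((r ^+ 2) `^ (a - 1) * (r ^+ 2) `^ (- (n%:R / 2))) * (ut a t * gr t 1).
  rewrite addr0 /ut pmulr_rgt0//; case: ifP => t0; last by rewrite !mul0r mulr0.
  rewrite /gr (powRM _ (ltW r20) (ltW t0)).
  have -> : 2 * pi * (r ^+ 2 * t) = r ^+ 2 * (2 * pi * t) by ring.
  rewrite (powRM _ (ltW r20)) ?mulr_ge0 ?pi_ge0 ?(ltW t0)//.
  have -> : - r ^+ 2 * (2 * (r ^+ 2 * t))^-1 = - 1 ^+ 2 * (2 * t)^-1.
    by field; rewrite !gt_eqF.
  by ring.
under eq_integral do rewrite E EFinM.
rewrite ge0_integralZl_EFin ?mulr_ge0 ?powR_ge0//; last 2 first.
- by move=> t _; rewrite lee_fin mulr_ge0 ?ut_ge0 ?gr_ge0.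
- exact: measurable_utgr.
rewrite -/(k0 1) k0_fin1 -!EFinM; congr EFin.
have -> : r ^+ 2 = r `^ 2 by rewrite -powR_mulrn// ltW.
have tl (e : R) : (r `^ 2) `^ e = r `^ (2 * e) by rewrite powRrM.
rewrite !tl mulrA -!powRD ?(gt_eqF r0) ?implybT// mulrC; congr (_ * _).
by congr (_ `^ _); lra.
Qed.

(** The mixture decreases with the distance, so its value at 0 dominates the values given by [k0E],
    which are unbounded near 0. *)
Lemma k0_0 : k0 0 = +oo%E.
Proof.
have h r : 0 < r -> ((cst0 * r `^ (alpha - n%:R))%:E <= k0 0)%E.
  move=> r0; rewrite -k0E//; apply: ge0_le_integral => //.
  - by move=> t _; rewrite lee_fin mulr_ge0 ?ut_ge0 ?gr_ge0.
  - exact: measurable_utgr.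
  - exact: measurable_utgr.
  - move=> t _; rewrite lee_fin /ut; case: ifP => t0; last by rewrite !mul0r.
    by rewrite ler_wpM2l ?powR_ge0// gr_le// ltW.
apply/eqyP => M M0.
have b0 := exponent_gt0 hn halpha.
have c0 := cst0_gt0.
pose r := (M / cst0) `^ (- (n%:R - alpha)^-1).
have r0 : 0 < r by rewrite powR_gt0// divr_gt0.
apply: le_trans (h r r0); rewrite lee_fin /r -powRrM.
have -> : - (n%:R - alpha)^-1 * (alpha - n%:R) = 1 by field; rewrite gt_eqF.
by rewrite powRr1 ?divr_ge0 ?(ltW M0) ?(ltW c0)// mulrC divfK// gt_eqF.
Qed.

Lemma kr_k0 r : 0 <= r -> kr n alpha r = ((cst0^-1)%:E * k0 r)%E.
Proof.
have c0 := cst0_gt0.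
move=> r0; rewrite /kr; case: eqP => [->|/eqP rn].
  by rewrite k0_0 gt0_muley// lte_fin invr_gt0.
have rp : 0 < r by rewrite lt0r rn.
by rewrite k0E// -EFinM mulrA mulVf ?mul1r// gt_eqF.
Qed.

(** [Kv e] is the kernel averaged over the law of [step e], and [Kw e] is what the averaging takes
    away. *)
Definition Kv e r : \bar R := ((cst0^-1)%:E * \int[leb]_t (vt a e t * gr t r)%:E)%E.
Definition Kw e r : \bar R := ((cst0^-1)%:E * \int[leb]_t (wt a e t * gr t r)%:E)%E.

Lemma measurable_vtgr e r : measurable_fun setT (fun t => (vt a e t * gr t r)%:E).
Proof.
apply/measurable_EFinP; apply: measurable_funM; first exact: measurable_vt.
by apply: measurable_gr.
Qed.

Lemma measurable_wtgr e r : measurable_fun setT (fun t => (wt a e t * gr t r)%:E).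
Proof.
apply/measurable_EFinP; apply: measurable_funM; first exact: measurable_wt.
by apply: measurable_gr.
Qed.

Let ci0 : 0 <= cst0^-1. Proof. by rewrite invr_ge0 ltW// cst0_gt0. Qed.

Lemma vtgr_ge0 e t r : 0 < e -> (0 <= (vt a e t * gr t r)%:E)%E.
Proof. by move=> e0; rewrite lee_fin mulr_ge0 ?gr_ge0 ?vt_ge0. Qed.

Lemma wtgr_ge0 e t r : 0 < e -> (0 <= (wt a e t * gr t r)%:E)%E.
Proof. by move=> e0; rewrite lee_fin mulr_ge0 ?gr_ge0 ?(wt_ge0 ha). Qed.

Lemma Kv_ge0 e r : 0 < e -> (0 <= Kv e r)%E.
Proof.
by move=> e0; rewrite mule_ge0 ?lee_fin// integral_ge0// => t _; exact: vtgr_ge0.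
Qed.

Lemma Kw_ge0 e r : 0 < e -> (0 <= Kw e r)%E.
Proof.
by move=> e0; rewrite mule_ge0 ?lee_fin// integral_ge0// => t _; exact: wtgr_ge0.
Qed.

Lemma kr_split e r : 0 < e -> 0 <= r -> kr n alpha r = (Kv e r + Kw e r)%E.
Proof.
move=> e0 r0; rewrite kr_k0// /Kv /Kw -ge0_muleDr ?integral_ge0//; last 2 first.
- by move=> t _; exact: vtgr_ge0.
- by move=> t _; exact: wtgr_ge0.
congr (_ * _)%E; rewrite -ge0_integralD//; last 4 first.
- by move=> t _; exact: vtgr_ge0.
- exact: measurable_vtgr.
- by move=> t _; exact: wtgr_ge0.
- exact: measurable_wtgr.
apply: eq_integral => t _; rewrite -EFinD -mulrDl; congr (_ * _)%:E.
exact: ut_split.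
Qed.

(** At distance at least [dl] the Gaussian factor makes [t ^ (a - 2)] harmless near 0, so the bound
    [wt_ub] integrates to a constant times [e]. *)
Lemma Kw_far (dl : R) : 0 < dl -> exists C : R, 0 <= C /\
  forall e r, 0 < e -> dl <= r -> (Kw e r <= (C * e)%:E)%E.
Proof.
move=> dl0; pose b := n%:R / 2 + 2 - a; pose rho := dl ^+ 2 / 2.
have b1 : 1 < b.
  by have := exponent_gt1; rewrite /b; lra.
have rho0 : 0 < rho by rewrite divr_gt0// exprn_gt0.
pose I1 := fine (\int[leb]_t (hb b rho t)%:E)%E.
have I1E : (\int[leb]_t (hb b rho t)%:E = I1%:E)%E.
  rewrite fineK// ge0_fin_numE ?hb_int// integral_ge0// => t _.
  by rewrite lee_fin hb_ge0.
have I10 : 0 <= I1 by apply: fine_ge0; apply: integral_ge0 => t _; rewrite lee_fin hb_ge0.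
exists (cst0^-1 * ((2 * pi) `^ (- (n%:R / 2)) * I1)); split.
  by rewrite !mulr_ge0 ?powR_ge0.
move=> e r e0 dr; rewrite /Kw -mulrA EFinM lee_wpmul2l ?lee_fin//.
apply: (@le_trans _ _ (\int[leb]_t (((2 * pi) `^ (- (n%:R / 2)) * e)%:E * (hb b rho t)%:E))%E).
  apply: ge0_le_integral => //.
  - by move=> t _; exact: wtgr_ge0.
  - exact: measurable_wtgr.
  - by apply: measurable_funeM; apply/measurable_EFinP; exact: measurable_hb.
  - move=> t _; rewrite -EFinM lee_fin /hb; have [t0|t0] := ltP 0 t; last first.
      by rewrite /wt ltNge t0/= mul0r mulr0.
    apply: (@le_trans _ _ (e * t `^ (a - 2) * gr t dl)).
      by rewrite ler_pM ?gr_ge0 ?(wt_ge0 ha) ?(wt_ub ha)// gr_le// ltW.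
    rewrite /gr powRM ?mulr_ge0 ?pi_ge0 ?(ltW t0)//.
    have -> : t `^ (- b) = t `^ (a - 2) * t `^ (- (n%:R / 2)).
      rewrite -powRD; last by rewrite (gt_eqF t0) implybT.
      by congr (_ `^ _); rewrite /b; ring.
    have -> : - dl ^+ 2 * (2 * t)^-1 = - rho * t^-1.
      by rewrite /rho; field; rewrite gt_eqF.
    by rewrite le_eqVlt; apply/orP; left; apply/eqP; ring.
rewrite ge0_integralZl_EFin//; last 3 first.
- by move=> t _; rewrite lee_fin hb_ge0.
- by apply/measurable_EFinP; exact: measurable_hb.
- by rewrite mulr_ge0 ?powR_ge0 ?(ltW e0).
by rewrite I1E -EFinM lee_fin le_eqVlt; apply/orP; left; apply/eqP; ring.
Qed.

(** The weight [vt] vanishes for [t <= e], and for larger [t] the Gaussian densities at distances 0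
    and 1 differ at most by the factor [M]. Finiteness here will exclude an atom of the step law at
    0. *)
Lemma Kv_center e : 0 < e -> (Kv e 0 < +oo)%E.
Proof.
move=> e0; rewrite /Kv lte_mul_pinfty ?lee_fin//.
pose M := expR ((2 * e)^-1).
apply: (@le_lt_trans _ _ (M%:E * k0 1)%E).
  rewrite /k0 -ge0_integralZl_EFin ?expR_ge0//; last 2 first.
  - by move=> t _; rewrite lee_fin mulr_ge0 ?ut_ge0 ?gr_ge0.
  - exact: measurable_utgr.
  apply: ge0_le_integral => //.
  - by move=> t _; exact: vtgr_ge0.
  - exact: measurable_vtgr.
  - by apply: measurable_funeM; exact: measurable_utgr.
  - move=> t _; rewrite -EFinM lee_fin.
    have [et|te] := ltP e t; last first.
      rewrite {1}/vt ltNge te/= mul0r.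
      by apply: mulr_ge0; [exact: expR_ge0|apply: mulr_ge0; [exact: ut_ge0|exact: gr_ge0]].
    have t0 : 0 < t := lt_trans e0 et.
    rewrite [X in _ <= X]mulrCA ler_pM ?gr_ge0 ?vt_ge0//.
      rewrite (ut_split a t e0) lerDl (wt_ge0 ha)//.
    rewrite /gr [X in _ <= X]mulrCA ler_wpM2l ?powR_ge0// -expRD ler_expR expr0n/= oppr0 mul0r.
    rewrite expr1n mulN1r subr_ge0 lef_pV2 ?posrE ?mulr_gt0// ler_pM2l// ltW//.
by rewrite lte_mul_pinfty ?lee_fin ?expR_ge0 ?k0_fin.
Qed.

Lemma measurable_Kw e : 0 < e -> measurable_fun setT (Kw e).
Proof.
move=> e0; apply: measurable_funeM.
apply: (@tonelli_measurable R _ _ _ _ leb (fun p : R * R => (wt a e p.2 * gr p.2 p.1)%:E)).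
- apply/measurable_EFinP; apply: measurable_funM.
    exact: (measurableT_comp (measurable_wt _ _) measurable_snd).
  by apply: measurable_gr; [exact: measurable_snd|exact: measurable_fst].
- by move=> p; exact: wtgr_ge0.
- exact: (@sigma_finiteT _ _ _ leb).
Qed.

Lemma measurable_Kv e : 0 < e -> measurable_fun setT (Kv e).
Proof.
move=> e0; apply: measurable_funeM.
apply: (@tonelli_measurable R _ _ _ _ leb (fun p : R * R => (vt a e p.2 * gr p.2 p.1)%:E)).
- apply/measurable_EFinP; apply: measurable_funM.
    exact: (measurableT_comp (measurable_vt _ _) measurable_snd).
  by apply: measurable_gr; [exact: measurable_snd|exact: measurable_fst].
- by move=> p; exact: vtgr_ge0.
- exact: (@sigma_finiteT _ _ _ leb).
Qed.

End StableOperators.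

Lemma pow_head (R : realType) (e : R) : 0 < e ->
  (\int[@lebesgue_measure R]_(s in `]0%R, 1%R]) (s `^ (e - 1))%:E <= (e^-1)%:E)%E.
Proof.
move=> e0.
have mf : measurable_fun setT (fun s : R => (s `^ (e - 1))%:E).
  by apply/measurable_EFinP; exact: measurable_powR.
have UF : \bigcup_k `[k.+2%:R^-1, 1]%classic = `]0, 1]%classic :> set R.
  apply/seteqP; split => x /=.
    move=> [k _ /=]; rewrite !in_itv/= => /andP[kx ->]; rewrite andbT.
    by rewrite (lt_le_trans _ kx)// invr_gt0 ltr0n.
  rewrite in_itv/= => /andP[x0 x1]; exists (Num.truncn x^-1) => //=.
  rewrite in_itv/= x1 andbT -[leRHS]invrK lef_pV2 ?posrE ?invr_gt0 ?ltr0n//.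
  by rewrite ltW// (lt_trans (truncnS_gt _))// ltr_nat.
have hc : (fun k => \int[@lebesgue_measure R]_(x in `[(k.+2%:R^-1)%R, 1%R])
    (x `^ (e - 1))%:E)%E @ \oo --> (\int[@lebesgue_measure R]_(x in `]0%R, 1%R]) (x `^ (e - 1))%:E)%E.
  rewrite -UF; apply: leb_cvg mf _; first by move=> k; exact: measurable_itv.
    move=> k l kl x /=; rewrite !in_itv/= => /andP[h ->]; rewrite andbT (le_trans _ h)//.
    by rewrite lef_pV2 ?posrE ?ltr0n// ler_nat !ltnS.
  by move=> x; rewrite lee_fin powR_ge0.
rewrite -(cvg_lim _ hc)//; apply: lime_le; first by apply/cvg_ex; eexists; exact: hc.
apply: nearW => k; rewrite pow_int ?gt_eqF ?invr_gt0 ?ltr0n ?invf_lt1 ?ltr1n// lee_fin.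
by rewrite powR1 ler_piMl ?invr_ge0 ?(ltW e0)// gerBl powR_ge0.
Qed.

(** * The step laws and the Gaussian test potential *)

Section Step.
Variables (R : realType) (n : nat) (alpha : R).
Hypotheses (hn : (3 <= n)%N) (halpha : 0 < alpha <= 2).
Local Notation E := (Rn R n).
Local Notation d := (@eucl_dist R n).
Local Notation K := (@riesz_kernel R n alpha).
Local Notation leb := (@lebesgue_measure R).
Local Notation a := (alpha / 2).
Local Notation gr := (@gr R n).
Local Notation cst0 := (cst0 n alpha).
Local Notation Kv := (@Kv R n alpha).
Local Notation Kw := (@Kw R n alpha).
Local Notation pot := (riesz_potential alpha).

Let ha : 0 < a <= 1. Proof. exact: half_alpha. Qed.
Let cst0_gt0 : 0 < cst0. Proof. exact: cst0_gt0. Qed.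
Let sleb : sigma_finite setT leb. Proof. exact: (@sigma_finiteT _ _ _ leb). Qed.

Lemma measurable_addv (x : 'rV[R]_n) : measurable_fun setT (fun y : E => (x + (y : 'rV[R]_n)) : E).
Proof.
apply: measurable_to_Rn => i; under eq_fun do rewrite mxE.
by apply: measurable_funD => //; exact: measurable_coord.
Qed.

Lemma kerk0 (x z : E) : K x z = ((cst0^-1)%:E * k0 n alpha (d x z))%E.
Proof. by rewrite kerE kr_k0// dist_ge0. Qed.

Lemma measurable_utgr2 d1 (T : measurableType d1) (f g : T -> R) :
  measurable_fun setT f -> measurable_fun setT g ->
  measurable_fun setT (fun x => (ut a (f x) * gr (f x) (g x))%:E).
Proof.
move=> mf mg; apply/measurable_EFinP; apply: measurable_funM.
  exact: (measurableT_comp (measurable_ut a)).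
exact: measurable_gr.
Qed.

Lemma utgr_ge0 t r : (0 <= (ut a t * gr t r)%:E)%E.
Proof. by rewrite lee_fin mulr_ge0 ?ut_ge0 ?gr_ge0. Qed.

Section OneStep.
Variables (G : {measure set E -> \bar R}).
Hypothesis G1 : G setT = 1%E.
Hypothesis hG : forall (s t : R) (x : 'rV[R]_n), 0 < s -> 0 < t ->
  (\int[G]_y (gk t (x + Num.sqrt s *: (y : 'rV[R]_n))%R)%:E = (gk (t + s) x)%:E)%E.

Let sG : sigma_finite setT G.
Proof. by apply: fin_sigma_finite; rewrite G1 ltry. Qed.

Lemma gauss_gr s t (x z : E) : 0 < s -> 0 < t ->
  (\int[G]_y (gr t (d ((x : 'rV[R]_n) + Num.sqrt s *: (y : 'rV[R]_n))%R z))%:E =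
   (gr (t + s) (d x z))%:E)%E.
Proof.
move=> s0 t0; rewrite -gk_dist ?addr_gt0// -(hG _ s0 t0); apply: eq_integral => y _.
by rewrite -gk_dist// addrAC.
Qed.

Lemma measurable_scalev s : measurable_fun setT (fun y : E => (Num.sqrt s *: (y : 'rV[R]_n)) : E).
Proof.
apply: measurable_to_Rn => i; under eq_fun do rewrite mxE.
by apply: measurable_funM => //; exact: measurable_coord.
Qed.

(** Averaging turns variance [t] into [t + s] in every density of the mixture; translating [t] moves
    this shift onto the weight. *)
Lemma gauss_ker s (x z : E) : 0 < s ->
  (\int[G]_y K ((x : 'rV[R]_n) + Num.sqrt s *: (y : 'rV[R]_n))%R z =
   (cst0^-1)%:E * \int[leb]_t (ut a (t - s) * gr t (d x z))%:E)%E.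
Proof.
move=> s0; under eq_integral do rewrite kerk0.
have md : measurable_fun setT
    (fun y : E => d ((x : 'rV[R]_n) + Num.sqrt s *: (y : 'rV[R]_n))%R z).
  apply: measurable_dist => //.
  by apply: (measurableT_comp (measurable_addv x)); exact: measurable_scalev.
rewrite ge0_integralZl_EFin ?invr_ge0 ?(ltW cst0_gt0)//; last 2 first.
- by move=> y _; apply: k0_ge0.
- apply: (@tonelli_measurable R _ _ _ _ leb (fun p : E * R => (ut a p.2 *
    gr p.2 (d ((x : 'rV[R]_n) + Num.sqrt s *: (p.1 : 'rV[R]_n))%R z))%:E)) => //.
  + apply: measurable_utgr2; first exact: measurable_snd.
    exact: (measurableT_comp md measurable_fst).
  + by move=> p; exact: utgr_ge0.
congr (_ * _)%E; rewrite /k0.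
rewrite (@tonelli_swap R _ _ _ _ G leb (fun p : E * R => (ut a p.2 *
    gr p.2 (d ((x : 'rV[R]_n) + Num.sqrt s *: (p.1 : 'rV[R]_n))%R z))%:E)) //=; first last.
- by move=> p; exact: utgr_ge0.
- apply: measurable_utgr2; first exact: measurable_snd.
  exact: (measurableT_comp md measurable_fst).
rewrite (@leb_affine R 1 s (fun t => (ut a (t - s) * gr t (d x z))%:E))// ?mul1e; last 2 first.
- apply/measurable_EFinP; apply: measurable_funM.
    by apply: (measurableT_comp (measurable_ut a)); apply: measurable_funB.
  exact: measurable_gr.
- by move=> t; rewrite lee_fin mulr_ge0 ?ut_ge0 ?gr_ge0.
apply: eq_integral => t _; rewrite mul1r addrK.
have [t0|t0] := ltP 0 t; last first.
  have -> : ut a t = 0 by rewrite /ut ltNge t0.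
  by rewrite mul0r integral0_eq// => y _; rewrite mul0r.
under eq_integral do rewrite EFinM.
rewrite ge0_integralZl_EFin ?ut_ge0//; last 2 first.
- by move=> y _; rewrite lee_fin gr_ge0.
- by apply/measurable_EFinP; apply: measurable_gr.
by rewrite gauss_gr// EFinM.
Qed.

(* What is used of the law [tau] of [sqrt s * Z], with [s] of density [pareto a e] and [Z] Gaussian. *)
Definition step e (tau : {measure set E -> \bar R}) :=
  [/\ (tau setT <= 1)%E, tau [set (0%R : 'rV[R]_n) : E] = 0%E &
   forall x z : E, (\int[tau]_y K ((x : 'rV[R]_n) + (y : 'rV[R]_n))%R z = Kv e (d x z))%E].

(** The Gaussian variable is integrated out first, which shifts the weight by [s], and then [s]
    itself, which is the identity [pareto_ut]; all integrands are nonnegative, so Tonelli's theorem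
    permits this order. *)
Lemma step_exG e : 0 < e -> exists tau : {measure set E -> \bar R}, step e tau.
Proof.
move=> e0.
have mf : measurable_fun setT (fun p : measurableTypeR R * E => (Num.sqrt p.1 *: (p.2 : 'rV[R]_n)) : E).
  apply: measurable_to_Rn => i; under eq_fun do rewrite mxE.
  apply: measurable_funM; last exact: (measurableT_comp (measurable_coord i) measurable_snd).
  by apply: (measurableT_comp (continuous_measurable_fun (@sqrt_continuous R))); exact: measurable_fst.
have mr : measurable_fun setT (fun p : measurableTypeR R * E => (pareto a e p.1)%:E).
  apply/measurable_EFinP.
  by apply: (measurableT_comp (measurable_pareto _ _)); exact: measurable_fst.
have [//|tau htau] := @conv_ex R _ _ _ (measurableTypeR R) E E leb G _ _ sleb sG mr _ mf.
  by move=> p; rewrite lee_fin (pareto_ge0 ha).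
have KE (x z : E) : (\int[tau]_y K ((x : 'rV[R]_n) + (y : 'rV[R]_n))%R z = Kv e (d x z))%E.
  rewrite htau/=; last 2 first.
  - by apply: measurable_ker => //; exact: measurable_addv.
  - by move=> y; exact: ker_ge0.
  transitivity (\int[leb]_s ((cst0^-1)%:E * \int[leb]_t (pareto a e s * (ut a (t - s) * gr t (d x z)))%:E))%E.
    apply: eq_integral => s _.
    have mK : measurable_fun setT (fun y : E => K ((x : 'rV[R]_n) + Num.sqrt s *: (y : 'rV[R]_n))%R z).
      apply: measurable_ker => //.
      by apply: (measurableT_comp (measurable_addv x)); exact: measurable_scalev.
    rewrite (@ge0_integralZl_EFin _ _ R G setT measurableT
       (fun y : E => K ((x : 'rV[R]_n) + Num.sqrt s *: (y : 'rV[R]_n))%R z))//; last 2 first.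
    - by move=> y _; exact: ker_ge0.
    - exact: (pareto_ge0 ha).
    have [es|se] := ltP e s; last first.
      have -> : pareto a e s = 0 by rewrite /pareto ltNge se.
      by rewrite mul0e integral0_eq ?mule0// => t _; rewrite mul0r.
    rewrite gauss_ker; last exact: lt_trans es.
    rewrite muleCA; congr (_ * _)%E.
    under [RHS]eq_integral do rewrite EFinM.
    rewrite ge0_integralZl_EFin//.
    - by move=> t _; rewrite lee_fin mulr_ge0 ?ut_ge0 ?gr_ge0.
    - apply/measurable_EFinP; apply: measurable_funM.
        by apply: (measurableT_comp (measurable_ut a)); apply: measurable_funB.
      exact: measurable_gr.
    - exact: (pareto_ge0 ha).
  pose F (p : R * R) : \bar R := (pareto a e p.1 * (ut a (p.2 - p.1) * gr p.2 (d x z)))%:E.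
  have F0 p : (0 <= F p)%E.
    by rewrite lee_fin; apply: mulr_ge0; [exact: pareto_ge0|rewrite mulr_ge0 ?ut_ge0 ?gr_ge0].
  have mF : measurable_fun setT F.
    apply/measurable_EFinP; apply: measurable_funM.
      by apply: (measurableT_comp (measurable_pareto _ _)); exact: measurable_fst.
    apply: measurable_funM.
      apply: (measurableT_comp (measurable_ut a)); apply: measurable_funB; first exact: measurable_snd.
      exact: measurable_fst.
    by apply: measurable_gr => //; exact: measurable_snd.
  rewrite ge0_integralZl_EFin ?invr_ge0 ?(ltW cst0_gt0)//; last 2 first.
  - by move=> s _; apply: integral_ge0 => t _; exact: (F0 (s, t)).
  - exact: (@tonelli_measurable R _ _ _ _ leb F).
  congr (_ * _)%E; rewrite (@tonelli_swap R _ _ _ _ leb leb F)//.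
  apply: eq_integral => t _; rewrite /F/=.
  rewrite EFinM -(pareto_ut ha)// muleC -ge0_integralZl_EFin ?gr_ge0//.
  - by apply: eq_integral => s _; rewrite -EFinM; congr EFin; ring.
  - by move=> s _; rewrite lee_fin mulr_ge0 ?ut_ge0 ?(pareto_ge0 ha).
  - apply/measurable_EFinP; apply: measurable_funM; first exact: measurable_pareto.
    by apply: (measurableT_comp (measurable_ut a)); apply: measurable_funB.
exists tau; split => //.
- have -> : tau setT = (\int[tau]_y 1)%E by rewrite integral_cst// mul1e.
  rewrite (htau (cst 1%E))//=; apply: le_trans (pareto_mass ha e0).
  rewrite le_eqVlt; apply/orP; left; apply/eqP; apply: eq_integral => s _.
  by rewrite (@integral_cst _ _ R G setT measurableT) G1 mule1 mulr1.
- have m0 : measurable [set (0%R : 'rV[R]_n) : E].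
    have -> : [set (0%R : 'rV[R]_n) : E] = [set y | (d y (0%R : 'rV[R]_n) <= 0)%R].
      apply/seteqP; split => y /=; first by move=> ->; rewrite distxx.
      by move=> h; apply/eqP; rewrite -dist_eq0 eq_le h dist_ge0.
    exact: measurable_ball_le.
  (* The kernel is infinite on the diagonal, so an atom at 0 would make [Kv e 0] infinite. *)
  have h : (+oo * tau [set (0%R : 'rV[R]_n) : E] < +oo)%E.
    apply: (@le_lt_trans _ _ (Kv e 0%R)); last exact: Kv_center.
    have -> : Kv e 0 = Kv e (d (0%R : 'rV[R]_n) (0%R : 'rV[R]_n)) by rewrite distxx.
    rewrite -KE -integral_cst//.
    apply: (@le_trans _ _ (\int[tau]_(y in [set (0%R : 'rV[R]_n) : E])
        K ((0%R : 'rV[R]_n) + (y : 'rV[R]_n))%R (0%R : 'rV[R]_n))%E).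
      rewrite le_eqVlt; apply/orP; left; apply/eqP; apply: eq_integral => y.
      by rewrite inE => /= ->; rewrite addr0 /riesz_kernel eqxx.
    apply: ge0_subset_integral => //.
    + by apply: measurable_ker => //; exact: measurable_addv.
    + by move=> y _; exact: ker_ge0.
  apply/eqP; rewrite eq_le measure_ge0 andbT leNgt; apply/negP => p.
  by move: h; rewrite gt0_mulye.
Qed.

Lemma gauss_kernel (w : R -> R) (x : E) : measurable_fun setT w -> (forall t, 0 <= w t) ->
  (forall t, t <= 0 -> w t = 0) ->
  (\int[G]_z \int[leb]_t (w t * gr t (d x z))%:E = \int[leb]_t (w t * gr (t + 1) (d x (0%R : 'rV[R]_n)))%:E)%E.
Proof.
move=> mw w0 wN.
rewrite (@tonelli_swap R _ _ _ _ G leb (fun p : E * R => (w p.2 * gr p.2 (d x p.1))%:E)) //=; first last.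
- by move=> p; rewrite lee_fin mulr_ge0 ?gr_ge0.
- apply/measurable_EFinP; apply: measurable_funM; first exact: (measurableT_comp mw measurable_snd).
  by apply: measurable_gr; [exact: measurable_snd|apply: measurable_dist => //; exact: measurable_fst].
apply: eq_integral => t _; have [t0|t0] := ltP 0 t; last first.
  by rewrite wN// mul0r integral0_eq// => y _; rewrite mul0r.
under eq_integral do rewrite EFinM.
rewrite ge0_integralZl_EFin//; last 2 first.
- by move=> y _; rewrite lee_fin gr_ge0.
- by apply/measurable_EFinP; apply: measurable_gr => //; exact: measurable_dist.
have h := @gauss_gr 1 t (0%R : 'rV[R]_n) x ltr01 t0.
transitivity ((w t)%:E * (gr (t + 1) (d (0%R : 'rV[R]_n) x))%:E)%E; last first.
  by rewrite -EFinM (dist_sym x).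
congr (_ * _)%E; transitivity (\int[G]_y0 (gr t (d ((0%R : 'rV[R]_n) + Num.sqrt 1 *: (y0 : 'rV[R]_n))%R x))%:E)%E; last exact: h.
by apply: eq_integral => y _; rewrite sqrtr1 scale1r add0r (dist_sym x).
Qed.

(** Averaging over [G] replaces variance [t] by [t + 1], so the densities stay bounded near [t = 0]
    and decay like [t ^ (- n / 2)]; the weight [ut] is integrable against both. *)
Lemma gauss_pot_fin x : (pot G x < +oo)%E.
Proof.
have b0 := exponent_gt1 hn halpha.
have -> : pot G x = ((cst0^-1)%:E * \int[leb]_t (ut a t * gr (t + 1)%R (d x (0%R : 'rV[R]_n)))%:E)%E.
  rewrite -gauss_kernel.
  - rewrite -ge0_integralZl_EFin ?invr_ge0 ?(ltW cst0_gt0)//.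
    + by apply: eq_integral => z _; rewrite kerk0.
    + by move=> z _; apply: integral_ge0 => t _; exact: utgr_ge0.
    + apply: (@tonelli_measurable R _ _ _ _ leb (fun p : E * R => (ut a p.2 * gr p.2 (d x p.1))%:E)) => //.
        by apply: measurable_utgr2; [exact: measurable_snd|apply: measurable_dist => //; exact: measurable_fst].
      by move=> p; exact: utgr_ge0.
  - exact: measurable_ut.
  - exact: ut_ge0.
  - by move=> t t0; rewrite /ut ltNge t0.
rewrite lte_mul_pinfty ?lee_fin ?invr_ge0 ?(ltW cst0_gt0)//.
set r := d x _.
pose M := (2 * pi) `^ (- (n%:R / 2)) : R.
have mp e : measurable_fun setT (fun s : R => (s `^ e)%:E).
  by apply/measurable_EFinP; exact: measurable_powR.
have grM t : 0 < t -> gr (t + 1) r <= M * Num.min 1 (t `^ (- (n%:R / 2))).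
  move=> t0; have t1 : 0 < t + 1 by rewrite addr_gt0.
  rewrite /gr; apply: (@le_trans _ _ ((2 * pi * (t + 1)) `^ (- (n%:R / 2)))).
    rewrite ler_piMr ?powR_ge0// -[leRHS]expR0 ler_expR mulNr oppr_le0.
    by apply: mulr_ge0; rewrite ?sqr_ge0// invr_ge0 mulr_ge0 ?ler0n ?(ltW t1).
  rewrite powRM ?mulr_ge0 ?pi_ge0 ?(ltW t1)// ler_wpM2l ?powR_ge0//.
  have pN s : 0 < s -> s <= t + 1 -> (t + 1) `^ (- (n%:R / 2)) <= s `^ (- (n%:R / 2)).
    move=> s0 st; rewrite !powRN lef_pV2 ?posrE ?powR_gt0//.
    by apply: ge0_ler_powR; rewrite ?nnegrE ?divr_ge0// ltW.
  by rewrite le_min pN ?lerDl// andbT (le_trans (pN 1 _ _)) ?powR1 ?lerDr// ltW.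
apply: (@le_lt_trans _ _ (M%:E * (\int[leb]_(s in `]0%R, 1%R]) (s `^ (a - 1))%:E +
    \int[leb]_(s in `[1%R, +oo[) (s `^ (- (n%:R / 2 - a) - 1))%:E))%E); last first.
  rewrite lte_mul_pinfty ?lee_fin ?powR_ge0// lte_add_pinfty//.
    by rewrite (le_lt_trans (pow_head _)) ?ltry//; case/andP: ha.
  by rewrite (le_lt_trans (pow_tail _ _)) ?ltry//; move: b0; lra.
rewrite [X in (_ <= _ * (X + _))%E]integral_mkcond [X in (_ <= _ * (_ + X))%E]integral_mkcond.
have mr1 : measurable_fun setT ((fun s : R => (s `^ (a - 1))%:E) \_ `]0%R, 1%R]).
  apply/(measurable_restrictT _ (measurable_itv _)); exact: measurable_funS (mp _).
have mr2 : measurable_fun setT ((fun s : R => (s `^ (- (n%:R / 2 - a) - 1))%:E) \_ `[1%R, +oo[).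
  apply/(measurable_restrictT _ (measurable_itv _)); exact: measurable_funS (mp _).
have n1 t : (0 <= ((fun s : R => (s `^ (a - 1))%:E) \_ `]0%R, 1%R]) t)%E.
  by rewrite patchE; case: ifP => // _; rewrite lee_fin powR_ge0.
have n2 t : (0 <= ((fun s : R => (s `^ (- (n%:R / 2 - a) - 1))%:E) \_ `[1%R, +oo[) t)%E.
  by rewrite patchE; case: ifP => // _; rewrite lee_fin powR_ge0.
rewrite -ge0_integralD//.
rewrite -ge0_integralZl_EFin ?powR_ge0//; last 2 first.
- by move=> t _; exact: adde_ge0.
- exact: emeasurable_funD.
apply: ge0_le_integral => //.
- by move=> t _; rewrite lee_fin mulr_ge0 ?ut_ge0 ?gr_ge0.
- apply/measurable_EFinP; apply: measurable_funM; first exact: measurable_ut.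
  by apply: measurable_gr => //; apply: measurable_funD.
- by apply: measurable_funeM; exact: emeasurable_funD.
move=> t _; have [t0|t0] := ltP 0 t; last first.
  by rewrite /ut ltNge t0/= mul0r mule_ge0 ?lee_fin ?powR_ge0// adde_ge0.
have [t1|t1] := leP t 1.
  apply: (@le_trans _ _ (M%:E * (t `^ (a - 1))%:E)%E).
    rewrite -EFinM lee_fin /ut t0 mulrC ler_wpM2r ?powR_ge0//.
    by rewrite (le_trans (grM _ t0))// ler_piMr ?powR_ge0// ge_min lexx.
  rewrite lee_wpmul2l ?lee_fin ?powR_ge0// -[leLHS]adde0 leeD//.
  by rewrite patchE ifT// inE/= in_itv/= t0.
apply: (@le_trans _ _ (M%:E * (t `^ (- (n%:R / 2 - a) - 1))%:E)%E).
  rewrite -EFinM lee_fin /ut t0.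
  have -> : t `^ (- (n%:R / 2 - a) - 1) = t `^ (a - 1) * t `^ (- (n%:R / 2)).
    rewrite -powRD; last by rewrite (gt_eqF t0) implybT.
    by congr (_ `^ _); ring.
  rewrite [leRHS]mulrCA ler_wpM2l ?powR_ge0//.
  by rewrite (le_trans (grM _ t0))// ler_wpM2l ?powR_ge0// ge_min lexx orbT.
rewrite lee_wpmul2l ?lee_fin ?powR_ge0// -[leLHS]add0e leeD//.
by rewrite patchE ifT// inE/= in_itv/= andbT ltW.
Qed.

(** For [t] between [e] and 1 the smoothed density has variance between 1 and 2 and is at least [m],
    whatever [e]; integrating [wt_lb] against it gives the logarithm. *)
Lemma gauss_Kw_lb x : exists2 c : R, 0 < c & forall e, 0 < e < 1 ->
  ((c * (e * - ln e))%:E <= \int[G]_z Kw e (d x z))%E.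
Proof.
have [a0 a1] := andP ha.
set r := d x (0%R : 'rV[R]_n).
pose m := (2 * pi * 2) `^ (- (n%:R / 2)) * expR (- r ^+ 2 * (2 * 1)^-1) : R.
have m0 : 0 < m by rewrite mulr_gt0 ?expR_gt0 ?powR_gt0// !mulr_gt0 ?pi_gt0.
exists (cst0^-1 * (a * m)); first by apply: mulr_gt0; [rewrite invr_gt0|exact: mulr_gt0].
move=> e /andP[e0 e1].
have -> : (\int[G]_z Kw e (d x z) =
    (cst0^-1)%:E * \int[leb]_t (wt a e t * gr (t + 1)%R r)%:E)%E.
  rewrite -gauss_kernel.
  - rewrite -ge0_integralZl_EFin ?invr_ge0 ?(ltW cst0_gt0)//.
    + by move=> z _; apply: integral_ge0 => t _; exact: wtgr_ge0.
    + apply: (@tonelli_measurable R _ _ _ _ leb (fun p : E * R => (wt a e p.2 * gr p.2 (d x p.1))%:E)) => //.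
        apply/measurable_EFinP; apply: measurable_funM.
          exact: (measurableT_comp (measurable_wt _ _) measurable_snd).
        by apply: measurable_gr; [exact: measurable_snd|apply: measurable_dist => //; exact: measurable_fst].
      by move=> p; exact: wtgr_ge0.
  - exact: measurable_wt.
  - by move=> t; exact: wt_ge0.
  - by move=> t t0; rewrite /wt ltNge t0.
have -> : (cst0^-1 * (a * m) * (e * - ln e))%:E = ((cst0^-1)%:E * (a * m * (e * - ln e))%:E)%E.
  by rewrite -[RHS]EFinM; congr EFin; ring.
rewrite lee_wpmul2l ?lee_fin ?invr_ge0 ?(ltW cst0_gt0)//.
apply: (@le_trans _ _ (\int[leb]_(t in `[e, 1%R]) (wt a e t * gr (t + 1)%R r)%:E)%E); last first.
  apply: ge0_subset_integral => //.
  - apply/measurable_EFinP; apply: measurable_funM; first exact: measurable_wt.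
    by apply: measurable_gr => //; apply: measurable_funD.
  - by move=> t _; rewrite lee_fin mulr_ge0 ?gr_ge0 ?(wt_ge0 ha).
have -> : a * m * (e * - ln e) = (m * (a * e)) * - ln e by ring.
have c0 : 0 <= m * (a * e) by apply/ltW/mulr_gt0 => //; exact: mulr_gt0.
have mi : measurable_fun (`[e, 1%R] : set R) (fun s : R => (s^-1)%:E).
  by apply: (@measurable_funS _ _ _ _ setT) => //; apply/measurable_EFinP; exact: measurable_inv.
rewrite EFinM -ln_int ?e0// -ge0_integralZl_EFin//; last first.
  by move=> s; rewrite /= in_itv/= => /andP[es _]; rewrite lee_fin invr_ge0 (le_trans (ltW e0)).
apply: ge0_le_integral => //.
- move=> s; rewrite /= in_itv/= => /andP[es _].
  by rewrite mule_ge0 ?lee_fin// invr_ge0 (le_trans (ltW e0)).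
- exact: measurable_funeM.
- apply: (@measurable_funS _ _ _ _ setT) => //.
  apply/measurable_EFinP; apply: measurable_funM; first exact: measurable_wt.
  by apply: measurable_gr => //; apply: measurable_funD.
move=> s; rewrite /= in_itv/= => /andP[es s1]; have s0 := lt_le_trans e0 es.
have s10 : 0 < s + 1 by rewrite addr_gt0.
rewrite -EFinM lee_fin (_ : m * (a * e) * s^-1 = (a * e * s^-1) * m); last by ring.
apply: ler_pM.
- by apply: mulr_ge0; [exact/ltW/mulr_gt0|rewrite invr_ge0 ltW].
- exact: ltW.
- exact: wt_lb.
rewrite /m /gr; apply: ler_pM; rewrite ?powR_ge0 ?expR_ge0//.
  rewrite !powRN lef_pV2 ?posrE ?powR_gt0 ?mulr_gt0 ?pi_gt0//.
  apply: ge0_ler_powR; rewrite ?nnegrE ?divr_ge0 ?mulr_ge0 ?pi_ge0 ?(ltW s10)//.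
  by rewrite ler_pM2l ?mulr_gt0 ?pi_gt0//; lra.
rewrite ler_expR !mulNr lerN2 ler_wpM2l ?sqr_ge0// lef_pV2 ?posrE ?mulr_gt0//.
by rewrite ler_pM2l// lerDr ltW.
Qed.

End OneStep.

Lemma step_ex e : 0 < e -> exists tau, step e tau.
Proof. by have [G [G1 hG]] := gauss_measure R n; exact: (step_exG G1 hG). Qed.

Lemma gauss_test : exists G : {measure set E -> \bar R}, [/\ G setT = 1%E,
  forall x, (pot G x < +oo)%E &
  forall x, exists2 c : R, 0 < c & forall e, 0 < e < 1 ->
    ((c * (e * - ln e))%:E <= \int[G]_z Kw e (d x z))%E].
Proof.
have [G [G1 hG]] := gauss_measure R n.
by exists G; split => //; [exact: gauss_pot_fin|exact: gauss_Kw_lb].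
Qed.

End Step.

(** * The domination principle *)

Section Semicontinuity.
Variables (R : realType) (n : nat).
Local Notation E := (Rn R n).
Local Notation d := (@eucl_dist R n).

Definition lsc (p : E -> \bar R) := forall x (c : R), (c%:E < p x)%E ->
  exists2 r : R, 0 < r & forall x', d x x' < r -> (c%:E < p x')%E.

Lemma lsc_open p (c : \bar R) : lsc p -> open ([set x | (c < p x)%E] : set 'rV[R]_n).
Proof.
move=> lp; apply/open_distP => x /= cp.
have [b /andP[cb bp]] : exists b : R, ((c <= b%:E) && (b%:E < p x))%E.
  case: c cp => [c||] cp; first by exists c; rewrite lexx.
    by move: cp; rewrite ltNge leey.
  case: (p x) cp => [s||//] _; last by exists 0; rewrite leNye ltry.
  by exists (s - 1); rewrite leNye lte_fin gtrBl ltr01.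
by have [r r0 h] := lp x b bp; exists r => // x' /h; exact: le_lt_trans.
Qed.

Lemma lsc_measurable p : lsc p -> measurable_fun setT p.
Proof.
move=> lp; apply: (measurability _ (ErealGenOInfty.measurableE R)).
move=> _ [_ [c ->] <-]; rewrite setTI; apply: open_measurable_Rn.
have := lsc_open (c := c%:E) lp; congr open; apply/seteqP; split => x /=; by rewrite in_itv/= andbT.
Qed.

Lemma lee_real_lt (x y : \bar R) : (forall c : R, (c%:E < x)%E -> (c%:E <= y)%E) -> (x <= y)%E.
Proof.
case: x => [x||] h; last by rewrite leNye.
  apply/lee_addgt0Pr => e e0; rewrite -leeBlDr// -EFinB.
  by apply: h; rewrite lte_fin gtrBl.
by rewrite leye_eq; apply/eqP/eqyP => c _; apply: h; rewrite ltry.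
Qed.

(** Fatou's lemma along a sequence tending to [x] on which the integral stays at most [c]. *)
Lemma lsc_int dT (T : measurableType dT) (m : {measure set T -> \bar R}) (k : E -> T -> \bar R) :
  (forall x, measurable_fun setT (k x)) -> (forall x t, (0 <= k x t)%E) ->
  (forall t, lsc (k ^~ t)) -> lsc (fun x => \int[m]_t k x t)%E.
Proof.
move=> mk k0 lk x c cx; apply: contrapT => h.
have hj j : exists x', d x x' < j.+1%:R^-1 /\ (\int[m]_t k x' t <= c%:E)%E.
  apply: contrapT => hj; apply: h; exists j.+1%:R^-1; first by rewrite invr_gt0 ltr0n.
  by move=> x' dx; rewrite ltNge; apply/negP => kc; apply: hj; exists x'.
have [s hs] := choice hj.
move: cx; rewrite ltNge => /negP; apply.
apply: (@le_trans _ _ (\int[m]_t limn_einf (fun j => k (s j) t))%E).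
  apply: ge0_le_integral => //.
  - under eq_fun do rewrite limn_einf_lim.
    apply: (emeasurable_fun_cvg (fun j t => einfs (fun j => k (s j) t) j)).
      by move=> j; apply: (measurable_fun_einfs (f := fun j t => k (s j) t)).
    by move=> t _; exact: is_cvg_einfs.
  - move=> t _; apply: lee_real_lt => b bk; have [r r0 hr] := lk t x b bk.
    rewrite limn_einf_lim; apply: lime_ge; first exact: is_cvg_einfs.
    near=> j; apply: le_ereal_inf_tmp => _ [i ji <-]; apply/ltW/hr.
    apply: (lt_le_trans (hs i).1); rewrite -[leRHS]invrK lef_pV2 ?posrE ?invr_gt0 ?ltr0n//.
    apply: (@le_trans _ _ j%:R); last by rewrite ler_nat (leq_trans ji).
    by near: j; exact: nbhs_infty_ger.
apply: (le_trans (fatou m measurableT (fun j => mk (s j)) (fun j t _ => k0 (s j) t))).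
rewrite limn_einf_lim; apply: lime_le; first exact: is_cvg_einfs.
apply: nearW => j; apply: ge_ereal_inf; exists (\int[m]_t k (s j) t)%E; last exact: (hs j).2.
by exists j => /=.
Unshelve. all: end_near. Qed.

(** A pointwise limit of continuous functions lying below it is their supremum. *)
Lemma lsc_cvg (f : nat -> R -> R) (g : R -> \bar R) (z : E) : (forall l, continuous (f l)) ->
  (forall l r, 0 <= r -> ((f l r)%:E <= g r)%E) ->
  (forall r, 0 <= r -> (f l r)%:E @[l --> \oo] --> g r) -> lsc (fun x => g (d x z)).
Proof.
move=> cf fg cg x c cx; have d0 := dist_ge0 x z.
have [l hl] : exists l, c < f l (d x z).
  apply: contrapT => hl; move: cx; rewrite ltNge -(cvg_lim _ (cg _ d0))// => /negP; apply.
  apply: lime_le; first by apply/cvg_ex; eexists; exact: (cg _ d0).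
  by apply: nearW => l; rewrite lee_fin leNgt; apply/negP => h; apply: hl; exists l.
have /cvgrPdist_lt /(_ (f l (d x z) - c)) := cf l (d x z).
rewrite subr_gt0 hl => /(_ isT) /nbhs_ballP [r r0 hr]; exists r => // x' dx.
apply: (lt_le_trans _ (fg l _ (dist_ge0 x' z))); rewrite lte_fin.
have /hr : ball (d x z) r (d x' z).
  by rewrite /ball/= (le_lt_trans (dist_lip _ _ _)).
by move=> /(le_lt_trans (ler_norm _)); lra.
Qed.

Lemma lsc_add (p q : E -> \bar R) : (forall x, (0 <= p x)%E) -> (forall x, (0 <= q x)%E) ->
  lsc p -> lsc q -> lsc (fun x => p x + q x)%E.
Proof.
move=> p0 q0 lp lq x c cpq.
have [b [b' [bp bq bb]]] : exists b b' : R, [/\ (b%:E < p x)%E, (b'%:E < q x)%E & c <= b + b'].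
  move: cpq (p0 x) (q0 x); case: (p x) => [s||//]; case: (q x) => [t||//].
  - rewrite -EFinD lte_fin => h _ _; exists (s - (s + t - c) / 2), (t - (s + t - c) / 2).
    by rewrite !lte_fin; split; lra.
  - by move=> _ _ _; exists (s - 1), (c - (s - 1)); rewrite lte_fin ltry; split => //; lra.
  - by move=> _ _ _; exists (c - (t - 1)), (t - 1); rewrite lte_fin ltry; split => //; lra.
  - by move=> _ _ _; exists c, 0; rewrite !ltry addr0.
have [r r0 hr] := lp _ _ bp; have [r' r'0 hr'] := lq _ _ bq.
exists (Num.min r r'); first by rewrite lt_min r0.
move=> x'; rewrite lt_min => /andP[/hr h1 /hr' h2].
by apply: (@le_lt_trans _ _ (b + b')%:E); rewrite ?lee_fin// EFinD lteD.
Qed.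

Lemma lsc_scale (p : E -> \bar R) (s : R) : 0 < s -> lsc p -> lsc (fun x => s%:E * p x)%E.
Proof.
move=> s0 lp x c; rewrite -lte_pdivrMl// -EFinM => /lp[r r0 h]; exists r => // x' /h.
by rewrite EFinM lte_pdivrMl.
Qed.

End Semicontinuity.

Lemma dist_continuous (R : realType) (n : nat) (f : 'rV[R]_n -> R) :
  (forall x e, 0 < e -> exists2 r, 0 < r &
    forall x', eucl_dist (x : Rn R n) x' < r -> `|f x - f x'| <= e) -> continuous f.
Proof.
move=> h x; apply/(@cvgrPdist_le _ _ _ (nbhs x) _ f (f x)) => e /(h x)[r r0 hr].
by apply/nbhs_distP; exists r.
Qed.

Lemma compact_in_ball (R : realType) (n : nat) (F : set 'rV[R]_n) : compact F ->
  exists r : R, F `<=` [set x | eucl_dist (x : Rn R n) (0 : 'rV[R]_n) <= r].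
Proof.
move=> cF; have [C [Cr hC]] := compact_bounded cF.
exists (n%:R * (`|C| + 1)) => x Fx /=.
have hx : `|x| <= `|C| + 1 by apply: hC Fx; rewrite (le_lt_trans (ler_norm C))// ltrDl.
apply: dist_le_coord; first by rewrite addr_ge0.
move=> i; rewrite mxE subr0 (le_trans _ hx)// [leRHS]mx_normrE.
exact: (le_bigmax _ (fun ij => `|x ij.1 ij.2|) (0, i)).
Qed.

Lemma measure_small d (T : measurableType d) (R : realType) (s : {measure set T -> \bar R})
    (X : nat -> set T) (t : R) :
  (s setT < +oo)%E -> (forall k, measurable (X k)) -> nonincreasing_seq X ->
  s (\bigcap_k X k) = 0%E -> 0 < t -> exists k, (s (X k) <= t%:E)%E.
Proof.
move=> sf mX ndX X0 t0.
have : s \o X @ \oo --> s (\bigcap_k X k).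
  apply: nonincreasing_cvg_mu => //.
  - by rewrite (le_lt_trans _ sf)// le_measure ?inE.
  - exact: bigcapT_measurable.
rewrite X0 => h; apply: contrapT => hk.
have : (t%:E <= limn (s \o X))%E.
  apply: lime_ge; first by apply/cvg_ex; eexists; exact: h.
  by apply: nearW => k; rewrite leNgt; apply/negP => /ltW hk'; apply: hk; exists k.
by rewrite (cvg_lim _ h)// lee_fin leNgt t0.
Qed.

(** * Truncated potentials, remainders and continuity *)

Section Remainder.
Variables (R : realType) (n : nat) (alpha : R).
Hypotheses (hn : (3 <= n)%N) (halpha : 0 < alpha <= 2).
Local Notation E := (Rn R n).
Local Notation d := (@eucl_dist R n).
Local Notation K := (@riesz_kernel R n alpha).
Local Notation kr := (kr n alpha).
Local Notation kt := (kt n alpha).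
Local Notation pot := (riesz_potential alpha).
Local Notation M := {measure set E -> \bar R}.
Implicit Types (s : M).

Lemma lsc_ker z : lsc (fun x : E => K x z).
Proof.
have -> : (fun x : E => K x z) = (fun x => kr (d x z)) by apply/funext => x; rewrite kerE.
apply: (lsc_cvg (f := kt)).
- exact: kt_continuous.
- exact: kt_le_kr.
- exact: kt_cvg.
Qed.

Lemma lsc_pot s : lsc (pot s).
Proof.
apply: lsc_int.
- exact: measurable_kerl.
- exact: ker_ge0.
- exact: lsc_ker.
Qed.

(* [kt k] truncates the kernel at distance [1 / (k + 1)]; [krem k] is what is cut off. *)
Definition krem k r : \bar R := (kr r - (kt k r)%:E)%E.

Lemma krem_ge0 k r : 0 <= r -> (0 <= krem k r)%E.
Proof. by move=> r0; rewrite sube_ge0 ?fin_numE//; exact: kt_le_kr. Qed.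

Lemma krem_nd k l r : (k <= l)%N -> (krem l r <= krem k r)%E.
Proof. by move=> kl; rewrite leeB// lee_fin kt_nd. Qed.

Lemma measurable_krem k : measurable_fun setT (krem k).
Proof.
apply: emeasurable_funB; first exact: measurable_kr.
by apply/measurable_EFinP; exact: measurable_kt.
Qed.

(** Index [(2 * k).+1] halves the truncation radius, and scaling by 2 turns one remainder into the
    other up to the factor [2 ^ (n - alpha)]. This compares the remainder seen from any point with
    the one seen from a nearest point of a compact set. *)
Lemma krem_double k r r' : 0 <= r -> 0 <= r' -> r' <= 2 * r ->
  (krem (2 * k).+1 r <= (2 `^ (n%:R - alpha))%:E * krem k r')%E.
Proof.
move=> r0 r'0 rr; have b2 : 0 < 2 `^ (n%:R - alpha) :> R by rewrite powR_gt0.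
have k2 : (2 * k).+2%:R = 2 * k.+1%:R :> R by rewrite -natrM mulnS.
have [h|h] := leP (2 * k).+2%:R^-1 r.
  by rewrite {1}/krem -(kt_eq n alpha h)// subee// mule_ge0 ?krem_ge0// lee_fin powR_ge0.
have [r'z|r'p] := eqVneq r' 0.
  by rewrite /krem /kr r'z eqxx /= addye// gt0_muley ?lte_fin// leey.
have {}r'p : 0 < r' by rewrite lt0r r'p.
have rp : 0 < r by rewrite -(@pmulr_rgt0 _ 2)// (lt_le_trans r'p).
have k0 : 0 < k.+1%:R^-1 :> R by rewrite invr_gt0 ltr0n.
have E1 : k.+1%:R^-1 = 2 * (2 * k).+2%:R^-1 :> R.
  by rewrite k2 invfM mulrA divff ?mul1r.
have r'k : r' <= k.+1%:R^-1.
  by rewrite (le_trans rr)// E1 ler_pM2l// ltW.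
rewrite /krem /kr !gt_eqF// /kt (max_r r'k) (max_r (ltW h)) -!EFinB -EFinM lee_fin mulrBr.
have tw (x : R) : 0 < x -> 2 `^ (n%:R - alpha) * (2 * x) `^ (alpha - n%:R) = x `^ (alpha - n%:R).
  move=> x0; rewrite powRM// ?(ltW x0)// mulrA -powRD; last by rewrite pnatr_eq0 implybT.
  by rewrite (_ : n%:R - alpha + (alpha - n%:R) = 0) ?powRr0 ?mul1r//; ring.
rewrite E1 tw ?invr_gt0 ?ltr0n// lerD2r -(tw r rp) ler_pM2l//.
exact: powRN_le.
Qed.

Definition rem s k x : \bar R := (\int[s]_z krem k (d x z))%E.
Definition vk s k x : \bar R := (\int[s]_z (kt k (d x z))%:E)%E.

Lemma measurable_kremd k x : measurable_fun setT (fun z : E => krem k (d x z)).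
Proof. by apply: (measurableT_comp (measurable_krem k)); exact: measurable_dist. Qed.

Lemma measurable_ktd k x : measurable_fun setT (fun z : E => (kt k (d x z))%:E).
Proof.
by apply/measurable_EFinP; apply: (measurableT_comp (measurable_kt n alpha k)); exact: measurable_dist.
Qed.

Lemma rem_ge0 s k x : (0 <= rem s k x)%E.
Proof. by apply: integral_ge0 => z _; apply: krem_ge0; exact: dist_ge0. Qed.

Lemma vk_ge0 s k x : (0 <= vk s k x)%E.
Proof. by apply: integral_ge0 => z _; rewrite lee_fin kt_ge0. Qed.

Lemma pot_rem s k x : pot s x = (vk s k x + rem s k x)%E.
Proof.
rewrite -ge0_integralD//.
- apply: eq_integral => z _; rewrite kerE /krem addeC subeK//.
- by move=> z _; rewrite lee_fin kt_ge0.
- exact: measurable_ktd.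
- by move=> z _; apply: krem_ge0; exact: dist_ge0.
- exact: measurable_kremd.
Qed.

Lemma lsc_rem s k : lsc (rem s k).
Proof.
apply: lsc_int; [exact: measurable_kremd|by move=> x z; apply: krem_ge0; exact: dist_ge0|].
move=> z; apply: (lsc_cvg (f := fun l r => kt l r - kt k r)).
- move=> l r; apply: continuousB; exact: kt_continuous.
- by move=> l r r0; rewrite EFinB leeB// kt_le_kr.
- move=> r r0; under eq_fun do rewrite EFinB.
  by apply: cvgeB => //; [exact: fin_num_adde_defl|exact: kt_cvg|exact: cvg_cst].
Qed.

Lemma lsc_vk s k : lsc (vk s k).
Proof.
apply: lsc_int; [exact: measurable_ktd|by move=> x z; rewrite lee_fin kt_ge0|].
move=> z; apply: (lsc_cvg (f := fun=> kt k) (g := fun r => (kt k r)%:E)) => //.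
  by move=> _; exact: kt_continuous.
by move=> r _; exact: cvg_cst.
Qed.

Definition ktb k : R := k.+1%:R^-1 `^ (alpha - n%:R).

Lemma vk_fin s k x : (s setT < +oo)%E -> (vk s k x <= (ktb k)%:E * s setT)%E.
Proof.
move=> sf; rewrite -integral_cst//; apply: ge0_le_integral => //.
- by move=> z _; rewrite lee_fin kt_ge0.
- exact: measurable_ktd.
- by move=> z _; rewrite lee_fin; exact: kt_bound.
Qed.

Lemma vk_fin_num s k x : (s setT < +oo)%E -> vk s k x \is a fin_num.
Proof.
move=> sf; rewrite ge0_fin_numE ?vk_ge0// (le_lt_trans (vk_fin _ _ sf))//.
by rewrite lte_mul_pinfty ?lee_fin ?powR_ge0.
Qed.

(** The truncated kernel lies between 0 and [ktb k], so the integrals of [kt k] and of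
    [ktb k - kt k] are both lower semicontinuous; their sum is constant. *)
Lemma vk_cont s k x e : (s setT < +oo)%E -> 0 < e -> exists2 r : R, 0 < r & forall x', d x x' < r ->
  `|fine (vk s k x) - fine (vk s k x')| <= e.
Proof.
move=> sf e0.
have lw : lsc (fun x => \int[s]_z (ktb k - kt k (d x z))%:E)%E.
  apply: lsc_int.
  - move=> y; apply/measurable_EFinP; apply: measurable_funB => //.
    by apply/measurable_EFinP; exact: measurable_ktd.
  - by move=> y z; rewrite lee_fin subr_ge0; exact: kt_bound.
  - move=> z; apply: (lsc_cvg (f := fun=> fun r => ktb k - kt k r) (g := fun r => (ktb k - kt k r)%:E)) => //.
      by move=> _ r; apply: cvgB; [exact: cvg_cst|exact: kt_continuous].
    by move=> r _; exact: cvg_cst.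
have [m mE] : exists m, s setT = m%:E by exists (fine (s setT)); rewrite fineK// ge0_fin_numE.
have [v vE] : exists v : E -> R, forall y, vk s k y = (v y)%:E.
  by exists (fun y => fine (vk s k y)) => y; rewrite fineK// vk_fin_num.
have wE y : (\int[s]_z (ktb k - kt k (d y z))%:E)%E = (ktb k * m - v y)%:E.
  have h : ((\int[s]_z (ktb k - kt k (d y z))%:E) + vk s k y = (ktb k * m)%:E)%E.
    rewrite -ge0_integralD//.
    - under eq_integral do rewrite -EFinD subrK.
      by rewrite integral_cst// mE EFinM.
    - by move=> z _; rewrite lee_fin subr_ge0; exact: kt_bound.
    - apply/measurable_EFinP; apply: measurable_funB => //.
      by apply/measurable_EFinP; exact: measurable_ktd.
    - by move=> z _; rewrite lee_fin kt_ge0.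
    - exact: measurable_ktd.
  by rewrite EFinB -h vE addeK.
have [|r r0 hr] := @lsc_vk s k x (v x - e); first by rewrite vE lte_fin gtrBl.
have [|r' r'0 hr'] := lw x (ktb k * m - v x - e); first by rewrite wE lte_fin gtrBl.
exists (Num.min r r'); first by rewrite lt_min r0.
move=> x'; rewrite lt_min => /andP[/hr h1 /hr' h2].
move: h1 h2; rewrite vE (wE x') (vE x) /= !lte_fin => h1 h2.
by clear -h1 h2; rewrite ler_norml; apply/andP; split; lra.
Qed.

Lemma vk_cvg s x : vk s k x @[k --> \oo] --> pot s x.
Proof.
have -> : pot s x = (\int[s]_z limn (fun k => (kt k (d x z))%:E))%E.
  by apply: eq_integral => z _; rewrite kerE kt_limn// dist_ge0.
apply: cvg_monotone_convergence => //.
- by move=> k; exact: measurable_ktd.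
- by move=> k z _; rewrite lee_fin kt_ge0.
- by move=> z _ k l kl; rewrite lee_fin kt_nd.
Qed.

Lemma rem_nd s k l x : (k <= l)%N -> (rem s l x <= rem s k x)%E.
Proof.
move=> kl; apply: ge0_le_integral => //.
- by move=> z _; apply: krem_ge0; exact: dist_ge0.
- exact: measurable_kremd.
- exact: measurable_kremd.
- by move=> z _; exact: krem_nd.
Qed.

Lemma rem_small s x (e : R) : (s setT < +oo)%E -> (pot s x < +oo)%E -> 0 < e ->
  exists k, (rem s k x <= e%:E)%E.
Proof.
move=> sf pf e0; apply: contrapT => h.
have pfn : pot s x \is a fin_num by rewrite ge0_fin_numE ?pot_ge0.
have : (pot s x <= pot s x - e%:E)%E.
  rewrite -{1}(cvg_lim _ (@vk_cvg s x))//.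
  apply: lime_le; first by apply/cvg_ex; eexists; exact: vk_cvg.
  apply: nearW => k; rewrite leeBrDr// (pot_rem s k) leeD2l//.
  by rewrite leNgt; apply/negP => hk; apply: h; exists k; exact: ltW.
by rewrite leNgt -(fineK pfn) -EFinB lte_fin gtrBl e0.
Qed.

(* Uniform smallness of the remainders is what makes a potential continuous. *)
Definition unif s (D : set E) := forall e : R, 0 < e ->
  exists k, forall x, D x -> (rem s k x <= e%:E)%E.

Lemma pot_unif_fin s : (s setT < +oo)%E -> unif s setT -> forall x, (pot s x < +oo)%E.
Proof.
move=> sf us x; have [k /(_ x I) hk] := us 1 ltr01.
rewrite (pot_rem s k) lte_add_pinfty// ?(le_lt_trans hk) ?ltry//.
by rewrite -ge0_fin_numE ?vk_ge0// vk_fin_num.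
Qed.

Lemma pot_unif_cont s : (s setT < +oo)%E -> unif s setT ->
  continuous (fun x : 'rV[R]_n => fine (pot s x)).
Proof.
move=> sf us; apply: dist_continuous => x e e0.
have e3 : 0 < e / 3 by rewrite divr_gt0.
have [k hk] := us _ e3; have [r r0 hr] := vk_cont k x sf e3.
exists r => // x' /hr h.
have rfin y : rem s k y \is a fin_num.
  by rewrite ge0_fin_numE ?rem_ge0// (le_lt_trans (hk y I)) ?ltry.
have [v vE] : exists v : E -> R, forall y, vk s k y = (v y)%:E.
  by exists (fun y => fine (vk s k y)) => y; rewrite fineK// vk_fin_num.
have [w wE] : exists w : E -> R, forall y, rem s k y = (w y)%:E.
  by exists (fun y => fine (rem s k y)) => y; rewrite fineK.
have pE y : fine (pot s y) = v y + w y by rewrite (pot_rem s k) vE wE.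
have rb y : 0 <= w y <= e / 3 by rewrite -!lee_fin -(wE y) rem_ge0 hk.
have vE' y : fine (vk s k y) = v y by rewrite vE.
have -> : fine (pot s x) - fine (pot s x') = v x + w x - (v x' + w x').
  by congr (_ - _); exact: pE.
have hE : fine (vk s k x) - fine (vk s k x') = v x - v x' by congr (_ - _); exact: vE'.
move: h (rb x) (rb x'); rewrite hE; clear.
rewrite !ler_norml => /andP[h1 h2] /andP[a1 a2] /andP[b1 b2].
by apply/andP; split; lra.
Qed.

(** A point [x'] of [F] nearest to [x] satisfies [d x' z <= 2 * d x z] for all [z] in [F], so
    [krem_double] carries the smallness from [F] to the whole space. *)
Lemma unif_restr s (F : set E) s' : (s setT < +oo)%E -> compact (F : set 'rV[R]_n) ->
  measurable F -> restr alpha s F s' -> unif s F -> unif s' setT.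
Proof.
move=> sf cF mF rs us e e0.
have b2 : 0 < 2 `^ (n%:R - alpha) :> R by rewrite powR_gt0.
have [rint _ _ _] := rs.
have remE k x : rem s' k x = (\int[s]_(z in F) krem k (d x z))%E.
  apply: rint; first exact: measurable_kremd.
  by move=> z; apply: krem_ge0; exact: dist_ge0.
have [[x0 Fx0]|F0] := pselect (F !=set0); last first.
  exists 0%N => x _; rewrite remE; have -> : F = set0 by apply/seteqP; split => // z Fz; apply: F0; exists z.
  by rewrite integral_set0 lee_fin ltW.
have [k hk] := us (e / 2 `^ (n%:R - alpha)) (divr_gt0 e0 b2).
exists (2 * k).+1 => x _; rewrite remE.
have dc : continuous (fun z : 'rV[R]_n => d x z).
  apply: dist_continuous => z t t0; exists t => // z' /ltW zz'.
  by rewrite !(dist_sym x) (le_trans (dist_lip _ _ _)).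
have [x' ] := compact_EVT_min (ex_intro _ x0 Fx0) cF (continuous_subspaceT dc).
rewrite inE => Fx' hx'.
have hz z : F z -> d x' z <= 2 * d x z.
  move=> Fz; have := dist_triangle x' x z; rewrite (dist_sym x' x).
  have := hx' z; rewrite inE => /(_ Fz); lra.
apply: (@le_trans _ _ (\int[s]_(z in F) ((2 `^ (n%:R - alpha))%:E * krem k (d x' z)))%E).
  apply: ge0_le_integral => //.
  - by move=> z _; apply: krem_ge0; exact: dist_ge0.
  - by apply: measurable_funTS; exact: measurable_kremd.
  - by apply: measurable_funeM; apply: measurable_funTS; exact: measurable_kremd.
  - by move=> z Fz; apply: krem_double; rewrite ?dist_ge0// hz.
rewrite ge0_integralZl_EFin ?powR_ge0//; last 2 first.
- by move=> z _; apply: krem_ge0; exact: dist_ge0.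
- by apply: measurable_funTS; exact: measurable_kremd.
have -> : e%:E = ((2 `^ (n%:R - alpha))%:E * (e / 2 `^ (n%:R - alpha))%:E)%E.
  by rewrite -EFinM mulrC divfK// gt_eqF.
rewrite lee_wpmul2l ?lee_fin ?powR_ge0//; apply: le_trans (hk _ Fx').
apply: ge0_subset_integral => //; first exact: measurable_kremd.
by move=> z _; apply: krem_ge0; exact: dist_ge0.
Qed.

Lemma pot_vanishing s r0 : (s setT < +oo)%E -> unif s setT ->
  concentrated s [set x : E | d x (0%R : 'rV[R]_n) <= r0] ->
  vanishing (fun x : 'rV[R]_n => fine (pot s x)).
Proof.
move=> sf us cs; have cont := pot_unif_cont sf us; have pfin := pot_unif_fin sf us.
have b0 := exponent_gt0 hn halpha.
split => //; first by move=> x; rewrite fine_ge0 ?pot_ge0.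
move=> c c0; apply: bounded_closed_compact; last first.
  have -> : [set x : 'rV[R]_n | c <= fine (pot s x)] = (fun x : 'rV[R]_n => fine (pot s x)) @^-1` [set t | c <= t] by [].
  by apply: closed_comp; [move=> x _; exact: cont|exact: closed_ge].
pose m := fine (s setT); have m0 : 0 <= m by rewrite fine_ge0.
have mE : s setT = m%:E by rewrite fineK// ge0_fin_numE.
(* At distance at least [L] from the ball that carries [s] the kernel is at most [c / (m + 1)], so
   the potential is below [c]. *)
pose L := ((m + 1) / c) `^ (n%:R - alpha)^-1; have L0 : 0 < L by rewrite powR_gt0// divr_gt0// ltr_pwDr.
have bd x : c <= fine (pot s x) -> d x (0%R : 'rV[R]_n) <= r0 + L.
  move=> cx; rewrite leNgt; apply/negP => h.
  have : (pot s x <= (L `^ (alpha - n%:R) * m)%R%:E)%E.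
    have -> : pot s x = (\int[s]_(z in [set x : E | (d x (0%R : 'rV[R]_n) <= r0)%R]) K x z)%E.
      apply: (conc_int cs) => //; last (by move=> z; exact: ker_ge0); first exact: measurable_ball_le.
      exact: measurable_kerl.
    rewrite EFinM -mE.
    apply: (@le_trans _ _ (\int[s]_(z in [set x : E | (d x (0%R : 'rV[R]_n) <= r0)%R]) (L `^ (alpha - n%:R))%:E)%E).
      apply: ge0_le_integral => //.
      - exact: measurable_ball_le.
      - by move=> z _; exact: ker_ge0.
      - by apply: measurable_funTS; exact: measurable_kerl.
      - move=> z /= zr; rewrite kerE (le_trans (kr_ler hn halpha L0 _))//.
        by have := dist_triangle x z (0%R : 'rV[R]_n); lra.
    rewrite integral_cst ?lee_wpmul2l ?lee_fin ?powR_ge0//; last exact: measurable_ball_le.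
    by rewrite le_measure ?inE//; exact: measurable_ball_le.
  rewrite -(fineK (_ : pot s x \is a fin_num)) ?ge0_fin_numE ?pot_ge0// lee_fin.
  have -> : L `^ (alpha - n%:R) = c / (m + 1).
    rewrite /L -powRrM.
    have -> : (n%:R - alpha)^-1 * (alpha - n%:R) = -1 by field; rewrite gt_eqF.
    by rewrite powR_inv1 ?divr_ge0 ?(ltW c0) ?addr_ge0// invf_div.
  have m1 : 0 < m + 1 by rewrite ltr_pwDr.
  have : c / (m + 1) * m < c.
    by rewrite mulrAC ltr_pdivrMr// ltr_pM2l// ltrDl.
  by lra.
exists (r0 + L); split => [|M' hM x cx]; first exact: num_real.
rewrite /= (le_trans _ (ltW hM))//.
rewrite [leLHS]mx_normrE; apply: bigmax_le.
  by rewrite (le_trans (dist_ge0 _ _) (bd x cx)).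
move=> [i j] _ /=; rewrite (ord1 i) (le_trans _ (bd x cx))//.
by have := dist_coord x (0%R : 'rV[R]_n) j; rewrite mxE subr0.
Qed.

(** Egorov's theorem for the remainders, which decrease to 0 wherever the potential is finite. They
    are lower semicontinuous, so the sets removed are open and the rest is closed; a large ball
    makes it compact. *)
Lemma nice_ex s (dl : R) : (s setT < +oo)%E -> {ae s, forall x, (pot s x < +oo)%E} -> 0 < dl ->
  exists F : set E, [/\ compact (F : set 'rV[R]_n), measurable F, unif s F & (s (~` F) <= dl%:E)%E].
Proof.
move=> sf pae dl0.
pose B j k := [set x : E | ((j.+1%:R^-1)%:E < rem s k x)%E].
have mB j k : measurable (B j k).
  by apply: open_measurable_Rn; apply: lsc_open; exact: lsc_rem.
pose C m := [set x : E | m%:R < d x (0%R : 'rV[R]_n)].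
have mC m : measurable (C m).
  have -> : C m = ~` [set x : E | d x (0%R : 'rV[R]_n) <= m%:R].
    by apply/seteqP; split => x /=; rewrite /C/= ltNge => /negP.
  by apply: measurableC; exact: measurable_ball_le.
have hB j : exists k, (s (B j k) <= (dl / 2 / (2 ^ j.+1)%:R)%:E)%E.
  apply: (measure_small sf (X := B j)).
  - exact: mB.
  - move=> k l kl; apply/subsetPset => x; rewrite /B /mkset => h; exact: (lt_le_trans h (rem_nd s x kl)).
  - apply/eqP; rewrite eq_le measure_ge0 andbT.
    case: pae => N [mN N0 sN]; rewrite -N0 le_measure ?inE//; first exact: bigcapT_measurable.
    move=> x hx; apply: sN => /= pf.
    have [k hk] := rem_small sf pf (natinv_gt0 R j).
    by have := hx k I; rewrite /B /mkset ltNge hk.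
  - by rewrite !divr_gt0// ltr0n expn_gt0.
have [m hm] : exists m, (s (C m) <= (dl / 2)%:E)%E.
  apply: (measure_small sf (X := C)); first exact: mC.
  - by move=> k l kl; apply/subsetPset => x; rewrite /C /mkset; apply: le_lt_trans; rewrite ler_nat.
  - rewrite (_ : \bigcap_k C k = set0) ?measure0//; apply/seteqP; split => // x hx.
    have := hx (Num.truncn (d x (0%R : 'rV[R]_n))).+1 I; rewrite /C/= ltNge => /negP; apply.
    by rewrite ltW// truncnS_gt.
  - by rewrite divr_gt0.
have [kk hkk] := choice hB.
pose F := ~` (\bigcup_j B j (kk j) `|` C m).
have mU : measurable (\bigcup_j B j (kk j) `|` C m).
  by apply: measurableU => //; apply: bigcupT_measurable => j.
exists F; split.
- apply: bounded_closed_compact.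
    exists m%:R; split => [|M' hM x Fx]; first exact: num_real.
    have xm : d x (0%R : 'rV[R]_n) <= m%:R.
      by rewrite leNgt; apply/negP => h; apply: Fx; right.
    rewrite /= (le_trans _ (ltW hM))// [leLHS]mx_normrE; apply: bigmax_le => // -[i j] _ /=.
    rewrite (ord1 i) (le_trans _ xm)//.
    by have := dist_coord x (0%R : 'rV[R]_n) j; rewrite mxE subr0.
  rewrite /F closedC; apply: openU.
    by apply: bigcup_open => j _; apply: lsc_open; exact: lsc_rem.
  apply/open_distP => x /= hx; exists (d x (0%R : 'rV[R]_n) - m%:R); first by rewrite subr_gt0.
  by move=> x' xx'; have := dist_triangle x x' (0%R : 'rV[R]_n); rewrite /C/=; lra.
- exact: measurableC.
- move=> e e0; pose j := Num.truncn e^-1.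
  exists (kk j) => x Fx; apply: (@le_trans _ _ (j.+1%:R^-1)%:E).
    by rewrite leNgt; apply/negP => h; apply: Fx; left; exists j.
  by rewrite lee_fin -[leRHS]invrK lef_pV2 ?posrE ?ltr0n ?invr_gt0// ltW// truncnS_gt.
- rewrite setCK (le_trans (measureU2 _ _ _))//; first exact: bigcupT_measurable.
  have -> : dl%:E = ((dl / 2)%:E + (dl / 2)%:E)%E by rewrite -EFinD -splitr.
  rewrite leeD//.
  apply: (@le_trans _ _ (\sum_(j <oo) s (B j (kk j)))%E).
    by apply: measure_sigma_subadditive => //; exact: bigcupT_measurable.
  apply: (@le_trans _ _ (\sum_(j <oo) (dl / 2 / (2 ^ j.+1)%:R)%:E)%E).
    by apply: lee_nneseries => // j _ _; rewrite hkk.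
  by apply: epsilon_trick0; rewrite divr_ge0// ltW.
Qed.

End Remainder.

(** * Superharmonic functions and domination for continuous potentials *)

Section Superharmonic.
Variables (R : realType) (n : nat) (alpha : R).
Hypotheses (hn : (3 <= n)%N) (halpha : 0 < alpha <= 2).
Local Notation E := (Rn R n).
Local Notation d := (@eucl_dist R n).
Local Notation K := (@riesz_kernel R n alpha).
Local Notation Kv := (@Kv R n alpha).
Local Notation Kw := (@Kw R n alpha).
Local Notation pot := (riesz_potential alpha).
Local Notation M := {measure set E -> \bar R}.
Local Notation step := (@step R n alpha).
Implicit Types (s : M).

Let mKv e : 0 < e -> measurable_fun setT (Kv e).
Proof. by move=> e0; apply: measurable_Kv. Qed.

Let mKw e : 0 < e -> measurable_fun setT (Kw e).
Proof. by move=> e0; apply: measurable_Kw. Qed.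

(* The mean value inequality is required for the laws [step e] only. *)
Definition super (p : E -> \bar R) :=
  [/\ forall x, (0 <= p x)%E, lsc p &
   forall e tau, 0 < e -> step e tau -> forall x : E,
     (\int[tau]_y p ((x : 'rV[R]_n) + (y : 'rV[R]_n))%R <= p x)%E].

Lemma step_sfinite e tau : step e tau -> sigma_finite setT tau.
Proof.
by case=> h _ _; apply: fin_sigma_finite; rewrite (le_lt_trans h)// ltry.
Qed.

Lemma super_cst (c : R) : 0 <= c -> super (fun=> c%:E).
Proof.
move=> c0; split => //.
- by move=> x b bc; exists 1.
- move=> e tau e0 [t1 _ _] x; rewrite integral_cst//.
  by rewrite -[leRHS]mule1 lee_wpmul2l// lee_fin.
Qed.

Lemma super_add p q : super p -> super q -> super (fun x => p x + q x)%E.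
Proof.
move=> [p0 lp hp] [q0 lq hq]; split.
- by move=> x; exact: adde_ge0.
- exact: lsc_add.
- move=> e tau e0 te x; rewrite ge0_integralD//; last 2 first.
  + by apply: (measurableT_comp (lsc_measurable lp)); exact: measurable_addv.
  + by apply: (measurableT_comp (lsc_measurable lq)); exact: measurable_addv.
  by rewrite leeD ?(hp e) ?(hq e).
Qed.

(** Under the integral one step replaces the kernel by [Kv e], which is at most the kernel. Allowing
    a density and a map covers potentials and their Kelvin transforms alike. *)
Lemma super_int dT (T : measurableType dT) (m : {measure set T -> \bar R})
    (rho : T -> \bar R) (phi : T -> E) :
  sigma_finite setT m -> measurable_fun setT rho -> (forall t, (0 <= rho t)%E) ->
  measurable_fun setT phi -> super (fun x => \int[m]_t (rho t * K x (phi t)))%E.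
Proof.
move=> sm mr r0 mphi.
have mk x : measurable_fun setT (fun t => rho t * K x (phi t))%E.
  by apply: emeasurable_funM => //; exact: measurable_ker.
have k0 x t : (0 <= rho t * K x (phi t))%E by exact: mule_ge0 (r0 _) (ker_ge0 _ _ _).
split.
- by move=> x; exact: integral_ge0.
- apply: lsc_int => // t /=.
  (* For the density values 0 and [+oo] the integrand is constant, the kernel being positive
     everywhere. *)
  have := r0 t; case: (rho t) => [r||//].
  + rewrite lee_fin le_eqVlt => /predU1P[<-|r1].
      by move=> x c; rewrite mul0e => c0; exists 1 => // x' _; rewrite mul0e.
    by apply: lsc_scale => //; exact: lsc_ker.
  + move=> _; have Kp y : (0 < K y (phi t))%E.
      rewrite /riesz_kernel; case: ifPn => [_|yn]; first by rewrite ltry.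
      by rewrite lte_fin powR_gt0 ?dist_gt0.
    by move=> x c _; exists 1 => // x' _; rewrite gt0_mulye// ltry.
- move=> e tau e0 te x; have st := step_sfinite te.
  have [_ _ tK] := te.
  rewrite (@tonelli_swap R _ _ _ _ tau m
    (fun q : E * T => rho q.2 * K ((x : 'rV[R]_n) + (q.1 : 'rV[R]_n))%R (phi q.2))%E)//; last first.
    apply: emeasurable_funM; first exact: (measurableT_comp mr measurable_snd).
    apply: measurable_ker; last exact: (measurableT_comp mphi measurable_snd).
    exact: (measurableT_comp (measurable_addv x) measurable_fst).
  have mKx t : measurable_fun setT (fun y : E => K ((x : 'rV[R]_n) + (y : 'rV[R]_n))%R (phi t)).
    by apply: measurable_ker => //; exact: measurable_addv.
  apply: ge0_le_integral => //.
  + by move=> t _; apply: integral_ge0 => y _; exact: mule_ge0 (r0 _) (ker_ge0 _ _ _).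
  + apply: (@tonelli_measurable R _ _ _ _ tau
      (fun q : T * E => rho q.1 * K ((x : 'rV[R]_n) + (q.2 : 'rV[R]_n))%R (phi q.1))%E) => //.
      apply: emeasurable_funM; first exact: (measurableT_comp mr measurable_fst).
      apply: measurable_ker; last exact: (measurableT_comp mphi measurable_fst).
      exact: (measurableT_comp (measurable_addv x) measurable_snd).
  + move=> t _ /=.
    rewrite (@ge0_integralZl _ _ R tau setT measurableT
       (fun y : E => K ((x : 'rV[R]_n) + (y : 'rV[R]_n))%R (phi t)))//; last first.
      by move=> y _; exact: ker_ge0.
    rewrite tK lee_wpmul2l// kerE (kr_split hn halpha e0) ?dist_ge0// leeDl//.
    exact: Kw_ge0.
Qed.

Lemma super_pot s : sigma_finite setT s -> super (pot s).
Proof.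
move=> ss; have := @super_int _ E s (cst 1%E) id ss.
have -> : (fun x => \int[s]_t (cst 1 t * K x (id t)))%E = pot s.
  by apply/funext => x; apply: eq_integral => z _; rewrite mul1e.
by apply => //; exact: measurable_cst.
Qed.

(** The exact loss of a potential in one step. Domination needs the loss bounded above for one
    measure and below for another, so the inequality in [super] would not be enough. *)
Lemma pot_step s e tau x : sigma_finite setT s -> 0 < e -> step e tau ->
  pot s x = (\int[tau]_y pot s ((x : 'rV[R]_n) + (y : 'rV[R]_n))%R + \int[s]_z Kw e (d x z))%E.
Proof.
move=> ss e0 te; have st := step_sfinite te; have [_ _ tK] := te.
rewrite (@tonelli_swap R _ _ _ _ tau s
    (fun q : E * E => K ((x : 'rV[R]_n) + (q.1 : 'rV[R]_n))%R q.2))//; last 2 first.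
- apply: measurable_ker; last exact: measurable_snd.
  exact: (measurableT_comp (measurable_addv x) measurable_fst).
- by move=> q; exact: ker_ge0.
have -> : (\int[s]_y \int[tau]_x0 K ((x : 'rV[R]_n) + (x0 : 'rV[R]_n))%R y = \int[s]_z Kv e (d x z))%E.
  by apply: eq_integral => z _; exact: tK.
rewrite -ge0_integralD//.
- by apply: eq_integral => z _; rewrite kerE (kr_split hn halpha e0)// dist_ge0.
- by move=> z _; exact: Kv_ge0.
- by apply: (measurableT_comp (mKv e0)); exact: measurable_dist.
- by move=> z _; exact: Kw_ge0.
- by apply: (measurableT_comp (mKw e0)); exact: measurable_dist.
Qed.

Lemma ereal_between (u : R) (q : \bar R) : (u%:E < q)%E -> exists2 c, u < c & (c%:E < q)%E.
Proof.
case: q => [q||//]; last by exists (u + 1); rewrite ?ltrDl ?ltry.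
by rewrite lte_fin => uq; exists ((u + q) / 2); rewrite ?lte_fin ?midf_lt.
Qed.

(** [Q] may be infinite, so the maximum of [phi - Q] is taken as the least [m] with [phi <= Q + m].
    Were it attained nowhere, semicontinuity and compactness would leave a uniform gap [dl] where
    [phi >= m / 2], while elsewhere [phi] is below [m / 2 <= m - dl]; so [m] could be lowered. *)
Lemma max_attained (phi : 'rV[R]_n -> R) (Q : E -> \bar R) x1 : vanishing phi -> lsc Q ->
  (forall x, (0 <= Q x)%E) -> (Q x1 < (phi x1)%:E)%E ->
  exists m x0, [/\ 0 < m, (forall x, ((phi x)%:E <= Q x + m%:E)%E) & (Q x0 + m%:E <= (phi x0)%:E)%E].
Proof.
move=> vphi lQ Q0 hx1; have [p0 pc pK] := vphi; have [B hB] := vanishing_bounded vphi.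
pose S := [set m : R | 0 <= m /\ forall x, ((phi x)%:E <= Q x + m%:E)%E].
have SB : S (Num.norm B).
  by split => // x; rewrite -[leLHS]add0e leeD// lee_fin (le_trans (hB x))// ler_norm.
have infS : has_inf S.
  by split; [exists (Num.norm B) => //|exists 0 => t -[]].
pose m := inf S.
have mS : S m.
  split; first by apply: lb_le_inf; [exists `|B| | move=> t []].
  move=> x; apply/lee_addgt0Pr => e e0.
  have [t [t0 tS] te] := inf_adherent e0 infS.
  by rewrite (le_trans (tS x))// -addeA leeD2l// -EFinD lee_fin ltW.
have m0 : 0 < m.
  rewrite lt0r mS.1 andbT; apply/eqP => mz.
  by have := mS.2 x1; rewrite mz adde0 leNgt hx1.
exists m; apply: contrapT => hno.
have hlt x : ((phi x)%:E < Q x + m%:E)%E.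
  by rewrite ltNge; apply/negP => h; apply: hno; exists x; split => //; exact: mS.2.
have lQm : lsc (fun x => Q x + m%:E)%E.
  by apply: lsc_add => //; [move=> _; rewrite lee_fin ltW|move=> x b bm; exists 1].
have cov := (@compact_near_coveringP _ _).1 (pK (m / 2) (divr_gt0 m0 (ltr0n _ 2))).
have := cov R 0^'+ (fun dl x => ((phi x + dl)%:E <= Q x + m%:E)%E) _.
case=> [x xC|dl0 /= dl00 hdl].
- have [c uc cQ] := ereal_between (hlt x); have [r r0 hr] := lQm _ _ cQ.
  have c0 : 0 < (c - phi x) / 2 by rewrite divr_gt0// subr_gt0.
  have /(@cvgrPdist_lt _ _ _ (nbhs x) _ phi (phi x)) /(_ _ c0) /nbhs_distP [r' r'0 hr'] := pc x.
  exists ([set x' | d x x' < r /\ d x x' < r'], [set dl | dl <= (c - phi x) / 2]) => /=.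
    split; last exact: nbhs_right_le.
    apply/nbhs_distP; exists (Num.min r r'); first by rewrite lt_min r0.
    by move=> y; rewrite lt_min => /andP[].
  move=> [x' dl] /= [[/hr h1 /hr' h2] h3].
  apply: le_trans (ltW h1); rewrite lee_fin.
  by move: h2; rewrite ltr_norml => /andP[h2 h4]; lra.
have [dl [dlp dlC dlm]] : exists dl, [/\ 0 < dl, dl <= m / 2 &
    forall x, m / 2 <= phi x -> ((phi x + dl)%:E <= Q x + m%:E)%E].
  exists (Num.min (dl0 / 2) (m / 2)).
  have hp : 0 < Num.min (dl0 / 2) (m / 2) by rewrite lt_min !divr_gt0.
  split => //; first by rewrite ge_min lexx orbT.
  apply: hdl => //=; rewrite sub0r normrN gtr0_norm//.
  by rewrite gt_min; apply/orP; left; rewrite ltr_pdivrMr// ltr_pMr// ltr1n.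
have : S (m - dl).
  split; first by lra.
  move=> x; have [h|h] := leP (m / 2) (phi x).
    by rewrite EFinB addeA leeBrDr// -EFinD dlm.
  by rewrite -[leLHS]add0e leeD// lee_fin; lra.
by move=> /(ge_inf infS.2); rewrite -/m; lra.
Qed.

Lemma domination_core s (F : set E) q : (s setT < +oo)%E -> unif alpha s setT ->
  compact (F : set 'rV[R]_n) -> concentrated s F -> super q ->
  (forall x, F x -> (pot s x <= q x)%E) -> forall x, (pot s x <= q x)%E.
Proof.
move=> sf us cF sF [q0 lq hq] hF x1.
have mF : measurable F by exact: compact_measurable.
have ss := fin_sigma_finite sf.
have [G [G1 Gfin Glb]] := gauss_test hn halpha.
have sG : sigma_finite setT G by apply: fin_sigma_finite; rewrite G1 ltry.
have [g gE] : exists g : E -> R, forall x, pot G x = (g x)%:E.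
  by exists (fun x => fine (pot G x)) => x; rewrite fineK// ge0_fin_numE ?pot_ge0.
have g0 x : 0 <= g x by rewrite -lee_fin -gE pot_ge0.
have [r0 hr0] := compact_in_ball cF.
have vphi := pot_vanishing hn halpha sf us (concentrated_sub hr0 sF).
pose phi (x : 'rV[R]_n) := fine (pot s x).
have pE (x : E) : pot s x = (phi x)%:E.
  by rewrite /phi fineK// ge0_fin_numE ?pot_ge0//; exact: pot_unif_fin.
have {vphi} : vanishing phi by [].
move: phi pE => phi pE vphi.
(* The test potential is finite at [x1], so its contribution disappears as [t] tends to 0. *)
suff hs (t : R) : 0 < t -> ((phi x1)%:E <= q x1 + t%:E * pot G x1)%E.
  rewrite pE; apply/lee_addgt0Pr => e e0.
  have g1 : 0 < g x1 + 1 by rewrite ltr_wpDl.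
  rewrite (le_trans (hs (e / (g x1 + 1)) (divr_gt0 e0 g1)))// leeD2l// gE -EFinM lee_fin.
  by rewrite mulrAC ler_pdivrMr// ler_wpM2l ?(ltW e0)// lerDl.
move=> t0; rewrite leNgt; apply/negP => hx1.
have lG : lsc (fun x => t%:E * pot G x)%E by apply: lsc_scale => //; exact: lsc_pot.
have tG0 x : (0 <= t%:E * pot G x)%E by rewrite mule_ge0 ?pot_ge0// lee_fin ltW.
have [|m [x0 [m0 hM hx0]]] := max_attained vphi (lsc_add q0 tG0 lq lG) _ hx1.
  by move=> x; rewrite adde_ge0.
have qfin : q x0 \is a fin_num.
  rewrite ge0_fin_numE// (le_lt_trans _ (ltry (phi x0)))// (le_trans _ hx0)// -addeA leeDl//.
  by rewrite adde_ge0// lee_fin ltW.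
have [qx qxE] : exists qx, q x0 = qx%:E by exists (fine (q x0)); rewrite fineK.
have nF : ~ F x0.
  move=> /hF; rewrite pE => h; have := le_trans hx0 h.
  rewrite qxE gE -EFinM -!EFinD lee_fin => h'.
  by have := mulr_ge0 (ltW t0) (g0 x0); lra.
have [dl dl0 hdl] : exists2 dl, 0 < dl & forall z, F z -> dl <= d x0 z.
  have oF : open (~` (F : set 'rV[R]_n)).
    by apply: closed_openC; apply: compact_closed => //; exact: norm_hausdorff.
  have [r rp hr] := (open_distP _).1 oF x0 nF; exists r => // z Fz.
  by rewrite leNgt; apply/negP => /hr.
have [C [C0 hC]] := Kw_far hn halpha dl0.
have [c c0 hc] := Glb x0.
have [sm smE] : exists sm, s setT = sm%:E by exists (fine (s setT)); rewrite fineK// ge0_fin_numE.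
have sm0 : 0 <= sm by rewrite -lee_fin -smE.
(* One step is averaged at the maximum [x0]. There [pot s] equals [q + t * pot G + m], and around it
   is at most that; hence [pot s] must lose at least [t] times what [pot G] loses, while [Kw_far]
   bounds its loss by [C * e * sm]. *)
have key e : 0 < e < 1 -> t * (c * (e * - ln e)) <= C * e * sm.
  move=> e01; have /andP[e0 e1] := e01.
  have [tau te] := step_ex hn halpha e0; have [t1 _ _] := te.
  have hG := pot_step x0 sG e0 te; have hS := pot_step x0 ss e0 te.
  have madd (f : E -> \bar R) : measurable_fun setT f ->
      measurable_fun setT (fun y : E => f ((x0 : 'rV[R]_n) + (y : 'rV[R]_n))%R).
    by move=> mf; apply: (measurableT_comp mf); exact: measurable_addv.
  have up : (\int[s]_z Kw e (d x0 z) <= (C * e * sm)%:E)%E.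
    have mKx : measurable_fun setT (fun z : E => Kw e (d x0 z)).
      by apply: (measurableT_comp (mKw e0)); exact: measurable_dist.
    rewrite (conc_int sF (fun _ => id) mF mKx); last by move=> z; exact: Kw_ge0.
    apply: (@le_trans _ _ (\int[s]_(z in F) (C * e)%:E)%E).
      apply: ge0_le_integral => //.
      - by move=> z _; exact: Kw_ge0.
      - exact: measurable_funTS.
      - by move=> z /hdl; exact: hC.
    have -> : (C * e * sm)%:E = ((C * e)%:E * s setT)%E by rewrite smE.
    rewrite integral_cst// lee_wpmul2l ?lee_fin ?mulr_ge0 ?(ltW e0)//.
    by rewrite le_measure ?inE.
  have up2 : (\int[tau]_y pot s ((x0 : 'rV[R]_n) + (y : 'rV[R]_n))%R <=
      q x0 + t%:E * \int[tau]_y pot G ((x0 : 'rV[R]_n) + (y : 'rV[R]_n))%R + m%:E)%E.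
    apply: (@le_trans _ _ (\int[tau]_y (q ((x0 : 'rV[R]_n) + (y : 'rV[R]_n))%R +
        t%:E * pot G ((x0 : 'rV[R]_n) + (y : 'rV[R]_n))%R + m%:E))%E).
      apply: ge0_le_integral => //.
      - by move=> y _; exact: pot_ge0.
      - by apply: madd; apply: measurable_pot.
      - apply: emeasurable_funD => //; apply: emeasurable_funD.
          by apply: madd; exact: lsc_measurable.
        by apply: measurable_funeM; apply: madd; apply: measurable_pot.
      - by move=> y _; rewrite pE hM.
    rewrite ge0_integralD//; last 3 first.
    - by move=> y _; rewrite adde_ge0.
    - apply: emeasurable_funD; first by apply: madd; exact: lsc_measurable.
      by apply: measurable_funeM; apply: madd; apply: measurable_pot.
    - by move=> y _; rewrite lee_fin ltW.
    rewrite ge0_integralD//; last 2 first.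
    - by apply: madd; exact: lsc_measurable.
    - by apply: measurable_funeM; apply: madd; apply: measurable_pot.
    rewrite leeD//.
      rewrite leeD//; first exact: (hq e).
      rewrite ge0_integralZl_EFin//; last 3 first.
      - by move=> y _; exact: pot_ge0.
      - by apply: madd; apply: measurable_pot.
      - exact: ltW.
    rewrite integral_cst// -[leRHS]mule1 lee_wpmul2l// lee_fin ltW//.
  have lo := hc e e01.
  move: hG hS up up2 lo; rewrite gE pE qxE.
  set IG := (\int[tau]_y pot G _)%E; set KG := (\int[G]_z Kw e _)%E.
  set IS := (\int[tau]_y pot s _)%E; set KS := (\int[s]_z Kw e _)%E.
  have IG0 : (0 <= IG)%E by apply: integral_ge0 => y _; exact: pot_ge0.
  have KG0 : (0 <= KG)%E by apply: integral_ge0 => y _; exact: Kw_ge0.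
  have IS0 : (0 <= IS)%E by apply: integral_ge0 => y _; exact: pot_ge0.
  have KS0 : (0 <= KS)%E by apply: integral_ge0 => y _; exact: Kw_ge0.
  move: hx0; rewrite qxE gE -EFinM -!EFinD lee_fin.
  clearbody IG KG IS KS; move: (phi x0) (g x0) => u v.
  clear -t0 IG0 KG0 IS0 KS0.
  case: IG IG0 => [a||] // _; case: KG KG0 => [b||] // _ h1 [hv].
  case: IS IS0 => [a'||] // _; case: KS KS0 => [b'||] // _ [hu].
  rewrite -EFinM -!EFinD !lee_fin => h2 h3 h4.
  have h5 : t * (c * (e * - ln e)) <= t * b by rewrite ler_wpM2l// ltW.
  rewrite (le_trans h5)//; move: h1; rewrite hv hu mulrDr; lra.
(* This [e] makes [- ln e] exceed [C * sm / (t * c)] by 1, which contradicts [key]. *)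
pose e := expR (- (C * sm / (t * c) + 1)).
have tc : 0 < t * c by rewrite mulr_gt0.
have L0 : 0 < C * sm / (t * c) + 1 by rewrite ltr_wpDl// divr_ge0 ?mulr_ge0// ltW.
have e0 : 0 < e by exact: expR_gt0.
have := key e; rewrite e0 -[X in e < X]expR0 ltr_expR oppr_lt0 L0 => /(_ isT).
rewrite /e expRK opprK -/e.
have -> : t * (c * (e * (C * sm / (t * c) + 1))) = e * (C * sm + t * c).
  by field; rewrite !gt_eqF.
have -> : C * e * sm = e * (C * sm) by ring.
by rewrite ler_pM2l//; lra.
Qed.

End Superharmonic.

(** * The domination principle for finite measures *)

Section Domination.
Variables (R : realType) (n : nat) (alpha : R).
Hypotheses (hn : (3 <= n)%N) (halpha : 0 < alpha <= 2).
Local Notation E := (Rn R n).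
Local Notation d := (@eucl_dist R n).
Local Notation K := (@riesz_kernel R n alpha).
Local Notation kt := (kt n alpha).
Local Notation pot := (riesz_potential alpha).
Local Notation M := {measure set E -> \bar R}.
Local Notation super := (super alpha).
Implicit Types (s : M).

(* The compact set is cut out of a nice one by the closed set of the points at distance at
   least [1 / (m + 1)] from the complement of the open set [vk s k < p + e / 2]; this
   replaces inner regularity. *)
Lemma compact_below s p (e dl : R) : (s setT < +oo)%E -> lsc p ->
  {ae s, forall x, (pot s x <= p x)%E} -> {ae s, forall x, (pot s x < +oo)%E} ->
  0 < e -> 0 < dl ->
  exists F : set E, [/\ compact (F : set 'rV[R]_n), measurable F, unif alpha s F,
    (s (~` F) <= dl%:E)%E & forall x, F x -> (pot s x <= p x + e%:E)%E].
Proof.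
move=> sf lp ple pfin e0 dl0.
have e2 : 0 < e / 2 by rewrite divr_gt0.
have dl2 : 0 < dl / 2 by rewrite divr_gt0.
have [F [cF mF uF sF]] := nice_ex hn halpha sf pfin dl2.
have [k hk] := uF _ e2.
pose O := [set x : E | (vk alpha s k x < p x + (e / 2)%:E)%E].
have [v vE] : exists v : E -> R, forall y, vk alpha s k y = (v y)%:E.
  by exists (fun y => fine (vk alpha s k y)) => y; rewrite fineK// (vk_fin_num hn halpha).
have oO x : O x -> exists2 r, 0 < r & forall x', d x x' < r -> O x'.
  rewrite /O /= vE => h.
  have hp : ((v x - e / 2)%:E < p x)%E by rewrite EFinB lteBlDr.
  have [c cv cp] := ereal_between hp; have [r r0 hr] := lp _ _ cp.
  have c0 : 0 < c - (v x - e / 2) by rewrite subr_gt0.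
  have [r' r'0 hr'] := vk_cont hn halpha k x sf (divr_gt0 c0 (ltr0n _ 2)).
  exists (Num.min r r'); first by rewrite lt_min r0.
  move=> x'; rewrite lt_min => /andP[/hr h1 /hr' h2]; rewrite /O/= vE.
  have hE : fine (vk alpha s k x) - fine (vk alpha s k x') = v x - v x'.
    by congr (_ - _); rewrite vE.
  rewrite hE in h2; rewrite -lteBlDr// -EFinB (le_lt_trans _ h1)// lee_fin.
  by move: h2 c0; clear; rewrite ler_norml => /andP[h1 h2] h3; lra.
pose Cl m := [set x : E | forall z, d x z < m.+1%:R^-1 -> O z].
have clC m : open (~` Cl m : set 'rV[R]_n).
  apply/open_distP => x /= /asboolPn/existsp_asboolPn[z /asboolPn/imply_asboolPn[xz nO]].
  exists (m.+1%:R^-1 - d x z); first by rewrite subr_gt0.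
  move=> x' xx' h; apply: nO; apply: h.
  by rewrite (le_lt_trans (dist_triangle x' x z))// (dist_sym x' x) -ltrBrDr.
have mCl m : measurable (Cl m).
  by rewrite -[Cl m]setCK; apply: measurableC; exact: open_measurable_Rn.
have [m hm] : exists m, (s (~` Cl m) <= (dl / 2)%:E)%E.
  apply: (measure_small sf (X := fun m => ~` Cl m)) => //.
  - by move=> m; exact: measurableC.
  - move=> i j ij; apply/subsetPset => x /= h1 h2; apply: h1 => z xz; apply: h2.
    by rewrite (lt_le_trans xz)// lef_pV2 ?posrE ?ltr0n// ler_nat.
  - apply/eqP; rewrite eq_le measure_ge0 andbT.
    case: ple => N [mN N0 sN]; rewrite -N0 le_measure ?inE//.
      by apply: bigcapT_measurable => m; exact: measurableC.
    move=> x hx; apply: sN => /= px.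
    have /oO[r r0 hr] : O x.
      rewrite /O/=; case: (ltP (p x) +oo%E) => [pf|].
        apply: (@le_lt_trans _ _ (p x)).
          by rewrite (le_trans _ px)// (pot_rem hn halpha s k) leeDl// rem_ge0.
        rewrite lteDl ?lte_fin// ge0_fin_numE// (le_trans _ px)//; exact: pot_ge0.
      by rewrite leye_eq => /eqP ->; rewrite vE addye// ltry.
    apply: (hx (Num.truncn r^-1) I) => z xz; apply: hr; apply: (lt_le_trans xz).
    by rewrite -[leRHS]invrK lef_pV2 ?posrE ?ltr0n ?invr_gt0// ltW// truncnS_gt.
exists (F `&` Cl m); split.
- have cl : closed (F `&` Cl m : set 'rV[R]_n).
    apply: closedI; first by apply: compact_closed => //; exact: norm_hausdorff.
    by rewrite -[X in closed X]setCK; exact: open_closedC.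
  by apply: (subclosed_compact cl cF) => x [].
- exact: measurableI.
- by move=> t t0; have [j hj] := uF t t0; exists j => x [Fx _]; exact: hj.
- rewrite setCI (le_trans (measureU2 _ _ _))//; [exact: measurableC|exact: measurableC|].
  by rewrite [dl]splitr EFinD leeD.
- move=> x [Fx Clx]; have /ltW hO : O x by apply: Clx; rewrite distxx invr_gt0 ltr0n.
  have -> : (p x + e%:E = p x + (e / 2)%:E + (e / 2)%:E)%E by rewrite -addeA -EFinD -splitr.
  by rewrite (pot_rem hn halpha s k) leeD// hk.
Qed.

(** It suffices to bound each truncated potential [vk s k]. The truncated kernel is at most [ktb k],
    so a set of small mass may be discarded at the price of [e / 2]; the rest sits on a compact set
    as in [domination_core], with [p + e / 2] as the majorant. *)
Theorem domination s p : (s setT < +oo)%E -> super p ->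
  {ae s, forall x, (pot s x <= p x)%E} -> {ae s, forall x, (pot s x < +oo)%E} ->
  forall x, (pot s x <= p x)%E.
Proof.
move=> sf sp ple pfin x; have [p0 lp _] := sp.
rewrite -(cvg_lim _ (vk_cvg hn halpha (s := s) (x := x)))//.
apply: lime_le; first by apply/cvg_ex; eexists; exact: (vk_cvg hn halpha).
apply: nearW => k; apply/lee_addgt0Pr => e e0.
have e2 : 0 < e / 2 by rewrite divr_gt0.
have b0 : 0 < ktb n alpha k by rewrite powR_gt0// natinv_gt0.
have [F [cF mF uF sF hF]] := compact_below sf lp ple pfin e2 (divr_gt0 e2 b0).
have [s' rs] := restr_exists alpha s mF.
have sf' : (s' setT < +oo)%E.
  by rewrite (restr_mass mF rs) (le_lt_trans _ sf)// le_measure ?inE.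
have sF' : concentrated s' F.
  case: (rs) => _ _ h _; have : concentrated s setT.
    by exists set0; split => //; rewrite setCT.
  by move/h; rewrite setTI.
have us' := unif_restr hn halpha sf cF mF rs uF.
have sq : super (fun x => p x + (e / 2)%:E)%E by apply: super_add => //; exact/super_cst/ltW.
have dom := domination_core hn halpha sf' us' cF sF' sq _ x.
have {}dom : (pot s' x <= p x + (e / 2)%:E)%E.
  by apply: dom => z Fz; rewrite (le_trans (restr_pot_le z mF rs))// hF.
have mC := measurableC mF.
have vsplit : vk alpha s k x = (\int[s]_(z in F) (kt k (d x z))%:E +
    \int[s]_(z in ~` F) (kt k (d x z))%:E)%E.
  rewrite /vk -ge0_integral_setU ?setUv//.
  - exact: measurable_ktd.
  - by move=> z _; rewrite lee_fin kt_ge0.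
  - by apply/disj_setPS => z [].
have -> : (p x + e%:E = p x + (e / 2)%:E + (e / 2)%:E)%E by rewrite -addeA -EFinD -splitr.
rewrite vsplit leeD//.
  apply: le_trans dom; case: (rs) => _ _ _ ->; apply: ge0_le_integral => //.
  - by move=> z _; rewrite lee_fin kt_ge0.
  - by apply: measurable_funTS; exact: measurable_ktd.
  - by apply: measurable_funTS; exact: measurable_kerl.
  - by move=> z _; rewrite kerE kt_le_kr// dist_ge0.
apply: (@le_trans _ _ (\int[s]_(z in ~` F) (ktb n alpha k)%:E)%E).
  apply: ge0_le_integral => //.
  - by move=> z _; rewrite lee_fin kt_ge0.
  - by apply: measurable_funTS; exact: measurable_ktd.
  - by move=> z _; rewrite lee_fin; exact: kt_bound.
rewrite integral_cst//.
have -> : (e / 2)%:E = ((ktb n alpha k)%:E * (e / 2 / ktb n alpha k)%:E)%E.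
  by rewrite -EFinM; congr EFin; rewrite [RHS]mulrC divfK// gt_eqF.
by rewrite lee_wpmul2l// lee_fin ltW.
Qed.

End Domination.

(** * Equilibrium measures and balayage *)

Section NearEquilibrium.
Local Open Scope ereal_scope.
Variables (R : realType) (n : nat) (alpha : R).
Hypotheses (hn : (3 <= n)%N) (halpha : (0 < alpha <= 2)%R).
Local Notation E := (Rn R n).
Local Notation d := (@eucl_dist R n).
Local Notation K := (@riesz_kernel R n alpha).
Local Notation pot := (riesz_potential alpha).
Local Notation energy := (riesz_energy alpha).
Local Notation mutual := (mutual_energy alpha).
Local Notation cap := (inner_capacity alpha).
Local Notation M := {measure set E -> \bar R}.
Implicit Types (mu nu s : M).

Lemma scale_exists mu (a : R) : (0 <= a)%R -> exists nu,
  [/\ forall f, measurable_fun setT f -> (forall y, 0 <= f y) ->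
        \int[nu]_y f y = a%:E * \int[mu]_x f x,
      nu setT = a%:E * mu setT,
      forall A, concentrated mu A -> concentrated nu A &
      forall x, pot nu x = a%:E * pot mu x].
Proof.
move=> a0; have [nu [h1 [h2 [h3 h4]]]] := restr_ex alpha mu measurableT a0.
exists nu; split => //; first by rewrite h2// setTI.
by move=> A /h3; rewrite setIT.
Qed.

Lemma conc_setT mu : concentrated mu setT.
Proof. by exists set0; split => //; rewrite setCT. Qed.

Lemma scale_mutual mu nu mu' nu' (a b : R) : (0 <= a)%R -> (0 <= b)%R ->
  sigma_finite setT nu ->
  (forall f, measurable_fun setT f -> (forall y, 0 <= f y) ->
        \int[mu']_y f y = a%:E * \int[mu]_x f x) ->
  (forall x, pot nu' x = b%:E * pot nu x) ->
  mutual mu' nu' = (a * b)%R%:E * mutual mu nu.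
Proof.
move=> a0 b0 sn hmu hnu; have mp := measurable_pot alpha sn.
transitivity (\int[mu']_x (b%:E * pot nu x)).
  by apply: eq_integral => x _; rewrite hnu.
rewrite hmu; last 2 first.
- exact: measurable_funeM.
- by move=> x; rewrite mule_ge0 ?pot_ge0// lee_fin.
by rewrite ge0_integralZl_EFin// ?muleA// => x _; exact: pot_ge0.
Qed.

(** The inequality of [cap_leP] along the combinations [a * mu + b * nu]. Varying the coefficients
    near 1 or near 0 replaces the Euler-Lagrange conditions of a minimizer. *)
Lemma cap_pair A (c a b m1 m2 e1 e2 x : R) mu nu : (0 <= c)%R -> cap A <= c%:E ->
  (0 <= a)%R -> (0 <= b)%R -> concentrated mu A -> concentrated nu A ->
  mu setT = m1%:E -> nu setT = m2%:E -> energy mu = e1%:E -> energy nu = e2%:E ->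
  mutual mu nu = x%:E ->
  ((a * m1 + b * m2) ^+ 2 <= c * (a ^+ 2 * e1 + 2 * (a * b * x) + b ^+ 2 * e2))%R.
Proof.
move=> c0 cA a0 b0 muA nuA mum num mue nue munu.
have sm : sigma_finite setT mu by apply: fin_sigma_finite; rewrite mum ltry.
have sn : sigma_finite setT nu by apply: fin_sigma_finite; rewrite num ltry.
have [mu' [i1 t1 c1 p1]] := scale_exists mu a0.
have [nu' [i2 t2 c2 p2]] := scale_exists nu b0.
have f1 : mu' setT < +oo by rewrite t1 mum -EFinM ltry.
have f2 : nu' setT < +oo by rewrite t2 num -EFinM ltry.
have [la [laT lac lae]] := energy_add alpha f1 f2.
have E1 : energy mu' = (a ^+ 2 * e1)%R%:E.
  by rewrite energyE (scale_mutual a0 a0 sm i1 p1) -energyE mue -EFinM expr2.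
have E2 : energy nu' = (b ^+ 2 * e2)%R%:E.
  by rewrite energyE (scale_mutual b0 b0 sn i2 p2) -energyE nue -EFinM expr2.
have E12 : mutual mu' nu' = (a * b * x)%R%:E.
  by rewrite (scale_mutual a0 b0 sn i1 p2) munu.
have lam : la setT = (a * m1 + b * m2)%R%:E by rewrite laT t1 t2 mum num -!EFinM -EFinD.
have laE : energy la = (a ^+ 2 * e1 + 2 * (a * b * x) + b ^+ 2 * e2)%R%:E.
  by rewrite lae E1 E2 E12 -EFinM -!EFinD.
have [h _] := cap_leP alpha A c0.
have := h cA la (lac _ (c1 _ muA) (c2 _ nuA)).
by rewrite lam laE /= => -> //; exact: ltry.
Qed.

Lemma pot_restr_add mu D mu1 mu2 x : measurable D -> restr alpha mu D mu1 ->
  restr alpha mu (~` D) mu2 -> pot mu x = pot mu1 x + pot mu2 x.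
Proof.
move=> mD [_ _ _ ->] [_ _ _ ->]; rewrite -ge0_integral_setU ?setUv//.
- exact: measurableC.
- exact: measurable_kerl.
- by move=> z _; exact: ker_ge0.
- by apply/disj_setPS => z [].
Qed.

(** Multiplying the part of high potential by [1 - t] costs the mass [t * m2] but saves the energy
    [2 * t * (x + e2)] to first order. The measure is optimal up to order [t ^ 2], so the surplus
    [dl] in the potential forces [m2] to be small. *)
Lemma near_eq_real (m e m2 x e1 e2 c t dl : R) : (0 < m)%R -> (0 <= c)%R -> (0 <= m2)%R ->
  (0 < t)%R -> (0 < dl)%R -> (0 <= e1)%R -> (0 <= x)%R -> (0 <= e2)%R ->
  (e = e1 + 2 * x + e2)%R -> (0 < e)%R ->
  (c * (1 - t ^+ 2) * e < m ^+ 2)%R -> (m ^+ 2 <= c * e)%R ->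
  (e / m * (1 + dl) * m2 <= x + e2)%R ->
  ((m - t * m2) ^+ 2 <= c * (e1 + 2 * ((1 - t) * x) + (1 - t) ^+ 2 * e2))%R ->
  (m2 <= t / dl * m)%R.
Proof.
move=> m0 c0 m20 t0 dl0 e10 x0 e20 eE e0 h1 h2 h3 h4.
have V0 : (0 < e / m)%R by rewrite divr_gt0.
set V := (e / m)%R in h3 V0; have eV : e = (V * m)%R by rewrite /V divfK// gt_eqF.
have cV : (m <= c * V)%R.
  by rewrite -(ler_pM2r m0) -mulrA -eV -expr2.
have k1 : (c * (e1 + 2 * ((1 - t) * x) + (1 - t) ^+ 2 * e2) <=
    c * (e - 2 * t * (V * (1 + dl) * m2) + t ^+ 2 * e))%R.
  rewrite ler_wpM2l//.
  have -> : (e1 + 2 * ((1 - t) * x) + (1 - t) ^+ 2 * e2 = e - 2 * t * (x + e2) + t ^+ 2 * e2)%R.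
    by rewrite eE; ring.
  have := ler_wpM2l (mulr_ge0 (ler0n _ 2) (ltW t0)) h3.
  have : (t ^+ 2 * e2 <= t ^+ 2 * e)%R by rewrite ler_wpM2l ?sqr_ge0// eE; lra.
  lra.
have k2 : (m ^+ 2 - 2 * t * (m * m2) <= (m - t * m2) ^+ 2)%R.
  by have := sqr_ge0 (t * m2)%R; rewrite sqrrB; lra.
have k3 : (t * (m2 * (c * V * (1 + dl) - m)) <= t * (c * t * e))%R.
  move: h1 k1 k2 h4; rewrite expr2; lra.
have k4 : (m2 * (c * V * dl) <= c * t * e)%R.
  rewrite ler_pM2l// in k3; apply: le_trans k3; rewrite ler_wpM2l//.
  by have := cV; lra.
have cp : (0 < c)%R.
  rewrite lt0r c0 andbT; apply/eqP => cz.
  by move: h2; rewrite cz mul0r leNgt exprn_gt0.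
have cVd : (0 < c * V * dl)%R := mulr_gt0 (mulr_gt0 cp V0) dl0.
rewrite -(ler_pM2r cVd) (le_trans k4)// eV le_eqVlt; apply/orP; left; apply/eqP.
by field; rewrite gt_eqF.
Qed.

(** Since [m ^ 2 / e] is almost [c] and [m2 <= dl * m], rescaling loses mass only to first order in
    [dl]; the coefficient 3 is large enough to absorb the terms of higher order. *)
Lemma near_eq_mass (m e m2 c dl : R) : (0 < m)%R -> (0 <= c)%R ->
  (0 < dl)%R -> (3 * dl < 1)%R -> (0 < e)%R ->
  (c * (1 - (dl ^+ 2) ^+ 2) * e < m ^+ 2)%R -> (m2 <= dl ^+ 2 / dl * m)%R ->
  (c * (1 - 3 * dl) <= (e / m * (1 + dl))^-1 * (m - m2))%R.
Proof.
move=> m0 c0 d0 d1 e0 h1; rewrite expr2 mulfK ?gt_eqF// => h2.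
have d11 : (0 < 1 + dl)%R by lra.
have V0 : (0 < e / m * (1 + dl))%R by rewrite !mulr_gt0 ?invr_gt0.
rewrite [leRHS]mulrC ler_pdivlMr//.
have h3 : (m * (1 - dl) <= m - m2)%R by rewrite mulrBr mulr1; lra.
apply: le_trans h3; rewrite -(ler_pM2r m0).
have -> : (c * (1 - 3 * dl) * (e / m * (1 + dl)) * m = c * ((1 - 3 * dl) * (1 + dl)) * e)%R.
  by field; rewrite gt_eqF.
have -> : (m * (1 - dl) * m = m ^+ 2 * (1 - dl))%R by ring.
have q : (0 <= dl * dl)%R by rewrite mulr_ge0// ltW.
have d2 : (dl * dl * (dl * dl) <= dl)%R.
  have : (dl * dl <= dl)%R by rewrite ler_piMr ?(ltW d0)//; lra.
  move=> h; rewrite (le_trans _ h)// ler_piMr//; lra.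
apply: (@le_trans _ _ (c * (1 - (dl ^+ 2) ^+ 2) * e * (1 - dl)))%R; last first.
  by rewrite ler_wpM2r ?(ltW h1)//; lra.
rewrite [leRHS]mulrAC ler_wpM2r ?(ltW e0)// -[leRHS]mulrA ler_wpM2l//.
have : ((1 - dl) * (1 - dl) <= (1 - (dl ^+ 2) ^+ 2) * (1 - dl))%R.
  by rewrite ler_wpM2r ?expr2//; lra.
by lra.
Qed.

(** A nearly optimal measure is cut to the set [B] where its potential is at most [V] and divided by
    [V]. The result has potential at most 1 on a set carrying it, so its energy is at most its mass,
    and almost the full mass [c] survives. *)
Lemma near_equilibrium A (c dl : R) : (0 < c)%R -> cap A = c%:E -> (0 < dl)%R -> (3 * dl < 1)%R ->
  exists g : M, exists m : R,
    [/\ g setT = m%:E, (c * (1 - 3 * dl) <= m <= c)%R, energy g <= m%:E &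
      exists B, [/\ measurable B, concentrated g (A `&` B) & forall x, B x -> pot g x <= 1]].
Proof.
(* [t] is the size of the perturbation, and the measure will be optimal up to [t ^ 2], one order
   better; then [t / dl = dl] bounds the share of mass that is cut away. *)
move=> c0 cA d0 d1; pose t := (dl ^+ 2)%R; have t0 : (0 < t)%R by rewrite exprn_gt0.
have dl1 : (dl < 1)%R by lra.
have t1 : (t < 1)%R by rewrite expr_lt1// ltW.
pose b := (c * (1 - t ^+ 2))%R.
have tt1 : (t ^+ 2 < 1)%R by rewrite expr_lt1// ltW.
have b0 : (0 <= b)%R by rewrite mulr_ge0// ?(ltW c0)// subr_ge0 ltW.
have bc : ~ (cap A <= b%:E).
  rewrite cA lee_fin /b leNgt gtr_pMr// => /negP; apply.
  by rewrite ltrBlDr ltrDl exprn_gt0.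
have [mu [muA [mfin [efin hb]]]] : exists mu, concentrated mu A /\ mu setT < +oo /\
    energy mu < +oo /\ (b * fine (energy mu) < fine (mu setT) ^+ 2)%R.
  apply: contrapT => h; apply: bc; apply/cap_leP => // mu muA mfin efin.
  by rewrite leNgt; apply/negP => hb; apply: h; exists mu.
have [m mE] : exists m, mu setT = m%:E by exists (fine (mu setT)); rewrite fineK// ge0_fin_numE.
have [e eE] : exists e, energy mu = e%:E.
  by exists (fine (energy mu)); rewrite fineK// ge0_fin_numE ?energy_ge0.
have hc : (m ^+ 2 <= c * e)%R.
  have [h _] := cap_leP alpha A (ltW c0).
  by have := h _ mu muA mfin efin; rewrite mE eE cA /=; apply.
have e0' : (0 <= e)%R by rewrite -lee_fin -eE energy_ge0.
move: hb; rewrite mE eE /= => hb.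
have m0 : (0 < m)%R.
  rewrite lt0r -(lee_fin 0 m) -mE measure_ge0 andbT; apply/eqP => mz.
  by move: hb; rewrite mz expr0n/= ltNge mulr_ge0.
have e0 : (0 < e)%R.
  rewrite lt0r e0' andbT; apply/eqP => ez.
  by move: hc; rewrite ez mulr0 leNgt exprn_gt0.
(* [e / m] is the mean of the potential of [mu] under [mu]; near optimality leaves little mass where
   the potential exceeds it by more than the factor [1 + dl]. *)
pose V := (e / m * (1 + dl))%R; have V0 : (0 < V)%R by rewrite !mulr_gt0 ?invr_gt0//; lra.
have smu := fin_sigma_finite mfin; have mp := measurable_pot alpha smu.
pose B := [set x | pot mu x <= V%:E].
have mB : measurable B.
  by have := emeasurable_fun_le measurableT mp (measurable_cst V%:E); rewrite setTI.
have mBC := measurableC mB.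
have [mu1 r1] := restr_exists alpha mu mB; have [mu2 r2] := restr_exists alpha mu mBC.
have mm1 : mu1 setT = mu B by exact: restr_mass r1.
have mm2 : mu2 setT = mu (~` B) by exact: restr_mass r2.
have f1 : mu1 setT < +oo by rewrite mm1 (le_lt_trans _ mfin)// le_measure// ?inE.
have f2 : mu2 setT < +oo by rewrite mm2 (le_lt_trans _ mfin)// le_measure// ?inE.
have s1 := fin_sigma_finite f1; have s2 := fin_sigma_finite f2.
have [m2 m2E] : exists m2, mu2 setT = m2%:E by exists (fine (mu2 setT)); rewrite fineK// ge0_fin_numE.
have m20 : (0 <= m2)%R by rewrite -lee_fin -m2E measure_ge0.
have m1E : mu1 setT = (m - m2)%R%:E.
  have : mu1 setT + mu2 setT = m%:E.
    by rewrite mm1 mm2 -mE -measureU// ?setUv// setICr.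
  by rewrite m2E EFinB => <-; rewrite addeK.
have conc1 : concentrated mu1 (A `&` B) by case: r1 => _ _ h _; exact: h.
have conc1' := concentrated_sub (@subIsetl _ A B) conc1.
have conc2' : concentrated mu2 A.
  by case: r2 => _ _ h _; apply: concentrated_sub (h _ muA) => x [].
have pE x := pot_restr_add x mB r1 r2.
have mp1 := measurable_pot alpha s1; have mp2 := measurable_pot alpha s2.
have I1 : \int[mu]_(x in B) pot mu x = energy mu1 + mutual mu1 mu2.
  case: (r1) => h _ _ _; rewrite -h//; last by move=> x; exact: pot_ge0.
  rewrite -ge0_integralD//; [|by move=> x _; exact: pot_ge0..].
  by apply: eq_integral => x _; rewrite pE.
have I2 : \int[mu]_(x in ~` B) pot mu x = mutual mu1 mu2 + energy mu2.
  case: (r2) => h _ _ _; rewrite -h//; last by move=> x; exact: pot_ge0.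
  rewrite (mutual_sym alpha s1 s2) -ge0_integralD//; [|by move=> x _; exact: pot_ge0..].
  by apply: eq_integral => x _; rewrite pE.
have eS : e%:E = (energy mu1 + mutual mu1 mu2) + (mutual mu1 mu2 + energy mu2).
  by rewrite -eE (energy_split alpha smu mB) I1 I2.
have [e1 [x [e2 [E1 Ex E2]]]] : exists e1 x e2,
    [/\ energy mu1 = e1%:E, mutual mu1 mu2 = x%:E & energy mu2 = e2%:E].
  have := energy_ge0 alpha mu1; have := energy_ge0 alpha mu2; have := mutual_ge0 alpha mu1 mu2.
  move: eS; case: (energy mu1) => [e1||]; case: (mutual mu1 mu2) => [x||];
    case: (energy mu2) => [e2||] //.
  by move=> _ _ _ _; exists e1, x, e2.
have e10 : (0 <= e1)%R by rewrite -lee_fin -E1 energy_ge0.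
have e20 : (0 <= e2)%R by rewrite -lee_fin -E2 energy_ge0.
have x0 : (0 <= x)%R by rewrite -lee_fin -Ex mutual_ge0.
have eS' : (e = e1 + 2 * x + e2)%R.
  by move: eS; rewrite E1 Ex E2 -!EFinD => -[->]; ring.
have P : (V * m2 <= x + e2)%R.
  rewrite -lee_fin EFinD -Ex -E2 -I2 EFinM -m2E mm2 -integral_cst//.
  apply: ge0_le_integral => //.
  - by move=> z _; rewrite lee_fin ltW.
  - by apply: measurable_funTS.
  - by move=> z /= /negP; rewrite -ltNge => /ltW.
have cAc : cap A <= c%:E by rewrite cA.
have t10 : (0 <= 1 - t)%R by rewrite subr_ge0 ltW.
have := cap_pair (ltW c0) cAc ler01 t10 conc1' conc2' m1E m2E E1 E2 Ex.
rewrite !mul1r expr1n mul1r => hv.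
have hv' : ((m - t * m2) ^+ 2 <= c * (e1 + 2 * ((1 - t) * x) + (1 - t) ^+ 2 * e2))%R.
  by apply: le_trans hv; rewrite le_eqVlt; apply/orP; left; apply/eqP; congr (_ ^+ _)%R; ring.
have hm2 := near_eq_real m0 (ltW c0) m20 t0 d0 e10 x0 e20 eS' e0 hb hc P hv'.
have hmass := near_eq_mass m0 (ltW c0) d0 d1 e0 hb hm2.
have Vi0 : (0 <= V^-1)%R by rewrite invr_ge0 ltW.
have [g [gi gT gc gp]] := scale_exists mu1 Vi0.
pose mg := (V^-1 * (m - m2))%R.
have gTE : g setT = mg%:E by rewrite gT m1E.
have gB : concentrated g (A `&` B) by exact: gc.
have pg x' : B x' -> pot g x' <= 1.
  move=> Bx; rewrite gp; have h : pot mu1 x' <= V%:E := le_trans (restr_pot_le x' mB r1) Bx.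
  apply: (@le_trans _ _ ((V^-1)%R%:E * V%:E)); first by rewrite lee_wpmul2l ?lee_fin.
  by rewrite -EFinM mulVf// gt_eqF.
have gfin : g setT < +oo by rewrite gTE ltry.
have mpg := measurable_pot alpha (fin_sigma_finite gfin).
have ge : energy g <= mg%:E.
  have gB' := concentrated_sub (@subIsetr _ A B) gB.
  rewrite /riesz_energy -/(riesz_potential alpha g).
  have -> : \int[g]_x pot g x = \int[g]_(x in B) pot g x.
    by apply: (conc_int gB') => //; move=> z; exact: pot_ge0.
  apply: (@le_trans _ _ (\int[g]_(x in B) cst 1 x)).
    apply: ge0_le_integral => //.
    - by move=> z _; exact: pot_ge0.
    - exact: measurable_funTS.
  by rewrite integral_cst// mul1e -gTE le_measure ?inE.
exists g, mg; split => //; last by exists B.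
rewrite hmass /=.
have gA := concentrated_sub (@subIsetl _ A B) gB.
have mg0 : (0 <= mg)%R by rewrite -lee_fin -gTE measure_ge0.
have gefin : energy g < +oo by rewrite (le_lt_trans ge)// ltry.
have [h _] := cap_leP alpha A (ltW c0).
have := h cAc g gA gfin gefin; rewrite gTE /=.
have : (fine (energy g) <= mg)%R.
  by rewrite -lee_fin fineK// ge0_fin_numE ?energy_ge0.
move=> h1 h2; have [->|mgn] := eqVneq mg 0%R; first exact: ltW.
have mgp : (0 < mg)%R by rewrite lt0r mgn.
rewrite -(ler_pM2r mgp) -expr2 (le_trans h2)// ler_wpM2l// ltW//.
Qed.

End NearEquilibrium.

(** * Existence of the equilibrium measure *)

Section Equilibrium.
Local Open Scope ereal_scope.
Variables (R : realType) (n : nat) (alpha : R).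
Hypotheses (hn : (3 <= n)%N) (halpha : (0 < alpha <= 2)%R).
Local Notation E := (Rn R n).
Local Notation d := (@eucl_dist R n).
Local Notation K := (@riesz_kernel R n alpha).
Local Notation pot := (riesz_potential alpha).
Local Notation energy := (riesz_energy alpha).
Local Notation mutual := (mutual_energy alpha).
Local Notation cap := (inner_capacity alpha).
Local Notation super := (super alpha).
Local Notation M := {measure set E -> \bar R}.
Implicit Types (mu nu s g : M).

Lemma concentrated_ae g A (P : E -> Prop) : concentrated g A -> (forall x, A x -> P x) ->
  {ae g, forall x, P x}.
Proof. by move=> gA h; apply: negligibleS gA => x /= nP /h. Qed.

Lemma vanishing_kt k x : vanishing (fun z : 'rV[R]_n => kt n alpha k (d x z)).
Proof.
have b0 := exponent_gt0 hn halpha.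
have cont : continuous (fun z : 'rV[R]_n => kt n alpha k (d x z)).
  have dc : continuous (fun z : 'rV[R]_n => d x z).
    apply: dist_continuous => z e e0; exists e => // z' /ltW zz'.
    by rewrite !(dist_sym x) (le_trans (dist_lip _ _ _)).
  by move=> z; apply: continuous_comp; [exact: dc|exact: kt_continuous].
split; [by move=> z; exact: kt_ge0|exact: cont|move=> s s0].
apply: bounded_closed_compact; last first.
  have -> : [set z : 'rV[R]_n | (s <= kt n alpha k (d x z))%R] =
    (fun z : 'rV[R]_n => kt n alpha k (d x z)) @^-1` [set t | (s <= t)%R] by [].
  by apply: closed_comp; [move=> z _; exact: cont|exact: closed_ge].
have [p p0 sE] : exists2 p : R, (0 < p)%R & s = (p `^ (alpha - n%:R))%R.
  exists (s `^ (- (n%:R - alpha)^-1))%R; first by rewrite powR_gt0.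
  rewrite -powRrM (_ : - (n%:R - alpha)^-1 * (alpha - n%:R) = 1)%R ?powRr1 ?(ltW s0)//.
  by field; rewrite gt_eqF.
pose L := (p + 1)%R; have L1 : (0 < L)%R by rewrite addr_gt0.
have bd z : (s <= kt n alpha k (d x z))%R -> (d x z <= L)%R.
  move=> h; rewrite leNgt; apply/negP => Lz.
  have h1 : (kt n alpha k (d x z) <= L `^ (alpha - n%:R))%R.
    by apply: (powRN_le hn halpha L1); rewrite le_max (ltW Lz).
  have h2 : (L `^ (alpha - n%:R) < s)%R.
    rewrite sE -(opprB _ alpha) !powRN ltf_pV2 ?posrE ?powR_gt0//.
    by apply: gt0_ltr_powR; rewrite ?nnegrE ?(ltW p0) ?(ltW L1)// ltrDl.
  by have := le_lt_trans (le_trans h h1) h2; rewrite ltxx.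
exists (d x (0%R : 'rV[R]_n) + L)%R; split => [|M' hM z zs]; first exact: num_real.
rewrite /= (le_trans _ (ltW hM))// [leLHS]mx_normrE; apply: bigmax_le.
  by rewrite addr_ge0 ?dist_ge0// ltW.
move=> [i j] _ /=; rewrite (ord1 i).
have h1 := dist_coord z (0%R : 'rV[R]_n) j; rewrite mxE subr0 in h1.
apply: (le_trans h1); apply: (le_trans (dist_triangle z x _)).
by rewrite addrC lerD2l dist_sym bd.
Qed.

(** The restriction to [N] still has finite energy, so [cap_leP] with bound 0 makes its mass
    vanish. *)
Lemma energy_null A N g : concentrated g A -> g setT < +oo -> energy g < +oo ->
  measurable N -> cap (A `&` N) <= 0 -> g N = 0.
Proof.
move=> gA gf ge mN c0; have [g' rg] := restr_exists alpha g mN.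
have gf' : g' setT < +oo by rewrite (restr_mass mN rg) (le_lt_trans _ gf)// le_measure ?inE.
have ge' : energy g' < +oo.
  rewrite (le_lt_trans _ ge)//.
  by apply: (restr_energy_le_energy mN rg); exact: fin_sigma_finite.
have gA' : concentrated g' (A `&` N) by case: (rg) => _ _ h _; exact: h.
have [h _] := cap_leP alpha (A `&` N) (lexx 0%R).
have := h c0 g' gA' gf' ge'; rewrite mul0r -(restr_mass mN rg) => h2.
have : (fine (g' setT) ^+ 2 == 0)%R by rewrite eq_le h2 sqr_ge0.
rewrite sqrf_eq0 => /eqP h3.
by rewrite -(fineK (_ : g' setT \is a fin_num)) ?h3// ge0_fin_numE.
Qed.

(** The exceptional set may fail to be measurable, so it is replaced by the set where [p < 1], which
    [g] does not charge by [energy_null]. Then the potential is at most 1, hence at most [p], almost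
    everywhere for [g], and domination applies. *)
Lemma near_eq_le A B g p : concentrated g (A `&` B) -> g setT < +oo -> energy g < +oo ->
  (forall x, B x -> pot g x <= 1) -> super p ->
  nearly_everywhere alpha A (fun z => 1 <= p z) -> forall x, pot g x <= p x.
Proof.
move=> gAB gf ge hB sp [N [NA [N0 hN]]]; have [p0 lp _] := sp.
pose D := [set x | p x < 1].
have mD : measurable D.
  have := emeasurable_fun_lt measurableT (lsc_measurable lp) (measurable_cst 1).
  by rewrite setTI.
have gD : g D = 0.
  apply: (energy_null (concentrated_sub (@subIsetl _ A B) gAB)) => //.
  rewrite -N0; apply: cap_mono => x [Ax]; rewrite /D/= ltNge => /negP h.
  by apply: contrapT => Nx; apply: h; exact: hN.
apply: (domination hn halpha gf sp).
  have : g.-negligible (~` (A `&` B) `|` D).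
    by apply: (negligibleU gAB); exists D; split.
  apply: negligibleS => x /= h; apply: contrapT => /not_orP[/contrapT[Ax Bx]].
  rewrite /D/= ltNge => /negP/negPn h1; apply: h.
  by rewrite (le_trans (hB x Bx)).
apply: (concentrated_ae gAB) => x [_ Bx].
by rewrite (le_lt_trans (hB x Bx))// ltry.
Qed.

(** The part linear in [t] of [cap_pair] for [g + t * s1]: the terms of order zero cancel up to an
    error proportional to [dl], since [g] has almost the largest possible mass. *)
Lemma variation_real (m c dl t s I x e : R) : (0 < c)%R -> (0 <= dl)%R -> (0 < t)%R ->
  (0 <= s)%R -> (c * (1 - 3 * dl) <= m)%R -> (m <= c)%R -> (e <= m)%R -> (0 <= I)%R ->
  ((m + t * s) ^+ 2 <= c * (e + 2 * (t * x) + t ^+ 2 * I))%R ->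
  (s * (1 - 3 * dl) - 3 * c * dl / (2 * t) - t * I / 2 <= x)%R.
Proof.
move=> c0 dl0 t0 s0 h1 h2 h3 I0 h4.
have ct : (0 < 2 * t * c)%R by rewrite !mulr_gt0.
rewrite -(ler_pM2l ct).
have -> : (2 * t * c * (s * (1 - 3 * dl) - 3 * c * dl / (2 * t) - t * I / 2) =
   2 * t * s * (c * (1 - 3 * dl)) - c * (3 * c * dl) - c * t ^+ 2 * I)%R.
  by field; rewrite gt_eqF.
have q1 : (2 * t * s * (c * (1 - 3 * dl)) <= 2 * t * s * m)%R by rewrite ler_wpM2l ?mulr_ge0 ?(ltW t0).
have q2 : (c * e <= c * m)%R by rewrite ler_wpM2l ?(ltW c0).
have q3 : (0 <= (t * s) ^+ 2)%R by rewrite sqr_ge0.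
have q4 : (m * (c - m) <= c * (3 * c * dl))%R.
  apply: (@le_trans _ _ (c * (c - m)))%R; first by rewrite ler_wpM2r ?subr_ge0.
  by rewrite ler_wpM2l ?(ltW c0)//; lra.
move: h4; rewrite sqrrD; lra.
Qed.

(** Minimality passes to the vague limit through the truncated kernels. For the lower bound, a
    measure [s] of finite energy on a set where the potential stays below [1 - eta] is cut to a
    piece [s1] with continuous potential; testing the near-equilibrium measures against [s1] shows
    that its mutual energy with the limit is at least its mass, a contradiction. *)
Lemma equilibrium_pos A (c : R) : (0 < c)%R -> cap A = c%:E -> exists g : M,
  [/\ g setT <= c%:E,
    forall p, super p -> nearly_everywhere alpha A (fun z => 1 <= p z) -> forall x, pot g x <= p x &
    nearly_everywhere alpha A (fun z => 1 <= pot g z)].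
Proof.
move=> c0 cA.
(* The factor 4 keeps [3 * dl j < 1] already for [j = 0]. *)
pose dl (j : nat) : R := ((4 * j.+1%:R)^-1)%R.
have dl0 j : (0 < dl j)%R by rewrite invr_gt0 mulr_gt0.
have dl1 j : (3 * dl j < 1)%R.
  rewrite /dl ltr_pdivrMr ?mulr_gt0// mul1r; apply: (@lt_le_trans _ _ (4 : R))%R.
    by rewrite ltr_nat.
  by rewrite ler_peMr// ler1n.
have [g hg] := choice (fun j => near_equilibrium c0 cA (dl0 j) (dl1 j)).
have [m hm] := choice hg.
have gC j : g j setT <= c%:E.
  by have [-> /andP[_ h] _ _] := hm j; rewrite lee_fin.
have [ga [gaT hga]] := vague_limit gC.
have gf j : g j setT < +oo by rewrite (le_lt_trans (gC j))// ltry.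
have gef j : energy (g j) < +oo.
  by have [_ _ h _] := hm j; rewrite (le_lt_trans h)// ltry.
have gaf : ga setT < +oo by rewrite (le_lt_trans gaT)// ltry.
have gle j p : super p -> nearly_everywhere alpha A (fun z => 1 <= p z) ->
    forall x, pot (g j) x <= p x.
  move=> sp hp x; have [_ _ _ [B [mB gB hB]]] := hm j.
  exact: (near_eq_le gB).
exists ga; split => //.
  move=> p sp hp x; rewrite -(cvg_lim _ (@vk_cvg _ _ _ hn halpha ga x))//.
  apply: lime_le; first by apply/cvg_ex; eexists; exact: (@vk_cvg _ _ _ hn halpha ga x).
  apply: nearW => k; have [h _] := hga _ (vanishing_kt k x) (p x).
  apply: h; apply: nearW => j; apply: le_trans (gle j p sp hp x).
  apply: ge0_le_integral => //.
  - by move=> z _; rewrite lee_fin kt_ge0.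
  - exact: measurable_ktd.
  - exact: measurable_kerl.
  - by move=> z _; rewrite kerE kt_le_kr// dist_ge0.
have lga : lsc (pot ga) by exact: lsc_pot.
pose N := [set z | A z /\ pot ga z < 1].
exists N; split; first by move=> x [].
split; last by move=> x Ax Nx; rewrite leNgt; apply/negP => h; apply: Nx.
apply/eqP; rewrite eq_le cap_ge0 andbT.
(* The second set is there only to make the [F k] exhaust the space; it does not meet [N]. *)
pose F k := [set z | pot ga z <= (1 - k.+1%:R^-1)%R%:E] `|` [set z | 1 <= pot ga z].
have mF k : measurable (F k).
  have mg := lsc_measurable lga.
  apply: measurableU.
    by have := emeasurable_fun_le measurableT mg (measurable_cst (1 - k.+1%:R^-1)%R%:E); rewrite setTI.
  by have := emeasurable_fun_le measurableT (measurable_cst 1) mg; rewrite setTI.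
apply: (@cap_exhaust R n alpha N F 0%R (lexx 0%R) mF).
- move=> k l kl; apply/subsetPset => x [h|h]; [left|by right].
  by rewrite /= (le_trans h)// lee_fin lerB// lef_pV2 ?posrE ?ltr0n// ler_nat ltnS.
- apply/seteqP; split => // x _; have [h|h] := leP 1 (pot ga x); first by exists 0%N => //; right.
  have [u uE] : exists u, pot ga x = u%:E.
    exists (fine (pot ga x)); rewrite fineK// ge0_fin_numE ?pot_ge0//.
    by rewrite (lt_trans h)// ltry.
  rewrite uE lte_fin in h.
  exists (Num.truncn (1 - u)^-1) => //; left; rewrite /= uE lee_fin lerBrDr -lerBrDl.
  by rewrite -[leRHS]invrK lef_pV2 ?posrE ?ltr0n ?invr_gt0 ?subr_gt0// ltW// truncnS_gt.
move=> k; set eta := (k.+1%:R^-1 : R)%R in F mF *.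
have eta0 : (0 < eta)%R by exact: natinv_gt0.
apply/cap_leP => // s sN sf se; rewrite mul0r leNgt; apply/negP => sp2.
have [S SE] : exists S, s setT = S%:E by exists (fine (s setT)); rewrite fineK// ge0_fin_numE.
rewrite SE /= in sp2.
have S0 : (0 < S)%R.
  rewrite lt0r -(lee_fin 0 S) -SE measure_ge0 andbT; apply/eqP => Sz.
  by move: sp2; rewrite Sz expr0n/= ltxx.
have ss := fin_sigma_finite sf.
have spf : {ae s, forall x, pot s x < +oo}.
  have ips : s.-integrable setT (pot s).
    apply/integrableP; split; first exact: measurable_pot.
    rewrite (eq_integral (pot s)) => [//|x _]; by rewrite gee0_abs// pot_ge0.
  have := integrable_ae measurableT ips; apply: filterS => x /(_ I).
  by rewrite ge0_fin_numE ?pot_ge0.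
(* On the compact set [D], which keeps at least half of the mass, the remainders are uniformly
   small, so the potential of the restriction is a test function for the vague limit. *)
have [D [cD mD uD sD]] := nice_ex hn halpha sf spf (divr_gt0 S0 (ltr0n _ 2)).
have [s1 r1] := restr_exists alpha s mD.
have s1T : s1 setT = s D by exact: restr_mass r1.
have s1f : s1 setT < +oo by rewrite s1T (le_lt_trans _ sf)// le_measure ?inE.
have [S1 S1E] : exists S1, s1 setT = S1%:E by exists (fine (s1 setT)); rewrite fineK// ge0_fin_numE.
have S10 : (0 < S1)%R.
  rewrite -lte_fin -S1E s1T ltNge; apply/negP => h.
  have : s setT = s D + s (~` D) by rewrite -measureU ?setUv ?setICr//; exact: measurableC.
  have -> : s D = 0 by apply/eqP; rewrite eq_le h measure_ge0.
  rewrite add0e SE => hS; move: sD; rewrite -hS lee_fin leNgt => /negP; apply.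
  by rewrite ltr_pdivrMr// ltr_pMr// ltr1n.
have ss1 := fin_sigma_finite s1f.
have s1e : energy s1 < +oo by rewrite (le_lt_trans _ se)//; exact: (restr_energy_le_energy mD r1).
have [I IE] : exists I, energy s1 = I%:E.
  by exists (fine (energy s1)); rewrite fineK// ge0_fin_numE ?energy_ge0.
have I0 : (0 <= I)%R by rewrite -lee_fin -IE energy_ge0.
have s1N : concentrated s1 ((N `&` F k) `&` D) by case: (r1) => _ _ h _; exact: h.
have s1A : concentrated s1 A by apply: concentrated_sub s1N => x [[[]]].
have us1 := unif_restr hn halpha sf cD mD r1 uD.
have [r0 Dr0] := compact_in_ball cD.
have vphi : vanishing (fun x : 'rV[R]_n => fine (pot s1 x)).
  apply: (pot_vanishing hn halpha s1f us1 (r0 := r0)).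
  by apply: concentrated_sub s1N => x [_ /Dr0].
have s1fin := pot_unif_fin hn halpha s1f us1.
have phiE x : pot s1 x = (fine (pot s1 x))%:E by rewrite fineK// ge0_fin_numE ?pot_ge0.
have mutE j : mutual (g j) s1 = \int[g j]_x (fine (pot s1 x))%:E.
  by apply: eq_integral => x _.
have mutfin j : exists x, mutual (g j) s1 = x%:E.
  have [b hb] := vanishing_bounded vphi.
  have : mutual (g j) s1 < +oo.
    apply: (@le_lt_trans _ _ (\int[g j]_x (cst b%:E x))).
      rewrite mutE; apply: ge0_le_integral => //.
      - by move=> x _; rewrite lee_fin fine_ge0 ?pot_ge0.
      - by apply/measurable_EFinP; exact: (vanishing_measurable vphi).
      - by move=> x _; rewrite lee_fin.
    by rewrite integral_cst// lte_mul_pinfty// lee_fin (le_trans _ (hb 0%R))// fine_ge0 ?pot_ge0.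
  move=> h; exists (fine (mutual (g j) s1)); rewrite fineK// ge0_fin_numE ?mutual_ge0//.
have lower (e : R) : (0 < e)%R -> (S1 - e)%R%:E <= mutual ga s1.
  move=> e0.
  (* With this [t] the quadratic error [t * I / 2] is at most [e / 2]; letting [j] grow afterwards
     brings the terms in [dl j] below [e / 2]. *)
  pose t := (e / (I + 1))%R; have t0 : (0 < t)%R by rewrite divr_gt0// ltr_wpDl.
  have tI : (t * I / 2 <= e / 2)%R.
    rewrite ler_pM2r ?invr_gt0// /t mulrAC ler_pdivrMr ?ltr_wpDl// ler_wpM2l ?(ltW e0)// lerDl//.
  have -> : mutual ga s1 = \int[ga]_x (fine (pot s1 x))%:E by apply: eq_integral => x _.
  have [_ h] := hga _ vphi (S1 - e)%R%:E; apply: h.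
  pose C := (S1 * 3 + 3 * c / (2 * t))%R.
  have C0 : (0 < C)%R.
    by apply: addr_gt0; [exact: mulr_gt0|apply: divr_gt0; exact: mulr_gt0].
  near=> j; rewrite -mutE; have [x xE] := mutfin j; rewrite xE lee_fin.
  have [mT /andP[m1 m2] me [B [_ gB _]]] := hm j.
  have [ej ejE] : exists ej, energy (g j) = ej%:E.
    by exists (fine (energy (g j))); rewrite fineK// ge0_fin_numE ?energy_ge0.
  have gA := concentrated_sub (@subIsetl _ A B) gB.
  have cAc : cap A <= c%:E by rewrite cA.
  have := cap_pair (ltW c0) cAc ler01 (ltW t0) gA s1A mT S1E ejE IE xE.
  rewrite !mul1r expr1n mul1r => hv.
  have ejm : (ej <= m j)%R by rewrite -lee_fin -ejE.
  have := variation_real c0 (ltW (dl0 j)) t0 (ltW S10) m1 m2 ejm I0 hv.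
  have : (C * dl j <= e / 2)%R.
    rewrite /dl invfM mulrA ler_pdivrMr// -ler_pdivrMl ?divr_gt0//.
    apply: (@le_trans _ _ j%:R); last by rewrite ler_nat.
    by near: j; exact: nbhs_infty_ger.
  have -> : (3 * c * dl j / (2 * t) = 3 * c / (2 * t) * dl j)%R by ring.
  rewrite /C mulrDl; lra.
have upper : mutual ga s1 <= ((1 - eta) * S1)%R%:E.
  have sga := fin_sigma_finite gaf.
  rewrite (mutual_sym alpha sga ss1) EFinM -S1E.
  have mB : measurable [set z | pot ga z <= (1 - eta)%R%:E].
    have := emeasurable_fun_le measurableT (lsc_measurable lga) (measurable_cst (1 - eta)%R%:E).
    by rewrite setTI.
  have cB : concentrated s1 [set z | pot ga z <= (1 - eta)%R%:E].
    apply: concentrated_sub s1N => x [[[_ h] [//|]]] /=.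
    by rewrite leNgt h.
  have -> : mutual s1 ga = \int[s1]_(z in [set z | pot ga z <= (1 - eta)%R%:E]) pot ga z.
    by apply: (conc_int cB) => //; [exact: lsc_measurable|move=> z; exact: pot_ge0].
  rewrite (conc_mass cB (fun _ => id) mB) -integral_cst//.
  apply: ge0_le_integral => //.
  - by move=> z _; exact: pot_ge0.
  - by apply: measurable_funTS; exact: lsc_measurable.
have e0 : (0 < eta * S1 / 2)%R by rewrite !mulr_gt0.
have := le_trans (lower _ e0) upper; rewrite lee_fin; lra.
Unshelve. all: end_near. Qed.

End Equilibrium.

(** * The Kelvin transformation of measures and potentials *)

Section Kelvin.
Local Open Scope ereal_scope.
Variables (R : realType) (n : nat) (alpha : R).
Hypotheses (hn : (3 <= n)%N) (halpha : (0 < alpha <= 2)%R).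
Local Notation E := (Rn R n).
Local Notation d := (@eucl_dist R n).
Local Notation K := (@riesz_kernel R n alpha).
Local Notation Kv := (@Kv R n alpha).
Local Notation Kw := (@Kw R n alpha).
Local Notation pot := (riesz_potential alpha).
Local Notation energy := (riesz_energy alpha).
Local Notation cap := (inner_capacity alpha).
Local Notation super := (super alpha).
Local Notation M := {measure set E -> \bar R}.
Local Notation be := (n%:R - alpha)%R.
Implicit Types (mu nu s g eta : M).

Lemma radon_sigma_finite s : radon_measure s -> sigma_finite setT s.
Proof.
move=> rs; exists (fun k : nat => [set x | (d (0%R : 'rV[R]_n) x <= k%:R)%R]).
  apply/seteqP; split => // x _; exists (Num.truncn (d (0%R : 'rV[R]_n) x)).+1 => //=.
  by rewrite ltW// truncnS_gt.
move=> k; split; last exact: rs.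
have := @measurable_ball_le R n (0%R : 'rV[R]_n) k%:R.
by congr measurable; apply/seteqP; split => x /=; rewrite dist_sym.
Qed.

Lemma measurable_point (y : E) : measurable [set y].
Proof.
have -> : [set y] = [set x | (d x y <= 0)%R].
  apply/seteqP; split => x /=; first by move=> ->; rewrite distxx.
  by move=> h; apply/eqP; rewrite -dist_eq0 eq_le h dist_ge0.
exact: measurable_ball_le.
Qed.

Lemma point_null s y : pot s y < +oo -> s [set y] = 0.
Proof.
move=> pf; have my := measurable_point y.
have h : +oo * s [set y] < +oo.
  apply: le_lt_trans pf; rewrite -integral_cst//.
  apply: (@le_trans _ _ (\int[s]_(z in [set y]) K y z)).
    rewrite le_eqVlt; apply/orP; left; apply/eqP; apply: eq_integral => z.
    by rewrite inE => /= ->; rewrite /riesz_kernel eqxx.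
  apply: ge0_subset_integral => //; first exact: measurable_kerl.
  by move=> z _; exact: ker_ge0.
apply/eqP; rewrite eq_le measure_ge0 andbT leNgt; apply/negP => p.
by move: h; rewrite gt0_mulye.
Qed.

Lemma pot_fin_radon s y : pot s y < +oo -> radon_measure s.
Proof.
move=> pf r; set B := [set x | _].
pose L := (d (0%R : 'rV[R]_n) y + `|r| + 1)%R.
have L0 : (0 < L)%R by rewrite ltr_pwDr// addr_ge0 ?dist_ge0.
have mB : measurable B.
  have := @measurable_ball_le R n (0%R : 'rV[R]_n) r.
  by congr measurable; apply/seteqP; split => x /=; rewrite dist_sym.
have c0 : (0 < L `^ (alpha - n%:R))%R by rewrite powR_gt0.
have h : (L `^ (alpha - n%:R))%:E * s B < +oo.
  apply: le_lt_trans pf; rewrite -integral_cst//.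
  apply: (@le_trans _ _ (\int[s]_(z in B) K y z)).
    apply: ge0_le_integral => //.
    - by move=> z _; rewrite lee_fin ltW.
    - by apply: measurable_funTS; exact: measurable_kerl.
    - move=> z zB; rewrite kerE; apply: le_trans (kr_le hn halpha (dist_ge0 y z) (_ : _ <= L)%R).
        by rewrite /kr gt_eqF.
      rewrite /L; have := dist_triangle y (0%R : 'rV[R]_n) z; rewrite (dist_sym y (0%R : 'rV[R]_n)).
      move: zB; rewrite /B/= => h1 h2; have := ler_norm r; lra.
  apply: ge0_subset_integral => //; first exact: measurable_kerl.
  by move=> z _; exact: ker_ge0.
by move: h; case: (s B) => [b||//]; rewrite ?ltry// gt0_muley.
Qed.

Variable y : E.
Local Notation J := (@inversion_at R n y).

Lemma cap_point : cap [set y] <= 0.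
Proof.
apply/lee_addgt0Pr => e e0; rewrite add0e.
have b0 := exponent_gt0 hn halpha.
pose r := ((e `^ be^-1) / 2)%R; have r0 : (0 < r)%R by rewrite divr_gt0// powR_gt0.
apply: (le_trans (@cap_bounded R n alpha hn halpha [set y] y r r0 _)).
  by move=> x /= ->; rewrite distxx ltW.
have -> : (2 * r = e `^ be^-1)%R by rewrite /r mulrC divfK.
by rewrite lee_fin -powRrM mulVf ?gt_eqF// powRr1// ltW.
Qed.

(** Near [y] inversion has no bounded factor, so the image is exhausted by balls, whose preimages
    stay away from [y]; there a finite factor multiplies 0. *)
Lemma cap_inv_null N : cap N <= 0 -> cap (inv_set N y) <= 0.
Proof.
move=> N0; pose F (k : nat) := [set z : E | (d z y <= k.+1%:R)%R].
apply: (@cap_exhaust R n alpha _ F 0%R (lexx 0%R)).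
- by move=> k; exact: measurable_ball_le.
- move=> k l kl; apply/subsetPset => z; rewrite /F /= => h; apply: (le_trans h).
  by rewrite ler_nat ltnS.
- apply/seteqP; split => // z _; exists (Num.truncn (d z y)) => //=.
  by rewrite /F/= ltW// truncnS_gt.
move=> k; have k0 := natinv_gt0 R k.
apply: (@le_trans _ _ (cap (J @` (N `&` [set x | (k.+1%:R^-1 <= d x y)%R])))).
  apply: cap_mono => _ [[x [Nx /eqP xy] <-]]; rewrite /F/= dist_inv// => h.
  exists x => //; split => //=; rewrite -[leRHS]invrK lef_pV2 ?posrE ?invr_gt0 ?dist_gt0//.
have h : N `&` [set x | (k.+1%:R^-1 <= d x y)%R] `<=` [set x | (k.+1%:R^-1 <= d x y)%R].
  by move=> x [].
have := cap_inv hn halpha k0 (lexx 0%R) h; rewrite mulr0; apply.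
by apply: le_trans N0; apply: cap_mono => x [].
Qed.

Lemma cap_addpoint N : cap N <= 0 -> cap ([set y] `|` (N `\ y)) <= 0.
Proof.
move=> N0; have -> : 0 = (0 + 0)%R%:E :> \bar R by rewrite addr0.
apply: (@cap_add R n alpha _ _ [set y]) => //.
- exact: measurable_point.
- exact: cap_point.
- by apply: le_trans N0; apply: cap_mono => x [].
Qed.

Lemma cap0 (N : set E) : (cap N = 0) <-> (cap N <= 0).
Proof.
split => [->//|h]; apply/eqP; rewrite eq_le h; exact: cap_ge0.
Qed.

(* Vanishes at [x = y], where [powR 0] of a nonzero exponent is [0]. *)
Definition rho (x : E) : \bar R := ((d x y) `^ (alpha - n%:R))%:E.

Lemma rho_ge0 x : 0 <= rho x. Proof. by rewrite lee_fin powR_ge0. Qed.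

Lemma rho_center : rho y = 0.
Proof.
have b0 := exponent_gt0 hn halpha.
by rewrite /rho distxx powR0// -oppr_eq0 opprB gt_eqF.
Qed.

Lemma measurable_rho : measurable_fun setT rho.
Proof.
apply/measurable_EFinP; apply: (measurableT_comp (@measurable_powR R _)).
exact: measurable_dist.
Qed.

Lemma rho_mul x : x != y -> rho x * ((d x y) `^ be)%:E = 1.
Proof.
move=> xy; rewrite /rho -EFinM -powRD; last by rewrite dist_eq0 xy implybT.
by rewrite addrA subrK subrr powRr0.
Qed.

Lemma rho_inv x : x != y -> ((d (J x) y) `^ be)%:E = rho x.
Proof.
move=> xy; rewrite dist_inv// -powR_inv1 ?dist_ge0// -powRrM /rho.
by congr ((_ `^ _)%:E); ring.
Qed.

Lemma ker_center x : x != y -> K (J x) y = ((d x y) `^ be)%:E.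
Proof.
move=> xy; rewrite kerE dist_inv// /kr invr_eq0 gt_eqF ?dist_gt0//.
rewrite -powR_inv1 ?dist_ge0// -powRrM.
by congr ((_ `^ _)%:E); ring.
Qed.

Definition kelvin g nu := forall f, measurable_fun setT f -> (forall x, 0 <= f x) ->
  \int[nu]_x f x = \int[g]_x (rho x * f (J x)).

Lemma kelvin_exists g : exists nu, kelvin g nu.
Proof.
have [nu h] := wpush_ex g measurable_rho rho_ge0 (measurable_inversion y).
by exists nu.
Qed.

Lemma off_center s (f : E -> \bar R) : s [set y] = 0 -> measurable_fun setT f ->
  (forall x, 0 <= f x) -> \int[s]_x f x = \int[s]_(x in ~` [set y]) f x.
Proof.
move=> sy mf f0; apply: (@conc_int R n s (~` [set y])) => //.
  by exists [set y]; split => //; [exact: measurable_point|rewrite setCK].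
by apply: measurableC; exact: measurable_point.
Qed.

Lemma measurable_rhoJ w : measurable_fun setT (fun x => rho x * K w (J x)).
Proof.
apply: emeasurable_funM; first exact: measurable_rho.
by apply: measurable_ker => //; exact: measurable_inversion.
Qed.

Section KelvinPotential.
Variables (g nu : M).
Hypotheses (gf : g setT < +oo) (gy : g [set y] = 0) (gn : kelvin g nu).

(** The density [rho] cancels the factor of [ker_inv] at the integration variable, and the factor at
    [w] remains. As [rho] vanishes at [y], mass of [g] there would be lost, hence the hypothesis
    [gy]. *)
Lemma kelvin_pot w : w != y -> pot nu (J w) = ((d w y) `^ be)%:E * pot g w.
Proof.
move=> wy; transitivity (\int[g]_x (rho x * K (J w) (J x))).
  by apply: gn; [exact: measurable_kerl|move=> x; exact: ker_ge0].
transitivity (\int[g]_(x in ~` [set y]) (rho x * K (J w) (J x))).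
  apply: off_center => //; first exact: measurable_rhoJ.
  by move=> x; rewrite mule_ge0 ?rho_ge0 ?ker_ge0.
have -> : pot g w = \int[g]_(x in ~` [set y]) K w x.
  by apply: off_center => //; [exact: measurable_kerl|move=> x; exact: ker_ge0].
transitivity (\int[g]_(x in ~` [set y]) (((d w y) `^ be)%R%:E * K w x)); last first.
  apply: ge0_integralZl_EFin.
  - by apply: measurableC; exact: measurable_point.
  - by move=> x _; exact: ker_ge0.
  - by apply: measurable_funTS; exact: measurable_kerl.
  - exact: powR_ge0.
apply: eq_integral => x; rewrite inE => /= /eqP xy.
rewrite ker_inv// EFinM muleA; congr (_ * _).
by rewrite muleCA rho_mul// mule1.
Qed.

(** Seen from the centre, density and kernel cancel entirely and the integrand is 1. Finiteness at
    this one point makes [nu] a Radon measure. *)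
Lemma kelvin_pot_center : pot nu y = g setT.
Proof.
transitivity (\int[g]_x (rho x * K y (J x))).
  by apply: gn; [exact: measurable_kerl|move=> x; exact: ker_ge0].
transitivity (\int[g]_(x in ~` [set y]) (rho x * K y (J x))).
  apply: off_center => //; first exact: measurable_rhoJ.
  by move=> x; rewrite mule_ge0 ?rho_ge0 ?ker_ge0.
have -> : g setT = \int[g]_(x in ~` [set y]) cst 1 x.
  transitivity (\int[g]_x cst 1 x); first by rewrite integral_cst// mul1e.
  exact: off_center.
apply: eq_integral => x; rewrite inE => /= /eqP xy.
by rewrite ker_sym ker_center// rho_mul.
Qed.

Lemma kelvin_fin : pot nu y < +oo. Proof. by rewrite kelvin_pot_center. Qed.

Lemma kelvin_Mplus : Mplus alpha nu.
Proof.
split; last by exists y; exact: kelvin_fin.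
exact: pot_fin_radon kelvin_fin.
Qed.

(** The factor left over in [kelvin_pot] cancels against the density of the outer integral. *)
Lemma kelvin_energy : energy nu = energy g.
Proof.
have sn : sigma_finite setT nu by apply: radon_sigma_finite; exact: kelvin_Mplus.1.
have mn := measurable_pot alpha sn; have mg := measurable_pot alpha (fin_sigma_finite gf).
transitivity (\int[g]_x (rho x * pot nu (J x))).
  by apply: gn => // x; exact: pot_ge0.
transitivity (\int[g]_(x in ~` [set y]) (rho x * pot nu (J x))).
  apply: off_center => //.
    apply: emeasurable_funM; first exact: measurable_rho.
    exact: (measurableT_comp mn (measurable_inversion y)).
  by move=> x; rewrite mule_ge0 ?rho_ge0 ?pot_ge0.
have -> : energy g = \int[g]_(x in ~` [set y]) pot g x.
  by apply: off_center => // x; exact: pot_ge0.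
apply: eq_integral => x; rewrite inE => /= /eqP xy.
by rewrite kelvin_pot// muleA rho_mul// mul1e.
Qed.

End KelvinPotential.

(* By [pot_kelvin_dual], the Kelvin transform of the potential of [eta]. *)
Definition kelvin_dual eta (w : E) : \bar R :=
  \int[eta]_x (rho x * K w (J x)) + eta [set y].

Lemma radon_point eta : radon_measure eta -> eta [set y] < +oo.
Proof.
move=> re; apply: le_lt_trans (re (d (0%R : 'rV[R]_n) y)).
rewrite le_measure ?inE//; first exact: measurable_point.
  have := @measurable_ball_le R n (0%R : 'rV[R]_n) (d (0%R : 'rV[R]_n) y).
  by congr measurable; apply/seteqP; split => x /=; rewrite (dist_sym x).
by move=> x /= ->.
Qed.

(** The integral falls under [super_int]; an atom of [eta] at [y], whose image would lie at
    infinity, contributes a constant. *)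
Lemma super_kelvin_dual eta : radon_measure eta -> super (kelvin_dual eta).
Proof.
move=> re; have ef := radon_point re.
have [c cE] : exists c, eta [set y] = c%:E.
  by exists (fine (eta [set y])); rewrite fineK// ge0_fin_numE.
have c0 : (0 <= c)%R by rewrite -lee_fin -cE.
have -> : kelvin_dual eta = (fun w => \int[eta]_x (rho x * K w (J x)) + c%:E).
  by apply/funext => w; rewrite /kelvin_dual cE.
apply: super_add; last exact: super_cst.
apply: super_int => //; first exact: radon_sigma_finite.
- exact: measurable_rho.
- exact: rho_ge0.
- exact: measurable_inversion.
Qed.

Lemma pot_kelvin_dual eta w : w != y ->
  pot eta (J w) = ((d w y) `^ be)%:E * kelvin_dual eta w.
Proof.
move=> wy; have my := measurable_point y; have myC := measurableC my.
have mr := measurable_rhoJ w.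
have r0 x : 0 <= rho x * K w (J x) by rewrite mule_ge0 ?rho_ge0 ?ker_ge0.
have I0 : \int[eta]_(x in [set y]) (rho x * K w (J x)) = 0.
  by apply: integral0_eq => x /= ->; rewrite rho_center mul0e.
have h1 : \int[eta]_x (rho x * K w (J x)) = \int[eta]_(x in ~` [set y]) (rho x * K w (J x)).
  transitivity (\int[eta]_(x in [set y] `|` ~` [set y]) (rho x * K w (J x))).
    by rewrite setUv.
  rewrite ge0_integral_setU//; first by rewrite I0 add0e.
  - by rewrite setUv.
  - by apply/disj_setPS => x [].
transitivity (\int[eta]_(x in [set y] `|` ~` [set y]) K (J w) x); first by rewrite setUv.
rewrite ge0_integral_setU//; last 3 first.
- by rewrite setUv; exact: measurable_kerl.
- by move=> x _; exact: ker_ge0.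
- by apply/disj_setPS => x [].
have -> : \int[eta]_(x in [set y]) K (J w) x = ((d w y) `^ be)%:E * eta [set y].
  rewrite -integral_cst//; apply: eq_integral => x; rewrite inE => /= ->.
  by rewrite ker_center.
have -> : \int[eta]_(x in ~` [set y]) K (J w) x =
    ((d w y) `^ be)%:E * \int[eta]_x (rho x * K w (J x)).
  rewrite h1 -ge0_integralZl_EFin ?powR_ge0//; last exact: measurable_funTS.
  apply: eq_integral => x; rewrite inE => /= /eqP xy.
  by rewrite -{1}(inversionK y x) ker_inv ?inv_neq// EFinM rho_inv// muleA.
by rewrite addeC; apply/esym/ge0_muleDr => //; apply: integral_ge0 => x _.
Qed.

Lemma pot_dirac z : pot (\d_ y) z = K z y.
Proof.
rewrite /riesz_potential integral_dirac//; last exact: measurable_kerl.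
by rewrite diracT mul1e.
Qed.

(** At [J w] the potential of the Dirac measure is the same factor [d w y ^ be] as in
    [pot_kelvin_dual], so dividing leaves 1. The exceptional set is inverted, and [y] joins it
    because the hypothesis does not reach that point. *)
Lemma kelvin_dual_class A eta :
  nearly_everywhere alpha (inv_set A y) (fun z => pot (\d_ y) z <= pot eta z) ->
  nearly_everywhere alpha A (fun w => 1 <= kelvin_dual eta w).
Proof.
move=> [N [NA [N0 hN]]].
have invA : inv_set N y `<=` A.
  by move=> _ [_ [/NA[x [Ax _] <-] _] <-]; rewrite inversionK.
exists (A `&` ([set y] `|` (inv_set N y `\ y))); split; first by move=> x [].
split.
  apply/cap0; apply: (@le_trans _ _ (cap ([set y] `|` (inv_set N y `\ y)))).
    by apply: cap_mono => x [].
  by apply: cap_addpoint; apply: cap_inv_null; rewrite N0.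
move=> w Aw nw; have wy : w != y.
  by apply/eqP => wy; apply: nw; split => //; left.
have Jw : inv_set A y (J w) by exists w => //; split => //; exact/eqP.
have nN : ~ N (J w).
  move=> NJ; apply: nw; split => //; right; split; last exact/eqP.
  by exists (J w); [split => //; exact/eqP/inv_neq|rewrite inversionK].
have := hN _ Jw nN; rewrite pot_dirac ker_center// pot_kelvin_dual//.
by rewrite -[leLHS]mule1 lee_pmul2l// lte_fin powR_gt0// dist_gt0.
Qed.

Lemma kelvin_class A g nu : g setT < +oo -> g [set y] = 0 -> kelvin g nu ->
  nearly_everywhere alpha A (fun w => 1 <= pot g w) ->
  nearly_everywhere alpha (inv_set A y) (fun z => pot (\d_ y) z <= pot nu z).
Proof.
move=> gf gy gn [N [NA [N0 hN]]]; exists (inv_set N y); split.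
  by move=> _ [x [/NA Ax xy] <-]; exists x.
split; first by apply/cap0; apply: cap_inv_null; rewrite N0.
move=> _ [w [Aw /eqP wy] <-] nN.
rewrite pot_dirac ker_center// (kelvin_pot gy gn)// -[leLHS]mule1 lee_wpmul2l//.
  by rewrite lee_fin powR_ge0.
by apply: hN => // Nw; apply: nN; exists w => //; split => //; exact/eqP.
Qed.

(** Step laws have no atom at 0, so averages around [y] see only points where the inequality is
    known. As the step size tends to 0 the averaged kernel recovers the kernel off the diagonal, by
    [Kw_far], and Fatou's lemma gives the value at [y]. *)
Lemma pot_le_at s p : sigma_finite setT s -> s [set y] = 0 -> super p ->
  (forall x, x != y -> pot s x <= p x) -> pot s y <= p y.
Proof.
move=> ss sy [p0 lp sp] h.
have e0 j : (0 < j.+1%:R^-1 :> R)%R by exact: natinv_gt0.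
have mKv j : measurable_fun setT (fun z : E => Kv j.+1%:R^-1 (d y z)).
  have mv : measurable_fun setT (Kv (j.+1%:R^-1)) by apply: measurable_Kv.
  by apply: (measurableT_comp mv); exact: measurable_dist.
have Kv0 j z : 0 <= Kv j.+1%:R^-1 (d y z) by exact: Kv_ge0.
have bound j : \int[s]_(z in ~` [set y]) Kv j.+1%:R^-1 (d y z) <= p y.
  have [tau te] := step_ex hn halpha (e0 j); have [t1 tz tK] := te.
  have st := step_sfinite te.
  apply: (@le_trans _ _ (\int[s]_z Kv j.+1%:R^-1 (d y z))).
    by apply: ge0_subset_integral => //; apply: measurableC; exact: measurable_point.
  have -> : \int[s]_z Kv j.+1%:R^-1 (d y z) =
      \int[tau]_u pot s ((y : 'rV[R]_n) + (u : 'rV[R]_n))%R.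
    rewrite (@tonelli_swap R _ _ _ _ tau s
      (fun q : E * E => K ((y : 'rV[R]_n) + (q.1 : 'rV[R]_n))%R q.2))//; last 2 first.
    - apply: measurable_ker; last exact: measurable_snd.
      exact: (measurableT_comp (measurable_addv y) measurable_fst).
    - by move=> q; exact: ker_ge0.
    by apply: eq_integral => z _; rewrite -tK.
  apply: le_trans (sp _ _ (e0 j) te y).
  have tC : concentrated tau (~` [set (0%R : 'rV[R]_n) : E]).
    by exists [set (0%R : 'rV[R]_n) : E]; split => //; [exact: measurable_point|rewrite setCK].
  have m0C : measurable (~` [set (0%R : 'rV[R]_n) : E]).
    by apply: measurableC; exact: measurable_point.
  have mp : measurable_fun setT (fun u : E => p ((y : 'rV[R]_n) + (u : 'rV[R]_n))%R).
    by apply: (measurableT_comp (lsc_measurable lp)); exact: measurable_addv.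
  have mps : measurable_fun setT (fun u : E => pot s ((y : 'rV[R]_n) + (u : 'rV[R]_n))%R).
    by apply: (measurableT_comp (measurable_pot alpha ss)); exact: measurable_addv.
  rewrite (conc_int tC (fun _ => id) m0C mps); last by move=> u; exact: pot_ge0.
  rewrite (conc_int tC (fun _ => id) m0C mp); last by move=> u.
  apply: ge0_le_integral => //.
  - by move=> u _; exact: pot_ge0.
  - exact: measurable_funTS.
  - exact: measurable_funTS.
  - move=> u /= u0; apply: h; apply/eqP => yu; apply: u0.
    by rewrite -(addKr (y : 'rV[R]_n) u) yu addNr.
have myC : measurable (~` [set y]) by apply: measurableC; exact: measurable_point.
have -> : pot s y = \int[s]_(z in ~` [set y]) K y z.
  by apply: off_center => //; [exact: measurable_kerl|move=> z; exact: ker_ge0].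
apply: (@le_trans _ _ (\int[s]_(z in ~` [set y]) limn_einf (fun j => Kv j.+1%:R^-1 (d y z)))).
  apply: ge0_le_integral => //.
  - by move=> z _; exact: ker_ge0.
  - by apply: measurable_funTS; exact: measurable_kerl.
  - under eq_fun do rewrite limn_einf_lim.
    apply: (emeasurable_fun_cvg (fun j z => einfs (fun j => Kv j.+1%:R^-1 (d y z)) j)).
      move=> j; apply: (measurable_fun_einfs (f := fun j z => Kv j.+1%:R^-1 (d y z))).
      by move=> i; exact: measurable_funTS.
    by move=> z _; exact: is_cvg_einfs.
  - move=> z /= zy; rewrite kerE; apply: lee_real_lt => c ck.
    have dp : (0 < d y z)%R by rewrite dist_gt0 eq_sym; apply/eqP.
    have [C [C0 hC]] := Kw_far hn halpha dp.
    have [b cb bk] := ereal_between ck.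
    rewrite limn_einf_lim; apply: lime_ge; first exact: is_cvg_einfs.
    near=> j; apply: le_ereal_inf_tmp => _ [i ji <-].
    have hi : (C * i.+1%:R^-1 <= b - c)%R.
      apply: (@le_trans _ _ (C * j.+1%:R^-1)%R).
        by rewrite ler_wpM2l// lef_pV2 ?posrE ?ltr0n// ler_nat ltnS.
      rewrite ler_pdivrMr// mulrC -ler_pdivrMr ?subr_gt0//.
      apply: (@le_trans _ _ j%:R); last by rewrite ler_nat.
      by near: j; exact: nbhs_infty_ger.
    have := kr_split hn halpha (e0 i) (ltW dp) => ks.
    have hw := hC _ _ (e0 i) (lexx _).
    move: hi hw; set w := (C * i.+1%:R^-1)%R => hi hw; move: hi; clearbody w => hi.
    move: bk hw (Kv0 i z); rewrite ks.
    case: (Kv _ _) => [v||] //; last by move=> *; rewrite leey.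
    move=> bk hw _; rewrite lee_fin.
    have : b%:E < v%:E + w%:E.
      by apply: (lt_le_trans bk); rewrite leeD2l.
    by rewrite -EFinD lte_fin; move: hi; clear; lra.
apply: (le_trans (fatou s myC (fun j => measurable_funTS (mKv j)) (fun j z _ => Kv0 j z))).
rewrite limn_einf_lim; apply: lime_le; first exact: is_cvg_einfs.
apply: nearW => j; apply: ge_ereal_inf.
exists (\int[s]_(z in ~` [set y]) Kv j.+1%:R^-1 (d y z)); last exact: bound.
by exists j => /=.
Unshelve. all: end_near. Qed.

(** Off [y] both potentials arise from the given inequality by the same factor; the value at [y] is
    recovered by [pot_le_at]. *)
Lemma kelvin_le g nu eta : g setT < +oo -> g [set y] = 0 -> kelvin g nu -> Mplus alpha eta ->
  (forall x, pot g x <= kelvin_dual eta x) -> forall x, pot nu x <= pot eta x.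
Proof.
move=> gf gy gn [re _] h.
have off x : x != y -> pot nu x <= pot eta x.
  move=> xy; have := kelvin_pot gy gn (inv_neq xy); have := pot_kelvin_dual eta (inv_neq xy).
  rewrite !inversionK => -> ->; rewrite lee_wpmul2l//.
  by rewrite lee_fin powR_ge0.
move=> x; have [->|xy] := eqVneq x y; last exact: off.
apply: pot_le_at off.
- by apply: radon_sigma_finite; exact: (kelvin_Mplus gf gy gn).1.
- by apply: point_null; exact: (kelvin_fin gf gy gn).
- by apply: super_pot => //; exact: radon_sigma_finite.
Qed.

End Kelvin.

(** * Finite capacity and finite energy of the balayage *)

Section Balayage.
Local Open Scope ereal_scope.
Variables (R : realType) (n : nat) (alpha : R).
Hypotheses (hn : (3 <= n)%N) (halpha : (0 < alpha <= 2)%R).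
Local Notation E := (Rn R n).
Local Notation d := (@eucl_dist R n).
Local Notation pot := (riesz_potential alpha).
Local Notation energy := (riesz_energy alpha).
Local Notation cap := (inner_capacity alpha).
Local Notation super := (super alpha).
Local Notation M := {measure set E -> \bar R}.
Implicit Types (g nu : M).

Lemma equilibrium A : cap A < +oo -> exists g : M,
  [/\ g setT < +oo,
    forall p, super p -> nearly_everywhere alpha A (fun z => 1 <= p z) -> forall x, pot g x <= p x &
    nearly_everywhere alpha A (fun z => 1 <= pot g z)].
Proof.
have [->//|[c c0 cA] _] := cap_cases alpha A.
have [cz|cn] := eqVneq c 0%R.
  exists (mzero : M); split.
  - exact: (ltry 0).
  - by move=> p [p0 _ _] _ x; rewrite /riesz_potential integral_measure_zero.
  - by exists A; split => //; split => //; rewrite cA cz.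
have cp : (0 < c)%R by rewrite lt0r cn.
have [g [gc ga gb]] := equilibrium_pos hn halpha cp cA.
by exists g; split => //; rewrite (le_lt_trans gc)// ltry.
Qed.

(** The Kelvin transform of the equilibrium measure belongs to the class defining the balayage and
    lies below all its members, so it attains the infimum. Its energy is that of the equilibrium
    measure, at most the mass. *)
Lemma cap_fin_balayage A y : cap A < +oo -> exists nu : M,
  is_balayage alpha (\d_ y) (inv_set A y) nu /\ energy nu < +oo.
Proof.
move=> /equilibrium[g [gf gle gge]].
(* The constant 1 is itself an admissible superharmonic majorant, with empty exceptional set. *)
have g1 x : pot g x <= 1.
  apply: (gle (fun=> 1)); first exact: (@super_cst R n alpha 1%R ler01).
  exists set0; split => //; split => //; apply/cap0.
  by apply: (le_trans _ (cap_point hn halpha y)); apply: cap_mono.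
have gy : g [set y] = 0 by apply: (point_null (alpha := alpha)); rewrite (le_lt_trans (g1 y))// ltry.
have [nu gn] := kelvin_exists alpha y g.
exists nu; split; last first.
  rewrite (kelvin_energy hn halpha gf gy gn).
  apply: (@le_lt_trans _ _ (\int[g]_x cst 1 x)); last by rewrite integral_cst// mul1e.
  apply: ge0_le_integral => //.
  - by move=> x _; exact: pot_ge0.
  - by apply: measurable_pot; exact: fin_sigma_finite.
  - by move=> x _; exact: g1.
have nM := kelvin_Mplus hn halpha gf gy gn.
split => // x; apply/eqP; rewrite eq_le; apply/andP; split.
  apply: le_ereal_inf_tmp => _ [eta [eM hE] <-].
  apply: (kelvin_le hn halpha gf gy gn eM) => z; apply: gle.
    by apply: super_kelvin_dual => //; exact: eM.1.
  exact: kelvin_dual_class.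
apply: ereal_inf_lbound; exists nu => //; split => //.
exact: (kelvin_class hn halpha gf).
Qed.

(** The truncations of [A] to balls have finite capacity. Kelvin transforms of their
    near-equilibrium measures lie below every competitor for the balayage of [A], hence below the
    balayage; comparing energies bounds the truncated capacities by the energy of [nu], uniformly in
    the radius. *)
Lemma balayage_cap_fin A y nu : is_balayage alpha (\d_ y) (inv_set A y) nu ->
  energy nu < +oo -> cap A < +oo.
Proof.
move=> [nM nE] ef; have snu := radon_sigma_finite nM.1.
have [b bE] : exists b, energy nu = b%:E.
  by exists (fine (energy nu)); rewrite fineK// ge0_fin_numE ?energy_ge0.
have b0 : (0 <= b)%R by rewrite -lee_fin -bE energy_ge0.
apply: (@le_lt_trans _ _ b%:E); last exact: ltry.
pose F (k : nat) := [set x : E | (d x y <= k%:R)%R].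
apply: (@cap_exhaust R n alpha A F b b0).
- by move=> k; exact: measurable_ball_le.
- move=> k l kl; apply/subsetPset => z; rewrite /F /= => h; apply: (le_trans h).
  by rewrite ler_nat.
- apply/seteqP; split => // z _; exists (Num.truncn (d z y)).+1 => //=.
  by rewrite /F/= ltW// truncnS_gt.
move=> k; set Ak := A `&` F k.
have : cap Ak < +oo by apply: (@cap_fin_bounded R n alpha hn halpha _ y k%:R) => x [].
have [->//|[c c0 cE] _] := cap_cases alpha Ak.
have [cz|cn] := eqVneq c 0%R; first by rewrite cE cz lee_fin.
have cp : (0 < c)%R by rewrite lt0r cn.
rewrite cE lee_fin.
have key dl : (0 < dl)%R -> (3 * dl < 1)%R -> (c * (1 - 3 * dl) ^+ 2 <= b)%R.
  move=> d0 d1; have [g [m [gT /andP[m1 m2] ge [B [mB gB hB]]]]] := near_equilibrium cp cE d0 d1.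
  have gf : g setT < +oo by rewrite gT ltry.
  have gef : energy g < +oo by rewrite (le_lt_trans ge)// ltry.
  have gAk := concentrated_sub (@subIsetl _ Ak B) gB.
  have gy : g [set y] = 0.
    apply: (energy_null (conc_setT g) gf gef (measurable_point y)).
    by rewrite setTI; exact: cap_point.
  have [nu' gn] := kelvin_exists alpha y g.
  have nM' := kelvin_Mplus hn halpha gf gy gn.
  have snu' := radon_sigma_finite nM'.1.
  have le_eta eta : Mplus alpha eta ->
      nearly_everywhere alpha (inv_set A y) (fun z => pot (\d_ y) z <= pot eta z) ->
      forall x, pot nu' x <= pot eta x.
    move=> eM hE; apply: (kelvin_le hn halpha gf gy gn eM).
    apply: (near_eq_le hn halpha gB gf gef hB).
      by apply: super_kelvin_dual => //; exact: eM.1.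
    have [N [NA [N0 hN]]] := kelvin_dual_class hn halpha hE.
    exists (N `&` F k); split; first by move=> x [/NA Ax Fx].
    split; last by move=> x [Ax Fx] nN; apply: hN => // Nx; apply: nN.
    by apply/cap0; rewrite -N0; apply: cap_mono => x [].
  have le_nu x : pot nu' x <= pot nu x.
    rewrite nE; apply: le_ereal_inf_tmp => _ [eta [eM hE] <-].
    exact: le_eta.
  have mnu := measurable_pot alpha snu; have mnu' := measurable_pot alpha snu'.
  have ele : energy g <= b%:E.
    rewrite -(kelvin_energy hn halpha gf gy gn) -bE.
    (* The pointwise inequality of potentials is used once in each variable, with the symmetry of
       the mutual energy in between. *)
    apply: (@le_trans _ _ (mutual_energy alpha nu' nu)).
      apply: ge0_le_integral => // x _; do 1?[exact: pot_ge0|exact: le_nu].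
    rewrite (mutual_sym alpha snu' snu).
    apply: ge0_le_integral => // x _; do 1?[exact: pot_ge0|exact: le_nu].
  have [h _] := cap_leP alpha Ak c0.
  have := h _ g gAk gf gef; rewrite cE lexx gT /= => /(_ isT) h2.
  have h3 : (fine (energy g) <= b)%R.
    by rewrite -lee_fin fineK// ge0_fin_numE ?energy_ge0.
  have q0 : (0 <= c * (1 - 3 * dl))%R by rewrite mulr_ge0// subr_ge0 ltW.
  have h4 : ((c * (1 - 3 * dl)) ^+ 2 <= c * b)%R.
    apply: (@le_trans _ _ (m ^+ 2))%R.
      by rewrite ler_pXn2r// nnegrE// (le_trans q0).
    by rewrite (le_trans h2)// ler_wpM2l.
  by move: h4; rewrite exprMn expr2 -mulrA ler_pM2l.
apply/ler_addgt0Pr => e e0.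
(* The first bound gives [3 * dl < 1], the second makes the first-order loss [6 * c * dl] at most
   [e]. *)
pose dl : R := (Num.min 6^-1 (e / (6 * c)))%R.
have d0 : (0 < dl)%R by rewrite lt_min invr_gt0 ltr0n/= divr_gt0// mulr_gt0.
have d1 : (dl <= 6^-1)%R by rewrite ge_min lexx.
have d2 : (dl * (6 * c) <= e)%R.
  by rewrite -ler_pdivlMr ?mulr_gt0// ge_min lexx orbT.
have d3 : (3 * dl < 1)%R.
  by apply: (@le_lt_trans _ _ (3 * 6^-1))%R; [rewrite ler_pM2l|rewrite ltr_pdivrMr// mul1r ltr_nat].
have := key dl d0 d3.
have := mulr_ge0 c0 (sqr_ge0 (3 * dl)%R).
have -> : (c * (1 - 3 * dl) ^+ 2 = c - dl * (6 * c) + c * (3 * dl) ^+ 2)%R by ring.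
lra.
Qed.

End Balayage.

Unset Implicit Arguments.
Theorem mainTheorem6 (R : realType) (n : nat) (alpha : R)
  (hn : (3 <= n)%N) (halpha : 0 < alpha <= 2)
  (A : set (Rn R n)) (q1 q2 : R) (hq1 : 1 < q1) (hq2 : 0 < q2 < 1) :
  let c := @inner_capacity R n alpha in
  (* (ii_1) *)
  let P2 := fun y : Rn R n =>
    (\sum_(k <oo) c (A `&` [set x | (q1 ^+ k <= eucl_dist x y < q1 ^+ k.+1)%R]) < +oo)%E in
  (* (iii_1) *)
  let P3 := fun y : Rn R n =>
    exists nu : {measure set Rn R n -> \bar R},
      is_balayage alpha (\d_ y) (inv_set A y) nu /\ (riesz_energy alpha nu < +oo)%E in
  (* (iv_1) *)
  let P4 := fun y : Rn R n =>
    (\sum_(k <oo)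
       (c (inv_set A y `&` [set x | (q2 ^+ k.+1 < eucl_dist x y <= q2 ^+ k)%R])
        * ((powR q2 (2 * k%:R * (n%:R - alpha))%R)^-1)%:E) < +oo)%E in
  (* (i_1) *)
  let P1 := (c A < +oo)%E in
  ((P1 <-> exists y, P2 y) /\ (P1 <-> forall y, P2 y)) /\
  ((P1 <-> exists y, P3 y) /\ (P1 <-> forall y, P3 y)) /\
  ((P1 <-> exists y, P4 y) /\ (P1 <-> forall y, P4 y)).
Proof.
move=> c P2 P3 P4 P1.
have h12 y : P1 <-> P2 y.
  by split=> h; [exact: (annuli_cap_fin hn halpha y hq1 h)|exact: (cap_fin_annuli hn halpha hq1 h)].
have h13 y : P1 <-> P3 y.
  split=> h; first exact: (cap_fin_balayage hn halpha y h).
  by case: h => nu [nuB nuE]; exact: (balayage_cap_fin hn halpha nuB nuE).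
have h14 y : P1 <-> P4 y.
  have q2i : 1 < q2^-1 by have /andP[q20 q21] := hq2; rewrite invf_gt1.
  have w := wiener_equiv hn halpha A y hq2.
  split=> h; first by apply/w; exact: (annuli_cap_fin hn halpha y q2i h).
  by apply: (cap_fin_annuli hn halpha q2i); apply/w; exact: h.
(* Each condition has been matched with finite capacity at every single [y], so existence and
   universality coincide; the origin serves as the witness. *)
have equiv (P : Rn R n -> Prop) : (forall y, P1 <-> P y) ->
    (P1 <-> exists y, P y) /\ (P1 <-> forall y, P y).
  move=> h; split; split => [p|].
  - by exists (0 : 'rV[R]_n); apply/h.
  - by case=> y /h.
  - by move=> y; apply/h.
  - by move/(_ (0 : 'rV[R]_n))/h.
by split; [exact: equiv|split; exact: equiv].
Qed.
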